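(* Let $\Omega\subset\mathbb{R}^2$ be an open bounded convex set with polygonal boundary and let $\mathcal{T}$ be a conformal triangular mesh of $\Omega$, all of whose angles satisfy $0<\theta_{K,i}<\pi/2$ ($K\in\mathcal{T}^2$, $i=1,2,3$). Let $g:(0,1)\to\mathbb{R}$ be integrable with $$\int_0^1 g(s)\,ds=1,\qquad \int_0^1 g(s)s^2\,ds=0,\qquad g(s)=g(1-s),$$ and for $K\in\mathcal{T}^2$, $i=1,2,3$, define $g_{K,i}:a_{K,i}\to\mathbb{R}$ by $g_{K,i}(x)=g(s)/|a_{K,i}|$ for $x=sS_{K,i}+(1-s)N_{K,i}$, where $S_{K,i},N_{K,i}$ are the endpoints of the edge $a_{K,i}$. For each $K\in\mathcal{T}^2$ let $\delta_K\in L^2(K)$ satisfy $$\int_K\delta_K\,dx=1,\qquad \int_K\delta_K(x)\,|x-W_{K,i}|^2\,dx=0\quad (i=1,2,3).$$ Let $(\varphi^\star_{K,i})_{K\in\mathcal{T}^2,\ i=1,2,3}$ be a family of vector fields on $\Omega$ such that, for each $K$ and $i$, $\varphi^\star_{K,i}|_K\in H(\mathrm{div},K)$, $\varphi^\star_{K,i}=0$ outside $K$, $\mathrm{div}\,\varphi^\star_{K,i}=\delta_K$ on $K$ (the same $\delta_K$ for $i=1,2,3$), and, with $n$ the unit normal on $\partial K$ pointing outwards $K$, $\varphi^\star_{K,i}\cdot n=g_{K,i}$ on $a_{K,i}$ and $\varphi^\star_{K,i}\cdot n=0$ on $\partial K\setminus a_{K,i}$. Define $(\varphi^\star_a)_{a\in\mathcal{T}^1}$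 by $$\varphi^\star_a=\varphi^\star_{K,i}-\varphi^\star_{L,j}\ \text{ if } a\in\mathcal{T}^1_i,\ \partial^c a=(K,L),\ a=a_{K,i}=a_{L,j};\qquad \varphi^\star_a=\varphi^\star_{K,i}\ \text{ if } a\in\mathcal{T}^1_b,\ \partial^c a=(K),\ a=a_{K,i}.$$ Then: 1. $(\varphi^\star_a)_{a\in\mathcal{T}^1}$ is a Raviart–Thomas dual basis. 2. The coefficients $(\varphi_a^\star,\varphi_a)_0$ depend only on the geometry of the mesh: $$(\varphi^\star_a,\varphi_a)_0=\tfrac12\left(\cot\theta_{a,K}+\cot\theta_{a,L}\right)\ \text{ if } a\in\mathcal{T}^1_i,\ \partial^c a=(K,L);\qquad (\varphi^\star_a,\varphi_a)_0=\tfrac12\cot\theta_{a,K}\ \text{ if } a\in\mathcal{T}^1_b,\ \partial^c a=(K).$$ 3. For every $f\in L^2(\Omega)$, the mixed Petrov–Galerkin discrete problem for the Poisson equation $-\Delta u=f$ in $\Omega$, $u=0$ on $\partial\Omega$, associated with $(\varphi^\star_a)_{a\in\mathcal{T}^1}$ has a unique solution $(u,p)\in P^0\times RT$, and it coincides with the VF4 scheme: $(u,p)$ is a solution if and only if $u=\sum_K u_K 1_K$ is a solution of the VF4 scheme and $p=\sum_{a}p_a\varphi_a$, where the $p_a$ are the VF4 fluxes associated with $u$.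
   Context: Mesh notation. For a conformal triangular mesh $\mathcal{T}$ of $\Omega$, $\mathcal{T}^1$ and $\mathcal{T}^2$ are the sets of edges and of triangles. $|K|$ is the area of $K\in\mathcal{T}^2$ and $|a|$ the length of $a\in\mathcal{T}^1$. The edges of $K$ are $a_{K,i}$, $i=1,2,3$; $W_{K,i}$ and $\theta_{K,i}$ are the vertex and the angle of $K$ opposite to $a_{K,i}$. If $a$ is an edge of $K$, $\theta_{a,K}$ is the angle of $K$ opposite to $a$. $\mathcal{T}^1_b$ is the set of edges contained in $\partial\Omega$ and $\mathcal{T}^1_i=\mathcal{T}^1\setminus\mathcal{T}^1_b$. Each edge $a$ has a fixed unit normal $n_a$. For $a\in\mathcal{T}^1_i$, $\partial^c a=(K,L)$ means that $a\subset\partial K\cap\partial L$ and $n_a$ points from $K$ towards $L$. For $a\in\mathcal{T}^1_b$, $\partial^c a=(K)$ means that $a\subset\partial K$, and $n_a$ points outwards $\Omega$. Function spaces. $(\cdot,\cdot)_0$ is the $L^2$ scalar product on $L^2(\Omega)$ and on $[L^2(\Omega)]^2$. $P^0$ is the space of functions that are constant on each triangle of $\mathcal{T}$; $u\in P^0$ is written $u=\sum_{K}u_K1_K$ with $1_K$ the indicator function of $K$. $RT\subset H(\mathrm{div},\Omega)$ is the lowest order (order 0) Raviart–Thomas space on $\mathcal{T}$, with basis $(\varphi_a)_{a\in\mathcal{T}^1}$ determined by $\int_b\varphi_a\cdot n_b\,ds=\delta_{ab}$ for all $b\in\mathcal{T}^1$. Equivalently, with $\varphi_{K,i}(x)=\frac{1}{4|K|}\nabla|x-W_{K,i}|^2=\frac{x-W_{K,i}}{2|K|}$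 on $K$ and $0$ outside $K$, $\varphi_a=\varphi_{K,i}-\varphi_{L,j}$ if $\partial^c a=(K,L)$, $a=a_{K,i}=a_{L,j}$, and $\varphi_a=\varphi_{K,i}$ if $\partial^c a=(K)$, $a=a_{K,i}$. Normal traces. Saying that a field $\psi\in H(\mathrm{div},K)$ has normal trace $\psi\cdot n=h$ on $\partial K$, with $h$ integrable on $\partial K$, means $\int_K(\psi\cdot\nabla w+w\,\mathrm{div}\,\psi)\,dx=\int_{\partial K}w\,h\,ds$ for all $w\in C^1(\overline K)$. Raviart–Thomas dual basis. A family $(\varphi^\star_a)_{a\in\mathcal{T}^1}$ of vector fields in $H(\mathrm{div},\Omega)$ (with integrable normal traces on the boundary of each triangle) is a Raviart–Thomas dual basis if: $(\varphi^\star_a,\varphi_a)_0\neq0$ for all $a\in\mathcal{T}^1$; $(\varphi^\star_a,\varphi_b)_0=0$ for all $a\neq b$ in $\mathcal{T}^1$; $\mathrm{Supp}(\varphi^\star_a)\subset\mathrm{Supp}(\varphi_a)$ for all $a$; and $\int_b\varphi^\star_a\cdot n_b\,ds=\delta_{ab}$ for all $a,b\in\mathcal{T}^1$. Mixed Petrov–Galerkin problem. Set $RT^\star=\mathrm{Span}(\varphi^\star_a,\ a\in\mathcal{T}^1)$. The problem is: find $(u,p)\in P^0\times RT$ such that for all $(v,q)\in P^0\times RT^\star$, $(p,q)_0+(u,\mathrm{div}\,q)_0=0$ and $-(\mathrm{div}\,p,v)_0=(f,v)_0$. VF4 scheme. On a mesh with all angles in $(0,\pi/2)$, let $x_K$ be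 the circumcenter of $K$; set $d_a=|x_K-x_L|$ if $\partial^c a=(K,L)$ and $d_a=\mathrm{dist}(x_K,a)$ if $\partial^c a=(K)$. For $u\in P^0$ the VF4 fluxes are $p_a=\frac{|a|}{d_a}(u_L-u_K)$ if $\partial^c a=(K,L)$ and $p_a=-\frac{|a|}{d_a}u_K$ if $\partial^c a=(K)$. The VF4 scheme is: find $u\in P^0$ such that for every $K\in\mathcal{T}^2$, $-\sum_{a\subset\partial K}(n_a\cdot n_{K,a})\,p_a=\int_K f\,dx$, where $n_{K,a}$ is the unit normal to $a$ pointing outwards $K$. *)

(* Defs.v *)
From HB Require Import structures.
From mathcomp Require Import all_boot all_order all_algebra.
From mathcomp Require Import all_classical all_reals all_analysis.
Set Implicit Arguments.
Unset Strict Implicit.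
Unset Printing Implicit Defensive.
Import Order.TTheory GRing.Theory Num.Theory.
Import numFieldNormedType.Exports.
Local Open Scope classical_set_scope.
Local Open Scope ring_scope.

Section Plane.
Variable R : realType.

(* The norm that MathComp-Analysis puts on [R * R] is the sup norm; lengths and
   distances are Euclidean, hence [dot] and [enorm]. *)
Definition dot (x y : R * R) : R := x.1 * y.1 + x.2 * y.2.
Definition enorm (x : R * R) : R := Num.sqrt (dot x x).
Definition cross (x y : R * R) : R := x.1 * y.2 - x.2 * y.1.

Definition edist_set (x : R * R) (A : set (R * R)) : R :=
  inf [set r | exists2 y, A y & r = enorm (x - y)].

Definition segment (x y : R * R) : set (R * R) :=
  [set z | exists2 s : R, 0 <= s <= 1 & z = s *: x + (1 - s) *: y].

Definition hull3 (w : 'I_3 -> R * R) : set (R * R) :=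
  [set x | exists l : 'I_3 -> R,
     [/\ forall i, 0 <= l i, \sum_i l i = 1 & x = \sum_i l i *: w i]].

Definition bdry (A : set (R * R)) : set (R * R) := closure A `\` A°.

Definition polygonal_bdry (A : set (R * R)) : Prop :=
  exists l : seq ((R * R) * (R * R)),
    bdry A = [set z | exists2 e, e \in l & segment e.1 e.2 z].

Definition cot (t : R) : R := cos t / sin t.

Definition mu2 : {measure set (measurableTypeR R * measurableTypeR R) -> \bar R}
  := (lebesgue_measure \x lebesgue_measure)%E.

Definition L2 (D : set (R * R)) (f : R * R -> R) : Prop :=
  measurable_fun (D : set (measurableTypeR R * measurableTypeR R)) f /\
  mu2.-integrable D (fun x => (f x ^+ 2)%:E).

Definition L2v (D : set (R * R)) (psi : R * R -> R * R) : Prop :=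
  L2 D (fun x => (psi x).1) /\ L2 D (fun x => (psi x).2).

Definition ip (D : set (R * R)) (f g : R * R -> R) : R :=
  \int[mu2]_(x in D) (f x * g x).
Definition ipv (D : set (R * R)) (f g : R * R -> R * R) : R :=
  \int[mu2]_(x in D) dot (f x) (g x).

Definition grad (w : R * R -> R) (x : R * R) : R * R :=
  ('D_((1, 0) : R * R) w x, 'D_((0, 1) : R * R) w x).

Definition C1 (w : R * R -> R) : Prop :=
  [/\ forall x, derivable w x ((1, 0) : R * R),
      forall x, derivable w x ((0, 1) : R * R),
      continuous (fun x : R * R => 'D_((1, 0) : R * R) w x) &
      continuous (fun x : R * R => 'D_((0, 1) : R * R) w x)].

Definition C1c (D : set (R * R)) (w : R * R -> R) : Prop :=
  C1 w /\ exists C : set (R * R),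
    [/\ compact C, C `<=` D & forall x, ~ C x -> w x = 0].

(* [is_div D psi d]: psi lies in H(div, D), D open, and its distributional
   divergence is (the class of) d. *)
Definition is_div (D : set (R * R)) (psi : R * R -> R * R) (d : R * R -> R)
    : Prop :=
  [/\ L2v D psi, L2 D d &
      forall w, C1c D w ->
        \int[mu2]_(x in D) (dot (psi x) (grad w x) + w x * d x) = 0].

Definition Hdiv (D : set (R * R)) (psi : R * R -> R * R) : Prop :=
  exists d, is_div D psi d.

(* A representative of the divergence; it is determined only up to a null set,
   and is used only under integral signs. *)
Definition wdiv (D : set (R * R)) (psi : R * R -> R * R) : R * R -> R :=
  xget (fun=> 0) [set d | is_div D psi d].

(* Support of an L^2 field, regarded as a class modulo null sets. *)
Definition esupp (psi : R * R -> R * R) : set (R * R) :=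
  [set x | forall U, nbhs x U ->
     ~ mu2.-negligible (U `&` [set y | psi y <> 0])].

End Plane.

(* Vertex [i] of [K] is opposite to edge [i]; indices are taken modulo 3, so
   edge [i] joins the vertices [i + 1] and [i + 2]. *)
Record mesh (R : realType) (Omega : set (R * R)) := Mesh {
  vtx : finType;
  tri : finType;
  pos : vtx -> R * R;
  vert : tri -> 'I_3 -> vtx;
  pos_inj : injective pos;
  vert_nondegenerate : forall K,
    cross (pos (vert K 1) - pos (vert K 0))
          (pos (vert K 2%:R) - pos (vert K 0)) != 0;
  mesh_cover : closure Omega =
    \bigcup_(K in [set: tri]) hull3 (fun i => pos (vert K i));
  mesh_conformal :
    let ctri K := hull3 (fun i => pos (vert K i)) in
    forall K L, K != L ->
    [\/ ctri K `&` ctri L = set0,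
        exists i j, vert K i = vert L j /\
          ctri K `&` ctri L = [set pos (vert K i)] |
        exists i j,
          [set vert K (i + 1); vert K (i + 2%:R)]%SET =
          [set vert L (j + 1); vert L (j + 2%:R)]%SET /\
          ctri K `&` ctri L =
            segment (pos (vert K (i + 1))) (pos (vert K (i + 2%:R)))]
}.

Section Mesh.
Variables (R : realType) (Omega : set (R * R)) (M : mesh Omega).
Local Notation tri := (tri M).
Local Notation vtx := (vtx M).
Implicit Types (K L : tri) (i j : 'I_3) (a b : {set vtx}).

Definition W K i : R * R := pos (vert K i).
(* The end points S_(K,i), N_(K,i) of edge [i] of [K]. *)
Definition eS K i : R * R := W K (i + 1).
Definition eN K i : R * R := W K (i + 2%:R).

(* Triangles are open: positive barycentric coordinates. *)
Definition otri K : set (R * R) :=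
  [set x | exists l : 'I_3 -> R,
     [/\ forall i, 0 < l i, \sum_i l i = 1 & x = \sum_i l i *: W K i]].

Definition area K : R := fine (mu2 R (otri K)).

Definition angle K i : R :=
  acos (dot (eS K i - W K i) (eN K i - W K i) /
        (enorm (eS K i - W K i) * enorm (eN K i - W K i))).

(* An edge is represented by the set of its two end vertices. *)
Definition edge K i : {set vtx} := [set vert K (i + 1); vert K (i + 2%:R)]%SET.
Definition edges : {set {set vtx}} :=
  [set edge Ki.1 Ki.2 | Ki : tri * 'I_3]%SET.

Definition edge_seg a : set (R * R) :=
  [set x | exists v w, [/\ v \in a, w \in a & segment (pos v) (pos w) x]].

Definition bedge a : Prop := a \in edges /\ edge_seg a `<=` bdry Omega.
Definition iedge a : Prop := a \in edges /\ ~ edge_seg a `<=` bdry Omega.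

Definition elen K i : R := enorm (eS K i - eN K i).

(* Unit normal to edge [i] of [K] pointing outwards [K]: the edge vector rotated
   by a right angle, with the sign that makes it point away from [W K i]. *)
Definition outnormal K i : R * R :=
  let t := eS K i - eN K i in
  let r : R * R := (t.2, - t.1) in
  (- Num.sg (dot r (W K i - eN K i)) / enorm t) *: r.

Definition edge_normals (n : {set vtx} -> R * R) : Prop :=
  (forall a v w, a \in edges -> v \in a -> w \in a ->
     enorm (n a) = 1 /\ dot (n a) (pos v - pos w) = 0) /\
  (forall K i, bedge (edge K i) -> n (edge K i) = outnormal K i).

Section Oriented.
Variable n : {set vtx} -> R * R.

(* [dc2 a K i L j]: a is interior, (K, L) is its oriented coboundary, and a is
   edge i of K and edge j of L.  [dc1 a K i]: the same on the boundary. *)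
Definition dc2 a K i L j : Prop :=
  [/\ iedge a, K != L, a = edge K i, a = edge L j & n a = outnormal K i].
Definition dc1 a K i : Prop :=
  [/\ bedge a, a = edge K i & n a = outnormal K i].

(* The edge fields [phi a] are assembled from the local fields [loc K i]. *)
Definition assembled (loc : tri -> 'I_3 -> R * R -> R * R)
    (phi : {set vtx} -> R * R -> R * R) : Prop :=
  (forall a K i L j, dc2 a K i L j ->
     phi a = (fun x => loc K i x - loc L j x)) /\
  (forall a K i, dc1 a K i -> phi a = loc K i).

Definition rt_local K i (x : R * R) : R * R :=
  \1_(otri K) x *: ((2 * area K)^-1 *: (x - W K i)).

Definition edge_param K i (s : R) : R * R := s *: eS K i + (1 - s) *: eN K i.

Definition edge_int K i (h : R * R -> R) : R :=
  elen K i * \int[lebesgue_measure]_(s in `]0%R, 1%R[) h (edge_param K i s).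

Definition bdry_int K (h : R * R -> R) : R := \sum_i edge_int K i h.

Definition normal_trace K (psi : R * R -> R * R) (h : R * R -> R) : Prop :=
  [/\ Hdiv (otri K) psi,
      forall i, lebesgue_measure.-integrable `]0%R, 1%R[
                  (fun s : R => (h (edge_param K i s))%:E) &
      forall w, C1 w ->
        \int[mu2 R]_(x in otri K)
           (dot (psi x) (grad w x) + w x * wdiv (otri K) psi x) =
        bdry_int K (fun x => w x * h x)].

(* The flux of a field through [b] is read off from its normal trace on the
   boundary of either triangle adjacent to [b], [dot (n b) (outnormal K i)] being
   the relative orientation. *)
Definition rt_dual_basis (phi phiS : {set vtx} -> R * R -> R * R) : Prop :=
  [/\ forall a, a \in edges -> Hdiv Omega (phiS a),
      forall a, a \in edges -> ipv Omega (phiS a) (phi a) != 0,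
      forall a b, a \in edges -> b \in edges -> a != b ->
        ipv Omega (phiS a) (phi b) = 0,
      forall a, a \in edges -> esupp (phiS a) `<=` esupp (phi a) &
      forall a, a \in edges ->
        exists h : tri -> R * R -> R,
          (forall K, normal_trace K (phiS a) (h K)) /\
          (forall b K i, b = edge K i ->
             dot (n b) (outnormal K i) * edge_int K i (h K) = (a == b)%:R)].

Definition P0_of (c : tri -> R) : R * R -> R :=
  fun x => \sum_K c K * \1_(otri K) x.

Definition P0 : set (R * R -> R) := [set u | exists c, u = P0_of c].

Definition lincomb (phi : {set vtx} -> R * R -> R * R) (c : {set vtx} -> R)
    : R * R -> R * R :=
  fun x => \sum_(a in edges) c a *: phi a x.

Definition span_edges (phi : {set vtx} -> R * R -> R * R)
    : set (R * R -> R * R) := [set p | exists c, p = lincomb phi c].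

(* With [phi] the Raviart-Thomas basis, [span_edges phi] is RT and
   [span_edges phiS] is the test space. *)
Definition petrov_galerkin (phi phiS : {set vtx} -> R * R -> R * R)
    (f u : R * R -> R) (p : R * R -> R * R) : Prop :=
  [/\ P0 u, span_edges phi p &
      forall v q, P0 v -> span_edges phiS q ->
        ipv Omega p q + ip Omega u (wdiv Omega q) = 0 /\
        - ip Omega (wdiv Omega p) v = ip Omega f v].

Definition circumcenters (xc : tri -> R * R) : Prop :=
  forall K i j, enorm (xc K - W K i) = enorm (xc K - W K j).

Definition vf4_dist (xc : tri -> R * R) (d : {set vtx} -> R) : Prop :=
  (forall a K i L j, dc2 a K i L j -> d a = enorm (xc K - xc L)) /\
  (forall a K i, dc1 a K i -> d a = edist_set (xc K) (edge_seg a)).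

Definition vf4_fluxes (d : {set vtx} -> R) (u : tri -> R)
    (p : {set vtx} -> R) : Prop :=
  (forall a K i L j, dc2 a K i L j -> p a = elen K i / d a * (u L - u K)) /\
  (forall a K i, dc1 a K i -> p a = - (elen K i / d a) * u K).

Definition vf4_scheme (f : R * R -> R) (p : {set vtx} -> R) : Prop :=
  forall K, - (\sum_i dot (n (edge K i)) (outnormal K i) * p (edge K i)) =
            \int[mu2 R]_(x in otri K) f x.

End Oriented.
End Mesh.

(* Main.v *)
Require Import Defs.
From HB Require Import structures.
From mathcomp Require Import all_boot all_order all_algebra.
From mathcomp Require Import all_classical all_reals all_analysis.
From mathcomp Require Import measurable_realfun ring lra.
Import Order.TTheory GRing.Theory Num.Theory.
Import numFieldNormedType.Exports.
Set Implicit Arguments.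
Unset Strict Implicit.
Unset Printing Implicit Defensive.
Local Open Scope classical_set_scope.
Local Open Scope ring_scope.

(** The local Raviart-Thomas field is the gradient of [|x - W|^2 / (4|K|)], so
    testing the normal trace of a dual field against this quadratic turns the
    scalar product into an edge integral of a quadratic polynomial against [g]:
    the moments of [g] annihilate it unless both fields sit on the same edge,
    where they leave [dot (S - W) (N - W) / (4|K|) = cot theta / 2], while the
    moments of [delta_K] kill the volume term.  On an acute mesh
    [|a| * (cot + cot) / 2] is the distance between neighbouring circumcenters,
    so the first Petrov-Galerkin equation is the VF4 flux formula and the second
    one is the VF4 balance.  The VF4 matrix is square and its energy is a sum of
    squared jumps; a function without jumps vanishes by the divergence theorem
    for the field [x], hence unique solvability. *)

(** * Lebesgue measure of the plane *)

(** [Hdiv] tests only against compactly supported functions and [wdiv] is an arbitrary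
    representative, so its integrals over a single triangle must be shown independent of the choice
    before a normal trace can be used; the cutoff functions serve this purpose. The record [mesh]
    fixes neither the orientation of the vertices nor the number of triangles at an edge. That
    neighbours lie on opposite sides of their edge, that an edge has at most two triangles, and that
    an edge off the boundary has two, are derived from conformity and from the covering of
    [closure Omega]. The signs [esgn] then turn both kinds of edges into one signed sum. The
    Raviart-Thomas fields and the dual fields obey the same local Green formula, with edge density 1
    or [g] and divergence [1 / area K] or [delta K]. One assembly argument serves both, and their
    divergences have the same integrals over triangles. Definiteness of the VF4 matrix is often
    proved by walking through neighbouring triangles to the boundary; the divergence theorem for the
    field [x] replaces this walk. *)

Section PlaneMeasure.
Variable R : realType.
Local Notation mR := (measurableTypeR R).
Local Notation mP := (measurableTypeR R * measurableTypeR R)%type.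
Local Notation leb := (@lebesgue_measure R).

(** Measurability on [mP] is that of the product sigma-algebra, so an open set has to be exhibited
    as a countable union of squares with rational centres. *)
Lemma open_measurable_plane (U : set (R * R)) : open U -> measurable (U : set mP).
Proof.
move=> oU.
pose B (q : rat * rat * nat) : set (R * R) :=
  ball (ratr q.1.1 : R) (q.2.+1%:R^-1) `*` ball (ratr q.1.2 : R) (q.2.+1%:R^-1).
have -> : U = \bigcup_(q in [set q | B q `<=` U]) B q.
  apply/seteqP; split=> [[x y] Uxy|z [q /= qU /qU]//].
  have /nbhs_ballP[e /= e0 eU] : nbhs (x, y) U by apply: open_nbhs_nbhs.
  (* The factor 2: the rational centre is within [1 / (n + 1)] of the given point, and so is every
     other point of the square. *)
  have [n ne] : exists n : nat, 2 * n.+1%:R^-1 < e.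
    have [n _ nP] := near_infty_natSinv_lt (PosNum (divr_gt0 e0 (ltr0n R 2))).
    exists n; have := nP n (leqnn n) => /=; rewrite ltr_pdivlMr// mulrC; exact.
  have n0 : 0 < n.+1%:R^-1 :> R by rewrite invr_gt0 ltr0n.
  have rat_near (t : R) : exists q : rat, `|ratr q - t| < n.+1%:R^-1.
    move: n0; set u := n.+1%:R^-1 => u0.
    have [|q] := @rat_in_itvoo R (t - u) (t + u); first by lra.
    by rewrite in_itv/= => /andP[h1 h2]; exists q; rewrite ltr_norml; lra.
  have [q1 q1x] := rat_near x; have [q2 q2y] := rat_near y.
  exists (q1, q2, n) => /=; last by split.
  move=> [x' y'] [bx by_]; apply: eU.
  have near2 (t t' r : R) : `|r - t| < n.+1%:R^-1 -> `|r - t'| < n.+1%:R^-1 ->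
      `|t - t'| < e.
    move=> h1 h2; apply: le_lt_trans (ler_distD r _ _) _.
    by rewrite distrC; move: ne h1 h2; set u := n.+1%:R^-1; lra.
  by split; [exact: near2 q1x bx|exact: near2 q2y by_].
rewrite bigcup_mkcond; apply: countable_bigcupT_measurable.
  exact: (@countableP _ setT).
move=> q; case: ifPn => // _; apply: measurableX; apply: open_measurable;
  exact: ball_open.
Qed.

Lemma continuous_measurable_plane (f : R * R -> R) :
  continuous f -> measurable_fun (setT : set mP) (f : mP -> mR).
Proof.
move=> cf; apply: (measurability _ (RGenOpens.measurableE R)).
move=> _ [_ [a [b ->] <-]]; rewrite setTI; apply: open_measurable_plane.
by move/continuousP : cf; apply; exact: interval_open.
Qed.

(** Lebesgue measure is determined by its values on half-open intervals, and the scaled image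
    measure takes the same values there. *)
Lemma lebesgue_affine (a b : R) (A : set mR) : a != 0 -> measurable A ->
  (leb A = `|a|%:E * leb ((fun s => (a * s + b)%R) @^-1` A))%E.
Proof.
move=> a0.
pose F (s : mR) : mR := a * s + b.
have mF : measurable_fun setT F.
  by apply: measurable_funD => //; apply: measurable_funM.
pose F' : {mfun mR >-> mR} := HB.pack F (isMeasurableFun.Build _ _ _ _ F mF).
pose na : {nonneg R} := NngNum (normr_ge0 a).
move: A; apply: (@lebesgue_measure_unique R (mscale na (pushforward leb F'))) => X.
case=> -[c d] /= _ <-.
rewrite /mscale/= /pushforward/=.
(* For negative [a] the preimage is closed on the other side; its length is the same. *)
have -> : F @^-1` `]c, d] = if a > 0 then `](c - b) / a, (d - b) / a]%classic
                     else `[(d - b) / a, (c - b) / a[%classic.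
  apply/seteqP; split=> [x /=|x].
    rewrite in_itv/= /F => /andP[h1 h2]; case: ifPn => ha /=; rewrite in_itv/=.
      by rewrite ltr_pdivrMr// ler_pdivlMr// [x * a]mulrC; apply/andP; split; lra.
    have ha' : a < 0 by rewrite lt_neqAle a0 leNgt.
    by rewrite ltr_ndivlMr// ler_ndivrMr// [x * a]mulrC; apply/andP; split; lra.
  rewrite /F; case: ifPn => ha /=; rewrite !in_itv/=.
    by rewrite ltr_pdivrMr// ler_pdivlMr// [x * a]mulrC => /andP[? ?]; apply/andP; split; lra.
  have ha' : a < 0 by rewrite lt_neqAle a0 leNgt.
  by rewrite ltr_ndivlMr// ler_ndivrMr// [x * a]mulrC => /andP[? ?]; apply/andP; split; lra.
have [ha|ha] := ltP 0 a.
  rewrite !lebesgue_measure_itv/= !lte_fin gtr0_norm//.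
  rewrite ltr_pM2r ?invr_gt0// ltrD2r; case: ifPn => _; last by rewrite mule0.
  by rewrite -!EFinB -EFinM; congr EFin; field.
have ha' : a < 0 by rewrite lt_neqAle a0.
rewrite !lebesgue_measure_itv/= !lte_fin ltr0_norm//.
rewrite ltr_nM2r ?invr_lt0// ltrD2r; case: ifPn => _; last by rewrite mule0.
by rewrite -!EFinB -EFinM; congr EFin; field.
Qed.

Lemma ge0_integral_affine (a b : R) (f : mR -> \bar R) : a != 0 ->
  measurable_fun setT f -> (forall x, 0 <= f x)%E ->
  (\int[leb]_x f x = `|a|%:E * \int[leb]_s f (a * s + b)%R)%E.
Proof.
move=> a0 mf f0.
pose F (s : mR) : mR := a * s + b.
have mF : measurable_fun setT F.
  by apply: measurable_funD => //; apply: measurable_funM.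
pose na : {nonneg R} := NngNum (normr_ge0 a).
pose nu : {measure set mR -> \bar R} :=
  measure_function_pushforward__canonical__measure_function_Measure leb mF.
transitivity (\int[mscale na nu]_x f x)%E.
  by apply: eq_measure_integral => A mA _; exact: (lebesgue_affine b a0 mA).
rewrite ge0_integral_mscale//=; congr (_ * _)%E.
by rewrite (ge0_integral_pushforward mF)// => x _; exact: f0.
Qed.

Local Notation mu := (mu2 R).

Lemma measurable_affine_form (p q c : R) :
  measurable_fun (setT : set mP) (fun s : mP => p * s.1 + q * s.2 + c : mR).
Proof.
apply: measurable_funD => //; apply: measurable_funD.
  by apply: measurable_funM => //; exact: measurable_fst.
by apply: measurable_funM => //; exact: measurable_snd.
Qed.

(** Changing one coordinate at a time reduces the plane, by Tonelli, to affine substitutions on the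
    line. *)
Lemma ge0_integral_shear1 (p q c : R) (f : mP -> \bar R) : p != 0 ->
  measurable_fun setT f -> (forall x, 0 <= f x)%E ->
  (\int[mu]_x f x = `|p|%:E * \int[mu]_s f (p * s.1 + q * s.2 + c, s.2)%R)%E.
Proof.
move=> p0 mf f0.
have mg : measurable_fun (setT : set mP)
    (fun s : mP => f ((p * s.1 + q * s.2 + c)%R, s.2)).
  apply: (measurableT_comp mf); apply: measurable_fun_pair => //.
  exact: measurable_affine_form.
rewrite [LHS]fubini_tonelli2// [in RHS]fubini_tonelli2//.
rewrite -ge0_integralZl//=; last 2 first.
- exact: measurable_fun_fubini_tonelli_G.
- by move=> y _; exact: integral_ge0.
apply: eq_integral => y _; rewrite /fubini_G.
rewrite (@ge0_integral_affine p (q * y + c) (fun x => f (x, y)))//.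
  by congr (_ * _)%E; apply: eq_integral => x _; rewrite addrA.
exact: measurableT_comp mf _.
Qed.

Lemma ge0_integral_swap (f : mP -> \bar R) :
  measurable_fun setT f -> (forall x, 0 <= f x)%E ->
  (\int[mu]_x f x = \int[mu]_s f (s.2, s.1))%E.
Proof.
move=> mf f0.
have mg : measurable_fun (setT : set mP) (fun s : mP => f (s.2, s.1)).
  by apply: (measurableT_comp mf); apply: measurable_fun_pair.
rewrite [LHS]fubini_tonelli2// [in RHS]fubini_tonelli1//.
Qed.

Lemma ge0_integral_shear2 (m k c : R) (f : mP -> \bar R) : k != 0 ->
  measurable_fun setT f -> (forall x, 0 <= f x)%E ->
  (\int[mu]_x f x = `|k|%:E * \int[mu]_s f (s.1, m * s.1 + k * s.2 + c)%R)%E.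
Proof.
move=> k0 mf f0.
have msw : measurable_fun (setT : set mP) (fun s : mP => (s.2, s.1)).
  by apply: measurable_fun_pair.
rewrite ge0_integral_swap// (@ge0_integral_shear1 k m c)//; last first.
  exact: measurableT_comp mf msw.
rewrite ge0_integral_swap//=; last first.
  apply: (measurableT_comp mf); apply: measurable_fun_pair => //.
  exact: measurable_affine_form.
by congr (_ * _)%E; apply: eq_integral => x _ /=; rewrite [(k * _ + _)%R]addrC.
Qed.

Definition aff (P e f : R * R) (s : R * R) : R * R := P + s.1 *: e + s.2 *: f.

Lemma affE P e f s : aff P e f s =
  (P.1 + s.1 * e.1 + s.2 * f.1, P.2 + s.1 * e.2 + s.2 * f.2).
Proof. by []. Qed.

Lemma measurable_aff P e f : measurable_fun (setT : set mP) (aff P e f : mP -> mP).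
Proof.
apply/measurable_fun_pairP; split.
  apply: (eq_measurable_fun (fun s : mP => e.1 * s.1 + f.1 * s.2 + P.1 : mR)).
    by move=> s _; rewrite [RHS]/comp affE /=; ring.
  exact: measurable_affine_form.
apply: (eq_measurable_fun (fun s : mP => e.2 * s.1 + f.2 * s.2 + P.2 : mR)).
  by move=> s _; rewrite [RHS]/comp affE /=; ring.
exact: measurable_affine_form.
Qed.

Lemma ge0_integral_aff (P e f : R * R) (g : mP -> \bar R) : cross e f != 0 ->
  measurable_fun setT g -> (forall x, 0 <= g x)%E ->
  (\int[mu]_x g x = `|cross e f|%:E * \int[mu]_s g (aff P e f s))%E.
Proof.
have main (e' f' : R * R) (h : mP -> \bar R) : e'.1 != 0 -> cross e' f' != 0 ->
    measurable_fun setT h -> (forall x, 0 <= h x)%E ->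
    (\int[mu]_x h x = `|cross e' f'|%:E * \int[mu]_s h (aff P e' f' s))%E.
  move=> e0 D0 mh h0.
  (* The affine map is a composite of two shears: once the first coordinate is known, the second is
     an affine function of it and of [s.2], with these coefficients. *)
  rewrite (@ge0_integral_shear2 (e'.2 / e'.1) (cross e' f' / e'.1)
    (P.2 - e'.2 / e'.1 * P.1))//; last by rewrite mulf_neq0// invr_neq0.
  rewrite (@ge0_integral_shear1 e'.1 f'.1 P.1)//; last first.
    apply: (measurableT_comp mh).
    apply: measurable_fun_pair => //; exact: measurable_affine_form.
  rewrite muleA -EFinM -normrM divfK//; congr (_ * _)%E.
  apply: eq_integral => s _ /=; congr h; rewrite affE /cross.
  by congr pair; field.
(* If [e.1] vanishes then [f.1] does not, and exchanging [e] and [f] only changes the sign of the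
   determinant. *)
move=> D0 mg g0; have [e0|e0] := eqVneq e.1 0; last exact: main.
have f0 : f.1 != 0.
  by apply: contra_neq D0 => f0; rewrite /cross e0 f0 !mul0r mulr0 subr0.
have cr : cross f e = - cross e f by rewrite /cross; ring.
rewrite (main f e)//; last by rewrite cr oppr_eq0.
rewrite cr normrN; congr (_ * _)%E; rewrite ge0_integral_swap//.
  apply: eq_integral => s _; congr g; rewrite !affE /=.
  by congr pair; ring.
exact: measurableT_comp mg (measurable_aff _ _ _).
Qed.

(** Valid for infinite values as well, which lets the change of variables treat arbitrary measurable
    integrands through their positive and negative parts. *)
Lemma EFin_mulBr (c : R) (x y : \bar R) : 0 < c ->
  (c%:E * x - c%:E * y = c%:E * (x - y))%E.
Proof.
move=> c0; have c0' : (0 < c%:E)%E by rewrite lte_fin.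
case: x => [x| |]; case: y => [y| |];
  rewrite ?(gt0_muley c0') ?(gt0_muleNy c0') //=;
  rewrite ?addey ?addye ?addeNy ?addNye //= ?(gt0_muley c0') ?(gt0_muleNy c0') //.
by rewrite -EFinM -!EFinD -EFinM mulrDr mulrN.
Qed.

Lemma fine_EFinM (c : R) (x : \bar R) : fine (c%:E * x)%E = c * fine x.
Proof.
have [c0|c0|->] := ltgtP c 0; last by rewrite mul0e mul0r.
  case: x => [x| |]; first by [].
    by rewrite lt0_muley ?lte_fin// mulr0.
  by rewrite lt0_muleNy ?lte_fin// mulr0.
case: x => [x| |]; first by [].
  by rewrite gt0_muley ?lte_fin// mulr0.
by rewrite gt0_muleNy ?lte_fin// mulr0.
Qed.

Lemma integral_aff (P e f : R * R) (D : set mP) (g : mP -> \bar R) :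
  cross e f != 0 -> measurable D -> measurable_fun D g ->
  (\int[mu]_(x in D) g x =
   `|cross e f|%:E * \int[mu]_(s in aff P e f @^-1` D) g (aff P e f s))%E.
Proof.
move=> D0 mD mg.
rewrite integral_mkcond [in RHS]integral_mkcond.
have -> : ((fun s => g (aff P e f s)) \_ (aff P e f @^-1` D)) =
   (fun s => (g \_ D) (aff P e f s)).
  by [].
have {}mg : measurable_fun setT (g \_ D) by apply/(measurable_restrictT _ mD).
move: mg; set h := g \_ D => mh.
have mhp := measurable_funepos mh; have mhn := measurable_funeneg mh.
rewrite integralE [in RHS]integralE.
rewrite (ge0_integral_aff P D0 mhp)//.
rewrite (ge0_integral_aff P D0 mhn)//.
have -> : (fun s => h (aff P e f s))^\+%E = (fun s => (h^\+)%E (aff P e f s)).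
  by apply/funext => s; rewrite -[fun s => h _]/(h \o aff P e f) funepos_comp.
have -> : (fun s => h (aff P e f s))^\-%E = (fun s => (h^\-)%E (aff P e f s)).
  by apply/funext => s; rewrite -[fun s => h _]/(h \o aff P e f) funeneg_comp.
by apply: EFin_mulBr; rewrite normr_gt0.
Qed.

Lemma Rintegral_aff (P e f : R * R) (D : set mP) (g : R * R -> R) :
  cross e f != 0 -> measurable D -> measurable_fun D (g : mP -> mR) ->
  \int[mu]_(x in D) g x =
   `|cross e f| * \int[mu]_(s in aff P e f @^-1` D) g (aff P e f s).
Proof.
move=> D0 mD mg; rewrite /Rintegral (integral_aff P D0)//; last first.
  exact/measurable_EFinP.
exact: fine_EFinM.
Qed.

End PlaneMeasure.

(** * Functions of class C1 *)

Section Calculus.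
Variable R : realType.
Local Notation mR := (measurableTypeR R).
Local Notation mP := (measurableTypeR R * measurableTypeR R)%type.
Local Notation leb := (@lebesgue_measure R).
Local Notation mu := (mu2 R).
Implicit Types (w : R * R -> R) (G : R * R -> R * R) (x v : R * R).

(** [C1] speaks of the two partial derivatives only. This form has derivatives in all directions: it
    restricts to lines and is stable under products and composition. *)
Definition has_grad w G :=
  [/\ continuous w, continuous (fun x => (G x).1), continuous (fun x => (G x).2) &
      forall x v, is_derive x v w (dot (G x) v)].

Lemma is_derive_line w x v s D : is_derive (x + s *: v) v w D ->
  is_derive s 1 (fun s => w (x + s *: v)) D.
Proof.
have E : (fun h : R => h^-1 *: (((fun s => w (x + s *: v)) \o shift s) (h *: 1) -
      w (x + s *: v))) =
   (fun h => h^-1 *: ((w \o shift (x + s *: v)) (h *: v) - w (x + s *: v))).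
  apply/funext => h; congr (_ *: (_ - _)) => /=; congr w.
  by rewrite scaler1 scalerDl addrCA.
case=> d1 d2; split; first by rewrite /derivable E.
by rewrite /derive E.
Qed.

Lemma is_derive_line0 w x v D :
  is_derive (0 : R) (1 : R) (fun s : R => w (x + s *: v)) D -> is_derive x v w D.
Proof.
have E : (fun h : R => h^-1 *: (((fun s => w (x + s *: v)) \o shift 0) (h *: 1) -
      w (x + 0 *: v))) = (fun h => h^-1 *: ((w \o shift x) (h *: v) - w x)).
  apply/funext => h; rewrite scale0r addr0; congr (_ *: (_ - _)) => /=; congr w.
  by rewrite scaler1 addr0 addrC.
case=> d1 d2; split; first by move: d1; rewrite /derivable E.
by move: d2; rewrite /derive E.
Qed.

Lemma mean_value (f df : R -> R) (p q : R) :
  (forall s : R, is_derive s 1 f (df s)) ->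
  exists2 c, `|c - p| <= `|q - p| & f q - f p = df c * (q - p).
Proof.
move=> fd.
have fc a b : {within `[a, b], continuous f}.
  apply: continuous_subspaceT => s.
  exact/differentiable_continuous/derivable1_diffP/(@ex_derive _ _ _ _ _ _ _ (fd s)).
have [pq|qp] := leP p q.
  have [c + fE] := MVT_segment pq (fun s _ => fd s) (fc _ _).
  rewrite in_itv/= => /andP[h1 h2]; exists c => //.
  by rewrite !ger0_norm ?subr_ge0//; lra.
have [c + fE] := MVT_segment (ltW qp) (fun s _ => fd s) (fc _ _).
rewrite in_itv/= => /andP[h1 h2]; exists c.
  by rewrite !ler0_norm ?subr_le0//; lra.
by rewrite -opprB fE; ring.
Qed.

(** Mean value theorem along the two legs of the path from [x] through [(x.1, y.2)] to [y], which
    uses partial derivatives only. *)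
Lemma C1_increment w x y : C1 w -> exists a b : R,
  [/\ `|a - x.1| <= `|y.1 - x.1|, `|b - x.2| <= `|y.2 - x.2| &
      w y - w x = (grad w (a, y.2)).1 * (y.1 - x.1) + (grad w (x.1, b)).2 * (y.2 - x.2)].
Proof.
case=> d1 d2 _ _.
have h1 (t s : R) : is_derive s 1 (fun s => w (s, t)) ((grad w (s, t)).1).
  have -> : (fun s => w (s, t)) = (fun s => w ((0, t) + s *: ((1, 0) : R * R))).
    apply/funext => r; congr w; congr pair => /=.
      by rewrite add0r [RHS]mulr1.
    by rewrite [_ *: _]mulr0 addr0.
  apply: is_derive_line; have -> : (0, t) + s *: ((1, 0) : R * R) = (s, t).
    congr pair => /=; first by rewrite add0r [LHS]mulr1.
    by rewrite [_ *: _]mulr0 addr0.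
  exact: derivableP (d1 _).
have h2 (s t : R) : is_derive t 1 (fun t => w (s, t)) ((grad w (s, t)).2).
  have -> : (fun t => w (s, t)) = (fun t => w ((s, 0) + t *: ((0, 1) : R * R))).
    apply/funext => r; congr w; congr pair => /=.
      by rewrite [_ *: _]mulr0 addr0.
    by rewrite add0r [RHS]mulr1.
  apply: is_derive_line; have -> : (s, 0) + t *: ((0, 1) : R * R) = (s, t).
    congr pair => /=; first by rewrite [_ *: _]mulr0 addr0.
    by rewrite add0r [LHS]mulr1.
  exact: derivableP (d2 _).
have [a a1 aE] := mean_value x.1 y.1 (h1 y.2).
have [b b1 bE] := mean_value x.2 y.2 (h2 x.1).
exists a, b; split => //; rewrite -aE -bE; case: (x) (y) => [? ?] [? ?] /=; ring.
Qed.

Lemma near_plane (f : R * R -> R) x (e : R) : {for x, continuous f} -> 0 < e ->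
  exists2 r : R, 0 < r & forall a b, `|a - x.1| < r -> `|b - x.2| < r ->
    `|f (a, b) - f x| < e.
Proof.
move=> cf e0; have /cvgrPdist_lt/(_ e e0)/nbhs_ballP[r /= r0 rP] := cf.
exists r => // a b ha hb; rewrite distrC; apply: rP.
by split; rewrite /ball/= distrC.
Qed.

Lemma C1_has_grad w : C1 w -> has_grad w (grad w).
Proof.
move=> C1w; have [_ _ c1 c2] := C1w.
split => //.
  move=> x; apply/cvgrPdist_lt => e e0.
  have [r1 r10 P1] := near_plane (c1 x) ltr01.
  have [r2 r20 P2] := near_plane (c2 x) ltr01.
  (* Near [x] both partial derivatives are bounded by [M], so each of the two terms of the increment
     stays below [M * r <= e / 2]. *)
  pose M := `|(grad w x).1| + `|(grad w x).2| + 2.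
  have M0 : 0 < M.
    rewrite /M; have := normr_ge0 (grad w x).1.
    by have := normr_ge0 (grad w x).2; lra.
  pose r := Num.min (Num.min r1 r2) (e / M / 2).
  have r0 : 0 < r by rewrite !lt_min r10 r20 !divr_gt0.
  suff : nbhs x (fun t => `|w x - w t| < e) by [].
  apply/nbhs_ballP; exists r => // y [/= y1 y2].
  have {}y1 : `|y.1 - x.1| < r by rewrite distrC.
  have {}y2 : `|y.2 - x.2| < r by rewrite distrC.
  have rr1 : r <= r1 by rewrite !ge_min lexx.
  have rr2 : r <= r2 by rewrite !ge_min lexx orbT.
  have [a [b [ha hb E]]] := C1_increment x y C1w.
  rewrite distrC E.
  have G1 : `|(grad w (a, y.2)).1| <= M.
    have := P1 a y.2 (le_lt_trans ha (lt_le_trans y1 rr1)) (lt_le_trans y2 rr1).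
    move=> h; have := ler_distD 0 (grad w (a, y.2)).1 (grad w x).1.
    have := ler_normD ((grad w (a, y.2)).1 - (grad w x).1) (grad w x).1.
    rewrite subrK; have := normr_ge0 (grad w x).2; move: h; rewrite /M /grad /=; lra.
  have G2 : `|(grad w (x.1, b)).2| <= M.
    have := P2 x.1 b; rewrite subrr normr0 => /(_ r20 (le_lt_trans hb (lt_le_trans y2 rr2))).
    move=> h; have := ler_normD ((grad w (x.1, b)).2 - (grad w x).2) (grad w x).2.
    rewrite subrK; have := normr_ge0 (grad w x).1; move: h; rewrite /M /grad /=; lra.
  apply: le_lt_trans (ler_normD _ _) _; rewrite !normrM.
  have rM : M * r <= e / 2.
    apply: (@le_trans _ _ (M * (e / M / 2))); last first.
      by rewrite le_eqVlt; apply/orP; left; apply/eqP; field; lra.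
    by rewrite ler_pM2l// !ge_min lexx orbT.
  have h1 : `|(grad w (a, y.2)).1| * `|y.1 - x.1| < M * r.
    apply: (@le_lt_trans _ _ (M * `|y.1 - x.1|)); first by rewrite ler_wpM2r.
    by rewrite ltr_pM2l.
  have h2 : `|(grad w (x.1, b)).2| * `|y.2 - x.2| < M * r.
    apply: (@le_lt_trans _ _ (M * `|y.2 - x.2|)); first by rewrite ler_wpM2r.
    by rewrite ltr_pM2l.
  lra.
move=> x v.
suff H : (fun h : R => h^-1 *: ((w \o shift x) (h *: v) - w x)) @ 0^' --> dot (grad w x) v.
  by split; [apply/cvg_ex; exists (dot (grad w x) v)|exact/cvg_lim].
apply/cvgrPdist_lt => e e0.
(* The summand 1 keeps [M] positive when [v] is zero; a step [h] with [|h| < r] moves each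
   coordinate by less than [min r1 r2]. *)
pose M := `|v.1| + `|v.2| + 1.
have M0 : 0 < M by rewrite /M; have := normr_ge0 v.1; have := normr_ge0 v.2; lra.
have eM : 0 < e / M by rewrite divr_gt0.
have [r1 r10 P1] := near_plane (c1 x) eM.
have [r2 r20 P2] := near_plane (c2 x) eM.
pose r := Num.min r1 r2 / M.
have r0 : 0 < r by rewrite divr_gt0// lt_min r10.
near=> h.
have h0 : h != 0 by near: h; exact: nbhs_dnbhs_neq.
have hr : `|h| < r.
  near: h; apply: dnbhs0_lt => //.
have small (t : R) : `|t| <= M -> `|h * t| < r1 /\ `|h * t| < r2.
  move=> tM; have : `|h * t| < Num.min r1 r2.
    rewrite normrM; apply: (@le_lt_trans _ _ (`|h| * M)); first by rewrite ler_wpM2l.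
    by rewrite -ltr_pdivlMr.
  by rewrite lt_min => /andP.
have v1M : `|v.1| <= M by rewrite /M; have := normr_ge0 v.2; lra.
have v2M : `|v.2| <= M by rewrite /M; have := normr_ge0 v.1; lra.
have [a [b [ha hb E]]] := C1_increment x (h *: v + x) C1w.
have E1 : (h *: v + x).1 - x.1 = h * v.1 by rewrite [LHS]addrK.
have E2 : (h *: v + x).2 - x.2 = h * v.2 by rewrite [LHS]addrK.
rewrite E1 in ha E; rewrite E2 in hb E.
rewrite [(w \o _) _]/= E.
have -> : h^-1 *: ((grad w (a, (h *: v + x).2)).1 * (h * v.1) +
    (grad w (x.1, b)).2 * (h * v.2)) =
   (grad w (a, (h *: v + x).2)).1 * v.1 + (grad w (x.1, b)).2 * v.2.
  by rewrite /GRing.scale/=; field.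
have [s11 s12] := small _ v1M; have [s21 s22] := small _ v2M.
have := P1 a ((h *: v + x).2) (le_lt_trans ha s11); rewrite E2 => /(_ s21) G1.
have := P2 x.1 b; rewrite subrr normr0 => /(_ r20 (le_lt_trans hb s22)) G2.
have -> : dot (grad w x) v - ((grad w (a, (h *: v + x).2)).1 * v.1 +
   (grad w (x.1, b)).2 * v.2) = - ((grad w (a, (h *: v + x).2)).1 - (grad w x).1) * v.1
   + - ((grad w (x.1, b)).2 - (grad w x).2) * v.2 by rewrite /dot; ring.
apply: le_lt_trans (ler_normD _ _) _; rewrite !normrM !normrN.
apply: (@le_lt_trans _ _ (e / M * (`|v.1| + `|v.2|))).
  by rewrite mulrDr lerD// ler_wpM2r// ltW.
by rewrite mulrAC ltr_pdivrMr// ltr_pM2l// /M ltrDl.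
Unshelve. all: by end_near.
Qed.

Lemma has_grad_gradE w G : has_grad w G -> grad w = G.
Proof.
case=> _ _ _ d; apply/funext => x; rewrite /grad.
have /@derive_val -> := d x ((1, 0) : R * R).
have /@derive_val -> := d x ((0, 1) : R * R).
by rewrite /dot/= !mulr1 !mulr0 addr0 add0r; case: (G x).
Qed.

Lemma has_grad_C1 w G : has_grad w G -> C1 w.
Proof.
move=> H; have E := has_grad_gradE H; case: H => _ c1 c2 d; split.
- by move=> x; exact: (@ex_derive _ _ _ _ _ _ _ (d x _)).
- by move=> x; exact: (@ex_derive _ _ _ _ _ _ _ (d x _)).
- by have -> : (fun x => 'D_(1, 0) w x) = (fun x => (G x).1) by rewrite -E.
- by have -> : (fun x => 'D_(0, 1) w x) = (fun x => (G x).2) by rewrite -E.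
Qed.

Lemma dotC (u v : R * R) : dot u v = dot v u.
Proof. by rewrite /dot; ring. Qed.

Lemma dotDl (u u' v : R * R) : dot (u + u') v = dot u v + dot u' v.
Proof.
rewrite /dot -[(u + u').1]/(u.1 + u'.1) -[(u + u').2]/(u.2 + u'.2); ring.
Qed.

Lemma dotZl (a : R) (u v : R * R) : dot (a *: u) v = a * dot u v.
Proof. rewrite /dot -[(a *: u).1]/(a * u.1) -[(a *: u).2]/(a * u.2); ring. Qed.

Lemma dotNl (u v : R * R) : dot (- u) v = - dot u v.
Proof. by rewrite -scaleN1r dotZl mulN1r. Qed.

Lemma dotDr (u v v' : R * R) : dot u (v + v') = dot u v + dot u v'.
Proof. by rewrite ![dot u _]dotC dotDl. Qed.

Lemma dotNr (u v : R * R) : dot u (- v) = - dot u v.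
Proof. by rewrite ![dot u _]dotC dotNl. Qed.

Lemma has_gradM w1 w2 G1 G2 : has_grad w1 G1 -> has_grad w2 G2 ->
  has_grad (fun x => w1 x * w2 x) (fun x => w1 x *: G2 x + w2 x *: G1 x).
Proof.
move=> [cw1 c11 c12 d1] [cw2 c21 c22 d2]; split.
- by move=> x; apply: cvgM; [exact: cw1|exact: cw2].
- move=> x; apply: cvgD; apply: cvgM; [exact: cw1|exact: c21|exact: cw2|exact: c11].
- move=> x; apply: cvgD; apply: cvgM; [exact: cw1|exact: c22|exact: cw2|exact: c12].
- move=> x v; have H := is_deriveM (d1 x v) (d2 x v).
  by apply: is_derive_eq H _; rewrite dotDl !dotZl.
Qed.

Lemma continuous_affine_form (p q c : R) :
  continuous (fun x : R * R => p * x.1 + q * x.2 + c).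
Proof.
move=> x; apply: cvgD; last exact: cvg_cst.
by apply: cvgD; apply: cvgM; (exact: cvg_cst || exact: cvg_fst || exact: cvg_snd).
Qed.

Lemma has_grad_affine (p q c : R) :
  has_grad (fun x => p * x.1 + q * x.2 + c) (fun=> (p, q)).
Proof.
split; [exact: continuous_affine_form|exact: cst_continuous|exact: cst_continuous|].
move=> x v; apply: is_derive_line0.
have -> : (fun s : R => p * (x + s *: v).1 + q * (x + s *: v).2 + c) =
   (fun s => (p * x.1 + q * x.2 + c) + s * (p * v.1 + q * v.2)).
  apply/funext => s; have -> : (x + s *: v).1 = x.1 + s * v.1 by [].
  by have -> : (x + s *: v).2 = x.2 + s * v.2 by []; ring.
apply: is_derive_eq; rewrite add0r /GRing.scale/= /dot/=; ring.
Qed.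

Lemma has_grad_comp (F dF : R -> R) w G : continuous dF ->
  (forall s : R, is_derive s 1 F (dF s)) -> has_grad w G ->
  has_grad (F \o w) (fun x => dF (w x) *: G x).
Proof.
move=> cdF HF [cw c1 c2 d].
have cF : continuous F.
  by move=> s; exact/differentiable_continuous/derivable1_diffP/(@ex_derive _ _ _ _ _ _ _ (HF s)).
split.
- by move=> x; apply: continuous_comp; [exact: cw|exact: cF].
- by move=> x; apply: cvgM; [apply: continuous_comp; [exact: cw|exact: cdF]|exact: c1].
- by move=> x; apply: cvgM; [apply: continuous_comp; [exact: cw|exact: cdF]|exact: c2].
- move=> x v; apply: is_derive_line0.
  have Hw : is_derive (0 : R) 1 (fun s : R => w (x + s *: v)) (dot (G x) v).
    by apply: is_derive_line; rewrite scale0r addr0; exact: d.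
  have HF' : is_derive ((fun s : R => w (x + s *: v)) 0) 1 F (dF (w x)).
    by rewrite scale0r addr0.
  have := @is_derive1_comp _ F (fun s : R => w (x + s *: v)) 0 _ _ HF' Hw.
  move=> H; apply: is_derive_eq H _; by rewrite dotZl mulrC.
Qed.

End Calculus.

(** * Square integrable functions *)

Section L2.
Variable R : realType.
Local Notation mR := (measurableTypeR R).
Local Notation mP := (measurableTypeR R * measurableTypeR R)%type.
Local Notation leb := (@lebesgue_measure R).
Local Notation mu := (mu2 R).
Implicit Types (w : R * R -> R) (G : R * R -> R * R) (x v : R * R).

Definition box (m : R) : set (R * R) := `[- m, m]%classic `*` `[- m, m]%classic.

Lemma compact_box m : compact (box m).
Proof. by apply: compact_setX; exact: segment_compact. Qed.

Lemma box_lty m (D : set mP) : measurable D -> D `<=` box m -> (mu D < +oo)%E.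
Proof.
move=> mD Dm; apply: (@le_lt_trans _ _ (mu (box m))).
  by apply: le_measure => //; rewrite inE//; apply: measurableX; exact: measurable_itv.
have -> : mu (box m) = (leb `[(- m)%R, m%R]%classic * leb `[(- m)%R, m%R]%classic)%E.
  by apply: product_measure1E; exact: measurable_itv.
by rewrite lte_mul_pinfty//= lebesgue_measure_itv/=; case: ifP => // _; rewrite -EFinB ?ltry.
Qed.

Lemma continuous_box_bounded m (D : set (R * R)) w : continuous w -> D `<=` box m ->
  exists M, forall x, D x -> `|w x| <= M.
Proof.
move=> cw Dm; have [[x Dx]|D0] := pselect (D !=set0); last first.
  by exists 0 => x Dx; exfalso; apply: D0; exists x.
have cnw : {within box m, continuous (fun x => `|w x|)}.
  by apply: continuous_subspaceT => y; apply: continuous_comp; [exact: cw|exact: norm_continuous].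
have [c _ cP] := compact_EVT_max (ex_intro _ x (Dm _ Dx)) (@compact_box m) cnw.
by exists (`|w c|) => y Dy; apply: cP; rewrite inE; exact: Dm.
Qed.

Lemma continuous_integrable m (D : set mP) w : continuous w -> measurable D ->
  D `<=` box m -> mu.-integrable D (EFin \o w).
Proof.
move=> cw mD Dm; apply: measurable_bounded_integrable => //.
- exact: box_lty Dm.
- exact: measurable_funTS (continuous_measurable_plane cw).
- have [M MP] := continuous_box_bounded cw Dm.
  exists M; split; [exact: num_real|move=> M' /ltW MM' x /= Dx].
  exact: le_trans (MP _ Dx) MM'.
Qed.

Lemma L2M_integrable (D : set mP) (f g : R * R -> R) : measurable D ->
  L2 D f -> L2 D g -> mu.-integrable D (fun x => (f x * g x)%:E).
Proof.
move=> mD [mf f2] [mg g2].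
apply: (@le_integrable _ _ _ _ D mD _ (fun x => (f x ^+ 2)%:E + (g x ^+ 2)%:E)%E).
- by apply/measurable_EFinP; exact: measurable_funM.
- move=> x Dx; rewrite -EFinD !abse_EFin lee_fin.
  rewrite [`|_ + _|]ger0_norm ?addr_ge0 ?sqr_ge0// ler_norml.
  have h3 := sqr_ge0 (f x + g x); have h4 := sqr_ge0 (f x - g x).
  have := sqr_ge0 (f x); have := sqr_ge0 (g x) => h1 h2.
  by apply/andP; split; nra.
- exact: integrableD.
Qed.

Lemma L2D (D : set mP) (f g : R * R -> R) : measurable D ->
  L2 D f -> L2 D g -> L2 D (fun x => f x + g x).
Proof.
move=> mD Lf Lg; have fg := L2M_integrable mD Lf Lg.
move: Lf Lg => [mf f2] [mg g2]; split; first exact: measurable_funD.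
have -> : (fun x => ((f x + g x) ^+ 2)%:E) =
   (fun x => (f x ^+ 2)%:E + ((2%:E * (f x * g x)%:E) + (g x ^+ 2)%:E))%E.
  by apply/funext => x; rewrite -EFinM -!EFinD; congr EFin; ring.
apply: integrableD => //; apply: integrableD => //; exact: integrableZl.
Qed.

Lemma L2Z (D : set mP) (f : R * R -> R) (k : R) : measurable D ->
  L2 D f -> L2 D (fun x => k * f x).
Proof.
move=> mD [mf f2]; split; first exact: measurable_funM.
have -> : (fun x => ((k * f x) ^+ 2)%:E) = (fun x => (k ^+ 2)%:E * (f x ^+ 2)%:E)%E.
  by apply/funext => x; rewrite -EFinM exprMn.
exact: integrableZl.
Qed.

Lemma L2_0 (D : set mP) : measurable D -> L2 D (fun=> 0 : R).
Proof.
move=> mD; split; first exact: measurable_cst.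
have -> : (fun x : R * R => ((0:R) ^+ 2)%:E) = cst 0%E by apply/funext => x; rewrite expr0n.
exact: integrable0.
Qed.

Lemma L2_continuous m (D : set mP) w : continuous w -> measurable D ->
  D `<=` box m -> L2 D w.
Proof.
move=> cw mD Dm; split; first exact: measurable_funTS (continuous_measurable_plane cw).
apply: (@continuous_integrable m D (fun x => w x ^+ 2)) => // x.
by apply: cvgM; exact: cw.
Qed.

Lemma L2_integrable m (D : set mP) (f : R * R -> R) : measurable D ->
  D `<=` box m -> L2 D f -> mu.-integrable D (EFin \o f).
Proof.
move=> mD Dm Lf; have L1 := @L2_continuous m D (fun=> 1) (@cst_continuous _ _ _) mD Dm.
have := L2M_integrable mD Lf L1.
by have -> // : (fun x => (f x * 1)%:E) = EFin \o f by apply/funext => x /=; rewrite mulr1.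
Qed.

Lemma L2_extend (D E : set mP) (f : R * R -> R) : measurable D -> measurable E ->
  E `<=` D -> (forall x, ~ E x -> f x = 0) -> L2 E f -> L2 D f.
Proof.
move=> mD mE ED f0 [mf f2].
have fE : f \_ E = f.
  apply/funext => x; rewrite /patch; case: ifPn => // /negP xE.
  by rewrite f0// => Ex; apply: xE; rewrite inE.
split.
  by apply: measurable_funTS; have := (measurable_restrictT _ mE).1 mf; rewrite fE.
have -> : (fun x => (f x ^+ 2)%:E) = (fun x => (f x ^+ 2)%:E) \_ E.
  apply/funext => x; rewrite /patch; case: ifPn => // /negP xE.
  by rewrite f0 ?expr0n// => Ex; apply: xE; rewrite inE.
by apply/(integrable_restrict _ mE mD); rewrite (_ : D `&` E = E)//; exact/setIidPr.
Qed.

Lemma L2_eq (D : set mP) (f g : R * R -> R) : measurable D -> (forall x, D x -> f x = g x) ->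
  L2 D f -> L2 D g.
Proof.
move=> mD fg [mf f2]; split.
  by apply: eq_measurable_fun mf => x; rewrite inE => /fg.
by apply: eq_integrable f2 => // x; rewrite inE => /fg ->.
Qed.

Lemma Rintegral_zero_outside (D E : set mP) (f : R * R -> R) :
  E `<=` D -> (forall x, D x -> ~ E x -> f x = 0) ->
  \int[mu]_(x in D) f x = \int[mu]_(x in E) f x.
Proof.
move=> ED f0; rewrite Rintegral_mkcond [RHS]Rintegral_mkcond.
congr (Rintegral _ _ _); apply/funext => x; rewrite /patch.
have [xE|xE] := boolP (x \in E).
  by rewrite mem_set//; apply: ED; move: xE; rewrite inE.
case: ifPn => //; rewrite inE => Dx; apply: f0 => // Ex.
by move/negP : xE; apply; rewrite inE.
Qed.

Lemma L2v_dot_integrable (D : set mP) psi G : measurable D ->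
  L2v D psi -> L2v D G -> mu.-integrable D (fun x => (dot (psi x) (G x))%:E).
Proof.
move=> mD [p1 p2] [q1 q2].
rewrite (_ : (fun x => _) = (fun x => ((psi x).1 * (G x).1)%:E + ((psi x).2 * (G x).2)%:E)%E).
  by apply: integrableD => //; exact: L2M_integrable.
by apply/funext => x; rewrite -EFinD.
Qed.

End L2.

Lemma continuous_pair (R : realType) (T : topologicalType) (f g : T -> R) :
  continuous f -> continuous g -> continuous (fun t => (f t, g t) : R * R).
Proof. by move=> cf cg x; exact: (cvg_pair (cf x) (cg x)). Qed.

(** * Green's formula on the reference triangle *)

Section Green.
Variable R : realType.
Local Notation mR := (measurableTypeR R).
Local Notation mP := (measurableTypeR R * measurableTypeR R)%type.
Local Notation leb := (@lebesgue_measure R).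
Local Notation mu := (mu2 R).
Implicit Types (w : R * R -> R) (G : R * R -> R * R) (x v : R * R).

Lemma FTC_oo (F f : R -> R) (a b : R) : a < b ->
  (forall s : R, is_derive s 1 F (f s)) -> continuous f ->
  (\int[leb]_(x in `]a, b[) (f x)%:E = (F b - F a)%:E)%E.
Proof.
move=> ab dF cf.
have cF : continuous F.
  by move=> s; exact/differentiable_continuous/derivable1_diffP/(@ex_derive _ _ _ _ _ _ _ (dF s)).
have mf D : measurable_fun (D : set R) (EFin \o f).
  by apply/measurable_EFinP; apply: measurable_funTS; exact: continuous_measurable_fun.
rewrite integral_itv_obnd_cbnd// integral_itv_bndo_bndc//.
rewrite (@continuous_FTC2 R f F a b)//.
- exact: continuous_subspaceT.
- split.
  + by move=> x _; exact: (@ex_derive _ _ _ _ _ _ _ (dF x)).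
  + by apply: cvg_at_right_filter; exact: cF.
  + by apply: cvg_at_left_filter; exact: cF.
- by move=> x _; rewrite derive1E; exact: (@derive_val _ _ _ _ _ _ _ (dF x)).
Qed.

Definition ref_tri : set (R * R) :=
  [set s | [/\ 0 < s.1, 0 < s.2 & s.1 + s.2 < 1]].

Lemma ref_tri_box : ref_tri `<=` box 1.
Proof.
by move=> x [h1 h2 h3]; split; rewrite /= in_itv/=; apply/andP; split; lra.
Qed.

Lemma measurable_ref_tri : measurable (ref_tri : set mP).
Proof.
apply: open_measurable_plane.
have -> : ref_tri = (fun x : R * R => 1 * x.1 + 0 * x.2 + 0) @^-1` [set t | t > 0] `&`
   ((fun x : R * R => 0 * x.1 + 1 * x.2 + 0) @^-1` [set t | t > 0] `&`
    (fun x : R * R => - 1 * x.1 + - 1 * x.2 + 1) @^-1` [set t | t > 0]).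
  apply/seteqP; split=> x; rewrite /ref_tri/=.
    by case=> h1 h2 h3; do !split; lra.
  by case=> h1 [h2 h3]; split; lra.
have cf (p q c : R) : open ((fun x : R * R => p * x.1 + q * x.2 + c) @^-1` [set t | t > 0]).
  have /continuousP := @continuous_affine_form R p q c; apply; exact: open_gt.
by do !apply: openI.
Qed.

(** The integrand is the derivative of [s * V (s, t)] in [s]. Each horizontal section is the
    interval from 0 to [1 - t], and the boundary term at 0 vanishes. *)
Lemma green_ref1 (V A : R * R -> R) : continuous V -> continuous A ->
  (forall s t : R, is_derive s 1 (fun s => V (s, t)) (A (s, t))) ->
  \int[mu]_(x in ref_tri) (V x + x.1 * A x) =
  \int[leb]_(t in `]0%R, 1%R[) ((1 - t) * V (1 - t, t)).
Proof.
move=> cV cA dV.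
pose h x : R := V x + x.1 * A x.
have ch : continuous h.
  move=> x; apply: cvgD; first exact: cV.
  by apply: cvgM; [exact: cvg_fst|exact: cA].
have ih := continuous_integrable ch measurable_ref_tri ref_tri_box.
have {}ih := (integrable_mkcond _ measurable_ref_tri).1 ih.
rewrite [in RHS]Rintegral_mkcond /Rintegral integral_mkcond; congr fine.
rewrite -(integral21_prod_meas1 ih); apply: eq_integral => y _.
rewrite /fubini_G.
have [y01|y01] := boolP (y \in `]0%R, 1%R[%classic); last first.
  rewrite patchN//.
  apply: integral0_eq => x _; rewrite patchN//.
  apply/negP; rewrite inE/= => -[/= x0 y0 xy]; move/negP : y01; apply.
  by rewrite inE/= in_itv/=; apply/andP; split; lra.
rewrite patchT//; move: y01; rewrite inE/= in_itv/= => /andP[y0 y1].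
have -> : (fun z : mR => ((EFin \o h) \_ ref_tri) (z, y)) =
   (fun z : mR => (h (z, y))%:E) \_ `]0%R, (1 - y)%R[.
  apply/funext => z; rewrite /patch; congr (if _ then _ else _).
  apply/idP/idP; rewrite !inE/= in_itv/=.
    by case=> /= ? ? ?; apply/andP; split; lra.
  by move=> /andP[? ?]; split => //=; lra.
have dF (s : R) : is_derive s 1 (fun s => s * V (s, y)) (h (s, y)).
  have -> : h (s, y) = s *: A (s, y) + V (s, y) *: 1.
    by rewrite /h /GRing.scale/= mulr1 addrC.
  exact: is_deriveM (is_derive_id s (1 : R)) (dV s y).
have ch' : continuous (fun s => h (s, y)).
  move=> s; apply: (@continuous_comp _ _ _ (fun s => (s, y)) h); last exact: ch.
  by apply: continuous_pair => ?; [exact: cvg_id|exact: cvg_cst].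
have y1' : 0 < 1 - y by rewrite subr_gt0.
by rewrite -integral_mkcond (FTC_oo y1' dF ch') mul0r subr0.
Qed.

Lemma Rintegral_swap_ref (h : R * R -> R) : measurable_fun (setT : set mP) (h : mP -> mR) ->
  \int[mu]_(x in ref_tri) h x = \int[mu]_(x in ref_tri) h (x.2, x.1).
Proof.
move=> mh.
have E s : aff 0 (0, 1) (1, 0) s = (s.2, s.1) :> R * R.
  by rewrite affE/=; congr pair; ring.
have c : cross ((0, 1) : R * R) (1, 0) = -1 by rewrite /cross/=; ring.
rewrite (@Rintegral_aff R 0 (0, 1) (1, 0) ref_tri h) ?c ?oppr_eq0 ?oner_eq0//.
- rewrite normrN1 mul1r.
  have -> : aff 0 (0, 1) (1, 0) @^-1` ref_tri = ref_tri.
    apply/seteqP; split=> x; rewrite /preimage/= E => -[/= h1 h2 h3]; split => //; lra.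
  by apply: eq_Rintegral => x _; rewrite E.
- exact: measurable_ref_tri.
- exact: measurable_funTS mh.
Qed.

Lemma Rintegral_reflect (h : R -> R) : measurable_fun (`]0%R, 1%R[%classic : set mR) (h : mR -> mR) ->
  \int[leb]_(t in `]0%R, 1%R[) h (1 - t) = \int[leb]_(t in `]0%R, 1%R[) h t.
Proof.
move=> mh; rewrite /Rintegral; congr fine.
rewrite integral_mkcond [RHS]integral_mkcond.
have mh' : measurable_fun (setT : set mR) ((EFin \o h) \_ `]0%R, 1%R[ : mR -> \bar R).
  apply/(measurable_restrictT _ (measurable_itv _)).
  exact: (measurable_EFinP _ _).2 mh.
have -> : ((fun t => (h (1 - t))%:E) \_ `]0%R, 1%R[) =
   (fun t => ((EFin \o h) \_ `]0%R, 1%R[) (-1 * t + 1)).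
  apply/funext => t; rewrite /patch; have -> : -1 * t + 1 = 1 - t by ring.
  congr (if _ then _ else _); apply/idP/idP; rewrite !inE/= !in_itv/= => /andP[? ?];
    by apply/andP; split; lra.
set k := (_ \_ _) in mh' *.
have N1 : (-1 : R) != 0 by rewrite oppr_eq0 oner_eq0.
rewrite integralE [RHS]integralE; congr (_ - _)%E.
  rewrite [RHS](@ge0_integral_affine R (-1) 1)//; last exact: measurable_funepos.
  rewrite normrN1 mul1e; apply: eq_integral => x _.
  by rewrite -[fun t => _]/(k \o (fun t => -1 * t + 1)) funepos_comp.
rewrite [RHS](@ge0_integral_affine R (-1) 1)//; last exact: measurable_funeneg.
rewrite normrN1 mul1e; apply: eq_integral => x _.
by rewrite -[fun t => _]/(k \o (fun t => -1 * t + 1)) funeneg_comp.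
Qed.

Lemma continuous_integrable01 (h : R -> R) : continuous h ->
  leb.-integrable `]0%R, 1%R[ (EFin \o h).
Proof.
move=> ch.
have H : leb.-integrable (`[0%R, 1%R]%classic : set mR) (EFin \o h).
  apply: continuous_compact_integrable; first exact: segment_compact.
  exact: continuous_subspaceT.
apply: integrableS H; [exact: measurable_itv|exact: measurable_itv|].
exact: subset_itv_oo_cc.
Qed.

(** Divergence theorem for the field [V x *: x]: it is tangent to the two legs, so only the
    hypotenuse contributes. *)
Lemma green_ref (V A B : R * R -> R) : continuous V -> continuous A -> continuous B ->
  (forall s t : R, is_derive s 1 (fun s => V (s, t)) (A (s, t))) ->
  (forall s t : R, is_derive t 1 (fun t => V (s, t)) (B (s, t))) ->
  \int[mu]_(x in ref_tri) (x.1 * A x + x.2 * B x + 2 * V x) =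
  \int[leb]_(s in `]0%R, 1%R[) V (s, 1 - s).
Proof.
move=> cV cA cB dA dB.
have csw : continuous (fun x : R * R => (x.2, x.1)).
  by apply: continuous_pair => x; [exact: cvg_snd|exact: cvg_fst].
have c1 : continuous (fun x => V x + x.1 * A x).
  move=> x; apply: cvgD; first exact: cV.
  by apply: cvgM; [exact: cvg_fst|exact: cA].
have c2 : continuous (fun x => V x + x.2 * B x).
  move=> x; apply: cvgD; first exact: cV.
  by apply: cvgM; [exact: cvg_snd|exact: cB].
have mT := measurable_ref_tri.
transitivity (\int[mu]_(x in ref_tri) (V x + x.1 * A x) +
              \int[mu]_(x in ref_tri) (V x + x.2 * B x)).
  rewrite -RintegralD//=; last 2 first.
    exact: continuous_integrable c1 mT ref_tri_box.
    exact: continuous_integrable c2 mT ref_tri_box.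
  by apply: eq_Rintegral => x _; ring.
rewrite [X in _ + X](Rintegral_swap_ref (continuous_measurable_plane c2)).
rewrite (green_ref1 cV cA dA).
have cVs : continuous (fun x : R * R => V (x.2, x.1)).
  by move=> x; apply: (@continuous_comp _ _ _ (fun x : R * R => (x.2, x.1)) V); [exact: csw|exact: cV].
have cBs : continuous (fun x : R * R => B (x.2, x.1)).
  by move=> x; apply: (@continuous_comp _ _ _ (fun x : R * R => (x.2, x.1)) B); [exact: csw|exact: cB].
rewrite [X in _ + X](green_ref1 cVs cBs (fun s t => dB t s)).
have cd (F : R -> R * R) : continuous F -> continuous (fun s => V (F s)).
  by move=> cF s; apply: continuous_comp; [exact: cF|exact: cV].
have cs1 : continuous (fun s : R => (s, 1 - s)).
  by apply: continuous_pair => s; [exact: cvg_id|apply: cvgB; [exact: cvg_cst|exact: cvg_id]].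
have cm : continuous (fun t : R => t * V (t, 1 - t)).
  by move=> t; apply: cvgM; [exact: cvg_id|exact: (cd _ cs1)].
have cm' : continuous (fun t : R => (1 - t) * V (t, 1 - t)).
  move=> t; apply: cvgM; last exact: (cd _ cs1).
  by apply: cvgB; [exact: cvg_cst|exact: cvg_id].
(* The two coordinate parts contribute with weights [t] and [1 - t], which add up to one. *)
have -> : \int[leb]_(t in `]0%R, 1%R[) ((1 - t) * V (1 - t, t)) =
          \int[leb]_(t in `]0%R, 1%R[) (t * V (t, 1 - t)).
  rewrite -[RHS]Rintegral_reflect; last first.
    exact: measurable_funTS (continuous_measurable_fun cm).
  by apply: eq_Rintegral => t _; congr (_ * V (_, _)); ring.
rewrite -RintegralD//=; last 2 first.
- exact: continuous_integrable01.
- exact: continuous_integrable01.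
by apply: eq_Rintegral => t _; ring.
Qed.

End Green.

(** * Triangles *)

Section Triangle.
Variable R : realType.
Local Notation mR := (measurableTypeR R).
Local Notation mP := (measurableTypeR R * measurableTypeR R)%type.
Local Notation leb := (@lebesgue_measure R).
Local Notation mu := (mu2 R).
Implicit Types (w : R * R -> R) (G : R * R -> R * R) (x v : R * R).

Lemma fstD (u v : R * R) : (u + v).1 = u.1 + v.1. Proof. by []. Qed.
Lemma sndD (u v : R * R) : (u + v).2 = u.2 + v.2. Proof. by []. Qed.
Lemma fstN (u : R * R) : (- u).1 = - u.1. Proof. by []. Qed.
Lemma sndN (u : R * R) : (- u).2 = - u.2. Proof. by []. Qed.
Lemma fstZ (k : R) (u : R * R) : (k *: u).1 = k * u.1. Proof. by []. Qed.
Lemma sndZ (k : R) (u : R * R) : (k *: u).2 = k * u.2. Proof. by []. Qed.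
Definition planeE := (fstD, sndD, fstN, sndN, fstZ, sndZ).

Lemma plane_eq (u v : R * R) : u.1 = v.1 -> u.2 = v.2 -> u = v.
Proof. by case: u v => [? ?] [? ?] /= -> ->. Qed.

Section OneTriangle.
Variables (P e f : R * R).
Hypothesis D0 : cross e f != 0.

(** Coordinates in the affine frame [(P, e, f)] by Cramer's rule; together with [ct] they invert
    [aff P e f]. *)
Definition cs x := cross (x - P) f / cross e f.
Definition ct x := cross e (x - P) / cross e f.
Definition otr : set (R * R) := [set x | [/\ 0 < cs x, 0 < ct x & cs x + ct x < 1]].

Lemma aff_csct x : aff P e f (cs x, ct x) = x.
Proof.
rewrite affE; apply: plane_eq; rewrite /cs /ct /=; move: D0; rewrite /cross !planeE => D0';
  by field.
Qed.

Lemma cs_aff s : cs (aff P e f s) = s.1.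
Proof. by rewrite affE /cs; move: D0; rewrite /cross !planeE /= => D0'; field. Qed.

Lemma ct_aff s : ct (aff P e f s) = s.2.
Proof. by rewrite affE /ct; move: D0; rewrite /cross !planeE /= => D0'; field. Qed.

Lemma preimage_otr : aff P e f @^-1` otr = @ref_tri R.
Proof. by apply/seteqP; split=> s; rewrite /preimage/= /otr/= cs_aff ct_aff. Qed.

Lemma csE x : cs x = f.2 / cross e f * x.1 + (- f.1 / cross e f) * x.2 +
   (P.2 * f.1 - P.1 * f.2) / cross e f.
Proof. by rewrite /cs {1}/cross !planeE; field. Qed.

Lemma ctE x : ct x = - e.2 / cross e f * x.1 + e.1 / cross e f * x.2 +
   (e.2 * P.1 - e.1 * P.2) / cross e f.
Proof. by rewrite /ct {1}/cross !planeE; field. Qed.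

Lemma has_grad_cs : exists G, has_grad cs G.
Proof. by eexists; rewrite (funext csE); exact: has_grad_affine. Qed.

Lemma has_grad_ct : exists G, has_grad ct G.
Proof. by eexists; rewrite (funext ctE); exact: has_grad_affine. Qed.

Lemma has_grad_cr : exists G, has_grad (fun x => 1 - cs x - ct x) G.
Proof.
eexists; rewrite (_ : (fun x => _) = fun x =>
  (- (f.2 / cross e f) + e.2 / cross e f) * x.1 +
  (f.1 / cross e f - e.1 / cross e f) * x.2 +
  (1 - (P.2 * f.1 - P.1 * f.2) / cross e f - (e.2 * P.1 - e.1 * P.2) / cross e f)).
  exact: has_grad_affine.
by apply/funext => x; rewrite csE ctE; ring.
Qed.

Lemma open_otr : open otr.
Proof.
have [G1 [c1 _ _ _]] := has_grad_cs; have [G2 [c2 _ _ _]] := has_grad_ct.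
have [G3 [c3 _ _ _]] := has_grad_cr.
have -> : otr = cs @^-1` [set t | t > 0] `&` (ct @^-1` [set t | t > 0] `&`
   (fun x => 1 - cs x - ct x) @^-1` [set t | t > 0]).
  apply/seteqP; split=> x; rewrite /otr/=.
    by case=> h1 h2 h3; do !split => //; lra.
  by case=> h1 [h2 h3]; split => //; lra.
by do !apply: openI; [move/continuousP : c1|move/continuousP : c2|move/continuousP : c3];
  apply; exact: open_gt.
Qed.

Lemma measurable_otr : measurable (otr : set mP).
Proof. exact: open_measurable_plane open_otr. Qed.

Definition bound_tri : R := `|P.1| + `|e.1| + `|f.1| + (`|P.2| + `|e.2| + `|f.2|).

Lemma closed_tri_box x : 0 <= cs x -> 0 <= ct x -> cs x + ct x <= 1 -> box bound_tri x.
Proof.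
move=> s0 t0 st; rewrite -(aff_csct x) affE.
have b (p q r s t : R) : 0 <= s -> 0 <= t -> s + t <= 1 ->
    `|p + s * q + t * r| <= `|p| + `|q| + `|r|.
  move=> h1 h2 h3; apply: le_trans (ler_normD _ _) _; apply: lerD.
    apply: le_trans (ler_normD _ _) _; rewrite lerD2l normrM ger0_norm//.
    by rewrite ler_piMl//; lra.
  by rewrite normrM ger0_norm// ler_piMl//; lra.
have h1 := b P.1 e.1 f.1 _ _ s0 t0 st; have h2 := b P.2 e.2 f.2 _ _ s0 t0 st.
have n2 : 0 <= `|P.2| + `|e.2| + `|f.2| by rewrite !addr_ge0.
have n1 : 0 <= `|P.1| + `|e.1| + `|f.1| by rewrite !addr_ge0.
by split; rewrite /= in_itv/= -ler_norml; [apply: le_trans h1 _|apply: le_trans h2 _];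
  rewrite /bound_tri; lra.
Qed.

Lemma otr_box : otr `<=` box bound_tri.
Proof. by move=> x [h1 h2 h3]; apply: closed_tri_box; lra. Qed.

Lemma Rintegral_otr (g : R * R -> R) : measurable_fun otr (g : mP -> mR) ->
  \int[mu]_(x in otr) g x = `|cross e f| * \int[mu]_(s in (@ref_tri R)) g (aff P e f s).
Proof.
by move=> mg; rewrite (@Rintegral_aff R P e f otr g D0 measurable_otr mg) preimage_otr.
Qed.

(** Divergence theorem for [w x *: (x - P)], which is tangent to the two sides through [P]. With [P]
    the vertex opposite to an edge, this computes the normal trace of the local Raviart-Thomas
    field. *)
Lemma green_tri w : C1 w ->
  \int[mu]_(x in otr) (dot (x - P) (grad w x) + 2 * w x) =
  `|cross e f| * \int[leb]_(s in `]0%R, 1%R[) w (P + s *: e + (1 - s) *: f).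
Proof.
move=> /C1_has_grad [cw cg1 cg2 dw].
have cg (u : R * R -> R * R) : continuous (fun x => (u x).1) -> continuous (fun x => (u x).2) ->
    continuous (fun x => dot (u x) (grad w x)).
  move=> c1 c2 x; apply: cvgD; apply: cvgM;
    [exact: c1|exact: cg1|exact: c2|exact: cg2].
have ca : continuous (aff P e f).
  have -> : aff P e f = fun s => (e.1 * s.1 + f.1 * s.2 + P.1, e.2 * s.1 + f.2 * s.2 + P.2).
    by apply/funext => s; rewrite affE; congr pair; ring.
  by apply: continuous_pair; exact: continuous_affine_form.
have cP1 : continuous (fun x => (x - P).1).
  rewrite (_ : (fun x => _) = fun x => 1 * x.1 + 0 * x.2 + - P.1); first by
    exact: continuous_affine_form.
  by apply/funext => x; rewrite !planeE; ring.
have cP2 : continuous (fun x => (x - P).2).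
  rewrite (_ : (fun x => _) = fun x => 0 * x.1 + 1 * x.2 + - P.2); first by
    exact: continuous_affine_form.
  by apply/funext => x; rewrite !planeE; ring.
rewrite Rintegral_otr; last first.
  apply: measurable_funTS; apply: continuous_measurable_plane => x; apply: cvgD.
    exact: cg cP1 cP2 x.
  by apply: cvgM; [exact: cvg_cst|exact: cw].
congr (_ * _).
pose V s := w (aff P e f s).
pose A s := dot e (grad w (aff P e f s)).
pose B s := dot f (grad w (aff P e f s)).
have cV : continuous V by move=> s; apply: continuous_comp; [exact: ca|exact: cw].
have cA : continuous A.
  move=> s; apply: (@continuous_comp _ _ _ _ (fun x => dot e (grad w x))); first exact: ca.
  by apply: cg; exact: cst_continuous.
have cB : continuous B.
  move=> s; apply: (@continuous_comp _ _ _ _ (fun x => dot f (grad w x))); first exact: ca.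
  by apply: cg; exact: cst_continuous.
have dA (s t : R) : is_derive s 1 (fun s => V (s, t)) (A (s, t)).
  have E r : aff P e f (r, t) = (P + t *: f) + r *: e by rewrite /aff/= addrAC.
  rewrite /V /A dotC (_ : (fun s => _) = fun s => w ((P + t *: f) + s *: e)).
    by rewrite E; apply: is_derive_line; exact: dw.
  by apply/funext => r; rewrite E.
have dB (s t : R) : is_derive t 1 (fun t => V (s, t)) (B (s, t)).
  by rewrite /V /B dotC; apply: (@is_derive_line _ w (P + s *: e) f t); exact: dw.
rewrite -(green_ref cV cA cB dA dB); apply: eq_Rintegral => s _.
rewrite /A /B /V; congr (_ + _).
have -> : aff P e f s - P = s.1 *: e + s.2 *: f.
  by rewrite affE; apply: plane_eq; rewrite !planeE /=; ring.
by rewrite dotDl !dotZl.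
Qed.

Lemma area_otr : fine (mu otr) = `|cross e f| / 2.
Proof.
have := @Rintegral_cst _ _ _ mu otr measurable_otr 1; rewrite mul1r => <-.
rewrite Rintegral_otr//; congr (_ * _).
have c (k : R) : continuous (fun _ : R * R => k) by exact: cst_continuous.
(* For [V] constantly 1 the formula says that twice the area of the reference triangle is 1. *)
have H := @green_ref R (fun=> 1) (fun=> 0) (fun=> 0) (c 1) (c 0) (c 0)
  (fun s t => is_derive_cst _ _ _) (fun s t => is_derive_cst _ _ _).
have I1 : \int[leb]_(s in `]0%R, 1%R[) (1 : R) = 1.
  rewrite Rintegral_cst ?mul1r; last exact: measurable_itv.
  have L : leb `]0%R, 1%R[%classic = 1%E.
    by rewrite lebesgue_measure_itv/= lte01 -EFinB subr0.
  exact: (congr1 fine L).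
rewrite I1 /= in H.
have : \int[mu]_(x in (@ref_tri R)) ((x.1 * 0 + x.2 * 0 + 2 * 1) : R) =
   2 * \int[mu]_(x in (@ref_tri R)) (1 : R).
  rewrite -RintegralZl//.
  - by apply: eq_Rintegral => x _; ring.
  - exact: measurable_ref_tri.
  - exact: continuous_integrable (c 1) (@measurable_ref_tri R) (@ref_tri_box R).
by rewrite H => h; lra.
Qed.

End OneTriangle.

(** * A C1 profile for cutoff functions *)

Definition ramp2 (t : R) : R := Num.max (t - 1) 0 ^+ 2.
(** The squared positive part is C1, and [q] to [1 - 1 / (1 + q)] keeps this while bringing the
    values into the unit interval: the result vanishes up to 1 and tends to 1 at infinity. *)
Definition ramp (t : R) : R := 1 - (1 + ramp2 t)^-1.

Lemma ramp2_ge0 t : 0 <= ramp2 t. Proof. exact: sqr_ge0. Qed.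

Lemma is_derive_ramp2 (t : R) : is_derive t 1 ramp2 (2 * Num.max (t - 1) 0).
Proof.
suff H : (fun h : R => h^-1 *: ((ramp2 \o shift t) (h *: (1 : R)) - ramp2 t)) @ 0^' -->
    2 * Num.max (t - 1) 0.
  by split; [apply/cvg_ex; eexists; exact: H|exact/cvg_lim].
apply/cvgrPdist_lt => eps e0; near=> h.
have h0 : h != 0 by near: h; exact: nbhs_dnbhs_neq.
have he : `|h| < eps by near: h; exact: dnbhs0_lt.
rewrite /= [h *: 1]mulr1.
set a := Num.max (t - 1) 0; set b := Num.max (h + t - 1) 0.
(* A quadratic remainder bound that holds on either side of the kink of the positive part and across
   it. *)
have key : `|ramp2 (h + t) - ramp2 t - 2 * a * h| <= h ^+ 2.
  rewrite /ramp2 -/a -/b ler_norml /a /b.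
  by case: (leP 0 (t - 1)) => h1; case: (leP 0 (h + t - 1)) => h2; apply/andP; split; nra.
apply: le_lt_trans he.
have hp : 0 < `|h| by rewrite normr_gt0.
rewrite -(ler_pM2l hp) -normrM -expr2 real_normK ?num_real//.
apply: le_trans key; rewrite -normrN le_eqVlt; apply/orP; left; apply/eqP; congr (`|_|).
by rewrite /GRing.scale/=; field.
Unshelve. all: by end_near.
Qed.

Lemma ramp_bounds t : 0 <= ramp t <= 1.
Proof.
have r0 := ramp2_ge0 t; rewrite /ramp.
have : 0 <= (1 + ramp2 t)^-1 by rewrite invr_ge0; lra.
have : (1 + ramp2 t)^-1 <= 1 by rewrite invf_le1; lra.
by move=> h1 h2; apply/andP; split; lra.
Qed.

Lemma ramp_eq0 t : t <= 1 -> ramp t = 0.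
Proof. by move=> t1; rewrite /ramp /ramp2 max_r ?subr_le0// expr0n addr0 invr1 subrr. Qed.

Lemma ramp_near1 t : 0 < t -> 1 - ramp t <= 2 / t.
Proof.
move=> t0; rewrite /ramp opprB addrC subrK.
rewrite ler_pdivlMr// mulrC ler_pdivrMr; last by have := ramp2_ge0 t; lra.
(* The claim [t <= 2 * (1 + (t - 1) ^+ 2)] reads [0 <= 2 * t ^+ 2 - 5 * t + 4], a quadratic with its
   minimum at 5/4. *)
have := sqr_ge0 (t - 5 / 4).
by rewrite /ramp2; case: (leP (t - 1) 0) => h; rewrite ?expr0n /=; nra.
Qed.

Lemma ramp_C1 : exists2 dF : R -> R, continuous dF &
  forall s : R, is_derive s 1 ramp (dF s).
Proof.
have p t : 1 + ramp2 t != 0 by have := ramp2_ge0 t; lra.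
have cm : continuous (fun t : R => Num.max (t - 1) 0).
  have cs1 : continuous (fun t : R => t - 1).
    by move=> t; apply: cvgB; [exact: cvg_id|exact: cvg_cst].
  have -> : (fun t : R => Num.max (t - 1) 0) = (fun t => (t - 1 + `|t - 1|) * 2^-1).
    apply/funext => t; case: (leP (t - 1) 0) => h.
      by rewrite ler0_norm// addrN mul0r.
    by rewrite gtr0_norm//; field.
  move=> t; apply: cvgM; last exact: cvg_cst.
  apply: cvgD; first exact: cs1.
  by apply: (@continuous_comp _ _ _ (fun t : R => t - 1)); [exact: cs1|exact: norm_continuous].
exists (fun t => (1 + ramp2 t) ^- 2 * (2 * Num.max (t - 1) 0)).
  move=> t; apply: cvgM; last by apply: cvgM; [exact: cvg_cst|exact: cm].
  apply: cvgV; first by rewrite expf_neq0.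
  by apply: cvgM; apply: cvgD; (exact: cvg_cst || (apply: cvgM; exact: cm)).
move=> s; have d1 := is_deriveD (is_derive_cst (1:R) s (1:R)) (is_derive_ramp2 s).
have d2 := @is_deriveV R (cst 1 + ramp2) s _ _ (p s) d1.
have d3 := is_deriveB (is_derive_cst (1:R) s (1:R)) d2.
by apply: is_derive_eq d3 _; rewrite /GRing.scale/= add0r; ring.
Qed.

End Triangle.

(** * Weak divergence *)

Section WeakDivergence.
Variable R : realType.
Local Notation mR := (measurableTypeR R).
Local Notation mP := (measurableTypeR R * measurableTypeR R)%type.
Local Notation leb := (@lebesgue_measure R).
Local Notation mu := (mu2 R).
Implicit Types (w : R * R -> R) (G : R * R -> R * R) (x v : R * R).

Lemma has_grad_cst (k : R) : has_grad (fun=> k) (fun=> (0, 0)).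
Proof.
have -> : (fun=> k) = (fun x : R * R => 0 * x.1 + 0 * x.2 + k).
  by apply/funext => x; ring.
exact: has_grad_affine.
Qed.

Lemma C1M w1 w2 : C1 w1 -> C1 w2 -> C1 (fun x => w1 x * w2 x).
Proof. by move=> /C1_has_grad h1 /C1_has_grad h2; exact: has_grad_C1 (has_gradM h1 h2). Qed.

Lemma C1cM D w1 w2 : C1 w1 -> C1c D w2 -> C1c D (fun x => w1 x * w2 x).
Proof.
move=> c1 [c2 [C [cC CD C0]]]; split; first exact: C1M.
by exists C; split => // x /C0 ->; rewrite mulr0.
Qed.

Lemma C1_cst (k : R) : C1 (fun _ : R * R => k).
Proof. exact: has_grad_C1 (has_grad_cst k). Qed.

Lemma C1_continuous w : C1 w -> continuous w.
Proof. by case/C1_has_grad. Qed.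

Lemma C1c_subset D E w : D `<=` E -> C1c D w -> C1c E w.
Proof.
move=> DE [c1 [C [cC CD C0]]]; split => //; exists C; split => //.
exact: subset_trans DE.
Qed.

Lemma ramp_scaled_cvg (t : R) : 0 < t ->
  (fun n : nat => ramp (n.+1%:R * t : R)) @ \oo --> (1 : R).
Proof.
move=> t0; apply/cvgrPdist_lt => eps e0.
have /cvgrPdist_lt/(_ (eps * t / 2)) := @cvg_harmonic R.
rewrite !divr_gt0 ?mulr_gt0// => /(_ isT); apply: filterS => n.
rewrite sub0r normrN ger0_norm ?invr_ge0// /harmonic/= => h.
have nt : 0 < n.+1%:R * t by rewrite mulr_gt0.
have /andP[b0 b1] := ramp_bounds (n.+1%:R * t).
rewrite ger0_norm ?subr_ge0//; apply: le_lt_trans (ramp_near1 nt) _.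
have -> : 2 / (n.+1%:R * t) = n.+1%:R^-1 * (2 / t) by rewrite invfM mulrCA.
rewrite -ltr_pdivlMr ?divr_gt0//.
by have -> : eps / (2 / t) = eps * t / 2 by field; lra.
Qed.

(** One ramp for each barycentric coordinate, scaled by [n + 1]. As [ramp] vanishes up to 1, the
    product lives where all three coordinates are at least [1 / (n + 1)], a compact part of the open
    triangle. *)
Lemma tri_cutoff (P e f : R * R) : cross e f != 0 ->
  exists chi : nat -> R * R -> R,
  [/\ forall n, C1c (otr P e f) (chi n), forall n x, 0 <= chi n x <= 1 &
      forall x, otr P e f x -> chi n x @[n --> \oo] --> (1 : R)].
Proof.
move=> D0; have [G1 H1] := has_grad_cs P D0; have [G2 H2] := has_grad_ct P D0.
have [G3 H3] := has_grad_cr P D0.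
have [dF cdF HF] := @ramp_C1 R.
exists (fun n x => ramp (n.+1%:R * cs P e f x) * (ramp (n.+1%:R * ct P e f x) *
   ramp (n.+1%:R * (1 - cs P e f x - ct P e f x)))).
have cb w G (k : R) : has_grad w G -> C1 (fun x => ramp (k * w x)).
  move=> Hw; have := has_grad_comp cdF HF (has_gradM (has_grad_cst k) Hw).
  exact: has_grad_C1.
split.
- move=> n; split.
    by apply: C1M; [exact: cb H1|apply: C1M; [exact: cb H2|exact: cb H3]].
  have n0 : 0 < n.+1%:R :> R by rewrite ltr0n.
  pose L := fun w : R * R -> R => w @^-1` [set t | n.+1%:R^-1 <= t].
  exists (L (cs P e f) `&` (L (ct P e f) `&` L (fun x => 1 - cs P e f x - ct P e f x))).
  have i0 : 0 < n.+1%:R^-1 :> R by rewrite invr_gt0.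
  split.
  + apply: (subclosed_compact _ (@compact_box R (bound_tri P e f))).
      have cL w : continuous w -> closed (L w).
        by move=> cw; apply: (closed_comp (fun x _ => cw x)); exact: closed_ge.
      by do !apply: closedI; apply: cL; [case: H1|case: H2|case: H3].
    move=> x [h1 [h2 h3]]; move: i0 h1 h2 h3; rewrite /L/=; set i := n.+1%:R^-1.
    by move=> i0 h1 h2 h3; apply: closed_tri_box => //; lra.
  + move=> x [h1 [h2 h3]]; move: i0 h1 h2 h3; rewrite /L/=; set i := n.+1%:R^-1.
    by move=> i0 h1 h2 h3; split; lra.
  + move=> x Cx.
    have z w : ~ L w x -> ramp (n.+1%:R * w x) = 0.
      move=> /negP; rewrite -ltNge => h; apply: ramp_eq0.
      by rewrite mulrC -ler_pdivlMr// mul1r ltW.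
    have [l1|/z ->] := pselect (L (cs P e f) x); last by rewrite mul0r.
    have [l2|/z ->] := pselect (L (ct P e f) x); last by rewrite mul0r mulr0.
    have [l3|/z ->] := pselect (L (fun x => 1 - cs P e f x - ct P e f x) x).
      by exfalso; apply: Cx; split.
    by rewrite !mulr0.
- move=> n x; have /andP[a0 a1] := ramp_bounds (n.+1%:R * cs P e f x).
  have /andP[b0 b1] := ramp_bounds (n.+1%:R * ct P e f x).
  have /andP[c0 c1] := ramp_bounds (n.+1%:R * (1 - cs P e f x - ct P e f x)).
  by rewrite !mulr_ge0//= !mulr_ile1// ?mulr_ge0.
- move=> x [h1 h2 h3].
  rewrite -[X in _ --> X](_ : 1 * (1 * 1) = 1 :> R); last by rewrite !mulr1.
  apply: cvgM; first exact: ramp_scaled_cvg.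
  by apply: cvgM; apply: ramp_scaled_cvg => //; lra.
Qed.

Lemma cutoff_cvg (D : set mP) (h : R * R -> R) (chi : nat -> R * R -> R) :
  measurable D -> mu.-integrable D (EFin \o h) ->
  (forall n, continuous (chi n)) -> (forall n x, 0 <= chi n x <= 1) ->
  (forall x, D x -> chi n x @[n --> \oo] --> (1 : R)) ->
  (\int[mu]_(x in D) (h x * chi n x)%:E @[n --> \oo] --> \int[mu]_(x in D) (h x)%:E)%E.
Proof.
move=> mD ih cc cb c1.
have mh : measurable_fun D h by apply/measurable_EFinP; exact: measurable_int ih.
have [] // := @dominated_convergence _ _ _ mu D mD (fun n x => (h x * chi n x)%:E)
  (EFin \o h) (fun x => `|h x|%:E).
- move=> n; apply/measurable_EFinP; apply: measurable_funM => //.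
  exact: measurable_funTS (continuous_measurable_plane (cc n)).
- exact/measurable_EFinP.
- apply: aeW => x Dx; apply: cvg_EFin; first exact: nearW.
  rewrite -[X in _ --> X]mulr1; apply: cvgM; [exact: cvg_cst|exact: c1].
- exact: integrable_norm.
- apply: aeW => x n Dx; rewrite abse_EFin lee_fin normrM.
  by have /andP[a b] := cb n x; rewrite [`|chi n x|]ger0_norm// ler_piMr.
Qed.

Lemma integrable_div m (D : set mP) psi d w : measurable D -> D `<=` box m ->
  L2v D psi -> L2 D d -> C1 w ->
  mu.-integrable D (fun x => (dot (psi x) (grad w x))%:E) /\
  mu.-integrable D (fun x => (w x * d x)%:E).
Proof.
move=> mD Dm Lp Ld /C1_has_grad [cw c1 c2 _].
split; last by apply: L2M_integrable => //; exact: L2_continuous Dm.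
by apply: L2v_dot_integrable => //; split; exact: L2_continuous Dm.
Qed.

(* [is_div] only tests against compactly supported functions: multiply [w] by
   cutoffs tending to 1 on the triangle and pass to the limit. *)
Lemma div_unique m (D : set mP) psi d d' (P e f : R * R) w : cross e f != 0 ->
  measurable D -> D `<=` box m -> otr P e f `<=` D ->
  is_div D psi d -> is_div D psi d' -> C1 w ->
  \int[mu]_(x in otr P e f) (w x * d x) = \int[mu]_(x in otr P e f) (w x * d' x).
Proof.
move=> D0 mD Dm TD [Lp Ld Hd] [_ Ld' Hd'] C1w.
have [chi [cc cb c1]] := tri_cutoff P D0.
have mT := measurable_otr P D0.
have cchi n : continuous (chi n) by case: (cc n) => /C1_continuous.
(* The right-hand side does not mention [h], so the integrals of [d] and [d'] against each cutoff
   agree. *)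
have step (h : R * R -> R) : L2 D h ->
    (forall w, C1c D w -> \int[mu]_(x in D) (dot (psi x) (grad w x) + w x * h x) = 0) ->
    forall n, \int[mu]_(x in otr P e f) (w x * h x * chi n x) =
    - \int[mu]_(x in D) dot (psi x) (grad (fun x => w x * chi n x) x).
  move=> Lh Hh n.
  have Cn : C1c D (fun x => w x * chi n x) by apply: C1c_subset TD _; exact: C1cM.
  have [i1 i2] := integrable_div mD Dm Lp Lh Cn.1.
  have := Hh _ Cn; rewrite RintegralD// => /eqP; rewrite addrC addr_eq0 => /eqP <-.
  rewrite (Rintegral_zero_outside TD).
    by apply: eq_Rintegral => x _; rewrite mulrAC.
  move=> x _ nT; have [C [_ CT C0]] := (cc n).2.
  by rewrite C0 ?mulr0 ?mul0r// => Cx; apply: nT; exact: CT.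
have iw h : L2 D h -> mu.-integrable (otr P e f) (fun x => (w x * h x)%:E).
  move=> Lh; apply: (integrableS mD mT TD).
  by have [] := integrable_div mD Dm Lp Lh C1w.
have iwc h n : L2 D h -> mu.-integrable (otr P e f) (fun x => (w x * h x * chi n x)%:E).
  move=> Lh; rewrite (_ : (fun x => _) = fun x => (w x * chi n x * h x)%:E).
    apply: (integrableS mD mT TD).
    by have [] := integrable_div mD Dm Lp Lh (C1M C1w (cc n).1).
  by apply/funext => x; rewrite mulrAC.
have L1 := cutoff_cvg mT (iw _ Ld) cchi cb c1.
have L2 := cutoff_cvg mT (iw _ Ld') cchi cb c1.
congr fine; apply: (cvg_unique _ L1).
  exact: ereal_hausdorff.
apply: cvg_trans L2; apply: near_eq_cvg; apply: nearW => n.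
have E := step _ Ld Hd n; rewrite -(step _ Ld' Hd' n) in E.
rewrite /Rintegral in E; rewrite -[LHS]fineK -1?[RHS]fineK ?E//;
  exact: integrable_fin_num (iwc _ _ _).
Qed.

Lemma wdivP (D : set (R * R)) psi : Hdiv D psi -> is_div D psi (wdiv D psi).
Proof. by move=> H; exact: (xgetPex (fun=> 0) H). Qed.

Lemma is_divD m (D : set mP) psi psi' d d' : measurable D -> D `<=` box m ->
  is_div D psi d -> is_div D psi' d' ->
  is_div D (fun x => psi x + psi' x) (fun x => d x + d' x).
Proof.
move=> mD Dm [[p1 p2] Ld H] [[q1 q2] Ld' H']; split.
- by split; rewrite /=; apply: L2D.
- exact: L2D.
- move=> w Cw; have [i1 i2] := integrable_div mD Dm (conj p1 p2) Ld Cw.1.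
  have [i3 i4] := integrable_div mD Dm (conj q1 q2) Ld' Cw.1.
  rewrite -[RHS]addr0 -{1}(H w Cw) -(H' w Cw) -RintegralD//=; last 2 first.
  + by rewrite (_ : _ \o _ = fun x => (dot (psi x) (grad w x))%:E + (w x * d x)%:E)%E;
      [exact: integrableD|apply/funext => x /=; rewrite EFinD].
  + by rewrite (_ : _ \o _ = fun x => (dot (psi' x) (grad w x))%:E + (w x * d' x)%:E)%E;
      [exact: integrableD|apply/funext => x /=; rewrite EFinD].
  by apply: eq_Rintegral => x _; rewrite dotDl; ring.
Qed.

Lemma is_divZ m (D : set mP) psi d (k : R) : measurable D -> D `<=` box m ->
  is_div D psi d -> is_div D (fun x => k *: psi x) (fun x => k * d x).
Proof.
move=> mD Dm [[p1 p2] Ld H]; split.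
- by split; rewrite /=; apply: L2Z.
- exact: L2Z.
- move=> w Cw; have [i1 i2] := integrable_div mD Dm (conj p1 p2) Ld Cw.1.
  rewrite -[RHS](mulr0 k) -(H w Cw) -RintegralZl//=; last first.
    by rewrite (_ : _ \o _ = fun x => (dot (psi x) (grad w x))%:E + (w x * d x)%:E)%E;
      [exact: integrableD|apply/funext => x /=; rewrite EFinD].
  by apply: eq_Rintegral => x _; rewrite dotZl; ring.
Qed.

Lemma is_div0 (D : set mP) : measurable D -> is_div D (fun=> 0) (fun=> 0).
Proof.
move=> mD; split; [by split; exact: L2_0|exact: L2_0|].
move=> w _; rewrite (@Rintegral_zero_outside R D set0) ?Rintegral_set0// => x _ _.
by rewrite /dot /= !mul0r mulr0 !addr0.
Qed.

Lemma is_div_eq (D : set mP) psi psi' d d' : measurable D ->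
  (forall x, D x -> psi x = psi' x) -> (forall x, D x -> d x = d' x) ->
  is_div D psi d -> is_div D psi' d'.
Proof.
move=> mD pp dd [[p1 p2] Ld H]; split.
- by split; [apply: L2_eq p1 => // x /pp ->|apply: L2_eq p2 => // x /pp ->].
- exact: L2_eq Ld.
- move=> w /H <-; apply: eq_Rintegral => x; rewrite inE => Dx.
  by rewrite pp// dd.
Qed.

End WeakDivergence.

(** * Geometry of the mesh *)

Section Ord3.
Implicit Types i j : 'I_3.

Lemma ord3_11 i : i + 1 + 1 = i + 2%:R. Proof. by rewrite -addrA. Qed.
Lemma ord3_12 i : i + 1 + 2%:R = i.
Proof. by case: i => [[|[|[|//]]] ?]; apply: val_inj. Qed.
Lemma ord3_21 i : i + 2%:R + 1 = i.
Proof. by case: i => [[|[|[|//]]] ?]; apply: val_inj. Qed.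
Lemma ord3_22 i : i + 2%:R + 2%:R = i + 1.
Proof. by case: i => [[|[|[|//]]] ?]; apply: val_inj. Qed.
Definition ord3E := (ord3_11, ord3_12, ord3_21, ord3_22).

Lemma ord3_n01 i : (i == i + 1) = false.
Proof. by case: i => [[|[|[|//]]] ?]. Qed.
Lemma ord3_n02 i : (i == i + 2%:R) = false.
Proof. by case: i => [[|[|[|//]]] ?]. Qed.
Lemma ord3_n12 i : (i + 1 == i + 2%:R) = false.
Proof. by case: i => [[|[|[|//]]] ?]. Qed.

(** Cases relative to [i]: statements about a triangle are proved in the cyclic order that starts at
    the vertex opposite to the edge in question. *)
Variant ord3_spec i : 'I_3 -> Type :=
  | Ord3Same : ord3_spec i i
  | Ord3Succ : ord3_spec i (i + 1)
  | Ord3Pred : ord3_spec i (i + 2%:R).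

Lemma ord3P i j : ord3_spec i j.
Proof.
have [->|ji] := eqVneq j i; first exact: Ord3Same.
have [->|ji1] := eqVneq j (i + 1); first exact: Ord3Succ.
suff -> : j = i + 2%:R by exact: Ord3Pred.
by apply: val_inj; move: ji ji1; case: i => [[|[|[|//]]] ?]; case: j => [[|[|[|//]]] ?].
Qed.

Lemma sum3 (V : nmodType) i (F : 'I_3 -> V) :
  \sum_j F j = F i + F (i + 1) + F (i + 2%:R).
Proof.
have E (a b c : V) : a + (b + (c + 0)) = a + b + c by rewrite addr0 addrA.
rewrite (reindex_inj (addrI i)) 3!big_ord_recl big_ord0 /= E.
by congr (F _ + F _ + F _); case: i => [[|[|[|//]]] ?]; apply: val_inj.
Qed.

Lemma all3 i (Q : 'I_3 -> Prop) : Q i -> Q (i + 1) -> Q (i + 2%:R) -> forall j, Q j.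
Proof. by move=> ? ? ? j; case: (ord3P i j). Qed.

Lemma set2_inj (T : finType) (a b c d : T) :
  [set a; b]%SET = [set c; d]%SET -> a != b ->
  (a = c /\ b = d) \/ (a = d /\ b = c).
Proof.
move=> E ab.
have /set2P[ac|ad] : a \in [set c; d]%SET by rewrite -E set21.
  have /set2P[bc|bd] : b \in [set c; d]%SET by rewrite -E set22.
    by move: ab; rewrite ac bc eqxx.
  by left.
have /set2P[bc|bd] : b \in [set c; d]%SET by rewrite -E set22.
  by right.
by move: ab; rewrite ad bd eqxx.
Qed.

End Ord3.

(** * Barycentric coordinates, neighbours and outward normals *)

Section Geometry.
Variables (R : realType) (Omega : set (R * R)) (M : mesh Omega).
Local Notation mR := (measurableTypeR R).
Local Notation mP := (measurableTypeR R * measurableTypeR R)%type.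
Local Notation mu := (mu2 R).
Implicit Types (K L : tri M) (i j : 'I_3) (a b : {set vtx M}) (x : R * R).

(** Twice the signed area. Its sign is the orientation of the vertices, which differs from triangle
    to triangle. *)
Definition sarea2 K : R := cross (W K 1 - W K 0) (W K 2%:R - W K 0).

Lemma sarea2_neq0 K : sarea2 K != 0. Proof. exact: vert_nondegenerate. Qed.

Lemma sarea2E K i : cross (eS K i - W K i) (eN K i - W K i) = sarea2 K.
Proof.
rewrite /sarea2 /eS /eN /cross !planeE; case: i => [[|[|[|//]]] p].
- have -> : Ordinal p = 0 by apply: val_inj.
  by rewrite !add0r.
- have -> : Ordinal p = 1 by apply: val_inj.
  have -> : 1 + 1 = 2%:R :> 'I_3 by [].
  have -> : 1 + 2%:R = 0 :> 'I_3 by apply: val_inj.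
  ring.
- have -> : Ordinal p = 2%:R by apply: val_inj.
  have -> : 2%:R + 1 = 0 :> 'I_3 by apply: val_inj.
  have -> : 2%:R + 2%:R = 1 :> 'I_3 by apply: val_inj.
  ring.
Qed.

Lemma edge_cross_neq0 K i : cross (eS K i - W K i) (eN K i - W K i) != 0.
Proof. by rewrite sarea2E sarea2_neq0. Qed.

(** Barycentric coordinate as a quotient of signed areas, [x] taking the place of [W K i] in the
    numerator; the orientation of [K] cancels. *)
Definition bary K i x : R := cross (eS K i - x) (eN K i - x) / sarea2 K.

Lemma eS_succ K i : eS K (i + 1) = eN K i. Proof. by rewrite /eS /eN ord3E. Qed.
Lemma eN_succ K i : eN K (i + 1) = W K i. Proof. by rewrite /eN ord3E. Qed.
Lemma eS_pred K i : eS K (i + 2%:R) = W K i. Proof. by rewrite /eS ord3E. Qed.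
Lemma eN_pred K i : eN K (i + 2%:R) = eS K i. Proof. by rewrite /eN ord3E. Qed.

Lemma bary_cs K i x : bary K (i + 1) x = cs (W K i) (eS K i - W K i) (eN K i - W K i) x.
Proof.
rewrite /bary /cs sarea2E eS_succ eN_succ; congr (_ / _).
by rewrite /cross !planeE; ring.
Qed.

Lemma bary_ct K i x : bary K (i + 2%:R) x = ct (W K i) (eS K i - W K i) (eN K i - W K i) x.
Proof.
rewrite /bary /ct sarea2E eS_pred eN_pred; congr (_ / _).
by rewrite /cross !planeE; ring.
Qed.

Lemma bary_sum K i x : bary K i x + bary K (i + 1) x + bary K (i + 2%:R) x = 1.
Proof.
rewrite /bary eS_succ eN_succ eS_pred eN_pred -(sarea2E K i).
have := edge_cross_neq0 K i; rewrite /cross !planeE => D0; by field.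
Qed.

Lemma bary_recon K i x :
  bary K i x *: W K i + bary K (i + 1) x *: eS K i + bary K (i + 2%:R) x *: eN K i = x.
Proof.
rewrite /bary eS_succ eN_succ eS_pred eN_pred -(sarea2E K i).
have := edge_cross_neq0 K i; rewrite /cross !planeE => D0.
by apply: plane_eq; rewrite !planeE; field.
Qed.

Lemma bary_comb K i (p q r : R) : p + q + r = 1 ->
  bary K i (p *: W K i + q *: eS K i + r *: eN K i) = p.
Proof.
move=> h; have -> : p = 1 - q - r by lra.
rewrite /bary -(sarea2E K i).
have := edge_cross_neq0 K i; rewrite /cross !planeE => D0; by field.
Qed.

Lemma bary_comb1 K i (p q r : R) : p + q + r = 1 ->
  bary K (i + 1) (p *: W K i + q *: eS K i + r *: eN K i) = q.
Proof.
move=> h; have -> : p *: W K i + q *: eS K i + r *: eN K i =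
    q *: W K (i + 1) + r *: eS K (i + 1) + p *: eN K (i + 1).
  rewrite eS_succ eN_succ -[W K (i + 1)]/(eS K i).
  by apply: plane_eq; rewrite !planeE; ring.
by rewrite bary_comb//; lra.
Qed.

Lemma bary_comb2 K i (p q r : R) : p + q + r = 1 ->
  bary K (i + 2%:R) (p *: W K i + q *: eS K i + r *: eN K i) = r.
Proof.
move=> h; have := bary_sum K i (p *: W K i + q *: eS K i + r *: eN K i).
by rewrite bary_comb// bary_comb1//; lra.
Qed.

Lemma bary_affine K i (t : R) x y :
  bary K i (x + t *: (y - x)) = (1 - t) * bary K i x + t * bary K i y.
Proof. by rewrite /bary /cross !planeE; field; exact: sarea2_neq0. Qed.

Lemma bary_self K i : bary K i (W K i) = 1.
Proof.
have E : 1 + 0 + 0 = 1 :> R by lra.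
rewrite -[RHS](bary_comb K i E); congr bary.
by apply: plane_eq; rewrite !planeE; ring.
Qed.

Lemma bary_eS K i : bary K i (eS K i) = 0.
Proof.
have E : 0 + 1 + 0 = 1 :> R by lra.
rewrite -[RHS](bary_comb K i E); congr bary.
by apply: plane_eq; rewrite !planeE; ring.
Qed.

Lemma bary_eN K i : bary K i (eN K i) = 0.
Proof.
have E : 0 + 0 + 1 = 1 :> R by lra.
rewrite -[RHS](bary_comb K i E); congr bary.
by apply: plane_eq; rewrite !planeE; ring.
Qed.

Lemma bary_vertex K i j : bary K i (W K j) = (i == j)%:R.
Proof.
case: (ord3P i j); first by rewrite eqxx bary_self.
  by rewrite -[W K _]/(eS K i) bary_eS ord3_n01.
by rewrite -[W K _]/(eN K i) bary_eN ord3_n02.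
Qed.

Lemma W_inj K : injective (W K).
Proof.
move=> i j ij; apply/eqP; have := bary_vertex K i j; rewrite -ij bary_self.
by case: (i == j) => // /eqP; rewrite oner_eq0.
Qed.

Definition ctri K := hull3 (fun i => pos (vert K i)).

Lemma bary_hull K (l : 'I_3 -> R) i : \sum_j l j = 1 ->
  bary K i (\sum_j l j *: W K j) = l i.
Proof. by rewrite !(sum3 i) => h; rewrite bary_comb. Qed.

Lemma bary_sum3 K x : \sum_i bary K i x = 1.
Proof. by rewrite (sum3 0) bary_sum. Qed.

Lemma bary_recon3 K x : \sum_i bary K i x *: W K i = x.
Proof. by rewrite (sum3 0) bary_recon. Qed.

Lemma ctriP K x : ctri K x <-> forall i, 0 <= bary K i x.
Proof.
split=> [[l [l0 l1 ->]] i|h].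
  by rewrite -[\sum_i _]/(\sum_i l i *: W K i) bary_hull.
exists (fun i => bary K i x); split => //; first by rewrite bary_sum3.
by rewrite -[RHS]/(\sum_i bary K i x *: W K i) bary_recon3.
Qed.

Lemma otriP K x : otri K x <-> forall i, 0 < bary K i x.
Proof.
split=> [[l [l0 l1 ->]] i|h]; first by rewrite bary_hull.
by exists (fun i => bary K i x); split => //; [rewrite bary_sum3|rewrite bary_recon3].
Qed.

Lemma otriE K i : otri K = otr (W K i) (eS K i - W K i) (eN K i - W K i).
Proof.
apply/seteqP; split=> x.
  move=> /otriP h; split; rewrite -?bary_cs -?bary_ct; have := bary_sum K i x;
  have := h i; have := h (i + 1); have := h (i + 2%:R); lra.
case; rewrite -?bary_cs -?bary_ct => h1 h2 h3; apply/otriP; apply: (all3 (i := i)) => //.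
by have := bary_sum K i x; lra.
Qed.

Lemma segmentP K i x : segment (eS K i) (eN K i) x <->
  [/\ 0 <= bary K (i + 1) x, 0 <= bary K (i + 2%:R) x & bary K i x = 0].
Proof.
split=> [[s /andP[s0 s1] ->]|[h1 h2 h0]].
  have -> : s *: eS K i + (1 - s) *: eN K i =
     0 *: W K i + s *: eS K i + (1 - s) *: eN K i by rewrite scale0r add0r.
  by rewrite bary_comb1 ?bary_comb2 ?bary_comb; try lra; split => //; lra.
have := bary_sum K i x; rewrite h0 add0r => h.
exists (bary K (i + 1) x); first by apply/andP; split => //; lra.
rewrite -{1}(bary_recon K i x) h0 scale0r add0r; congr (_ + _ *: _); lra.
Qed.

(** In every case of conformity the intersection is empty or lies where some barycentric coordinate
    of [K] vanishes. *)
Lemma otri_ctri_disjoint K L x : K != L -> otri K x -> ~ ctri L x.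
Proof.
move=> KL /otriP ox cL.
have cK : ctri K x by apply/ctriP => i; exact: ltW.
have xKL : (ctri K `&` ctri L) x by split.
case: (mesh_conformal KL); rewrite -/(ctri K) -/(ctri L).
- by move=> E; move: xKL; rewrite E.
- case=> i [j [_ E]]; move: xKL; rewrite E => /= xE.
  have := ox (i + 1); rewrite xE -[pos _]/(W K i) bary_vertex.
  by rewrite eq_sym ord3_n01 ltxx.
- case=> i [j [_ E]]; move: xKL; rewrite E => /(segmentP K i x)[_ _ h].
  by have := ox i; rewrite h ltxx.
Qed.

Lemma otri_disjoint K L x : K != L -> otri K x -> ~ otri L x.
Proof.
move=> KL oK /otriP oL; apply: (otri_ctri_disjoint KL oK).
by apply/ctriP => i; exact: ltW.
Qed.

Lemma vert_neq K i j : i != j -> vert K i != vert K j.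
Proof. by apply: contra_neq => h; apply: (@W_inj K); rewrite /W h. Qed.

Lemma edge_inj K : injective (edge K).
Proof.
move=> i j E; apply/eqP/negPn/negP => ij.
have : vert K i \in edge K j.
  rewrite /edge; case: (ord3P j i) ij => [|_|_]; rewrite ?eqxx// !inE eqxx ?orbT//.
rewrite -E /edge !inE (negPf (@vert_neq K i (i + 1) (negbT (ord3_n01 i)))).
by rewrite (negPf (@vert_neq K i (i + 2%:R) (negbT (ord3_n02 i)))).
Qed.

Lemma edge_eqP K i L j : edge K i = edge L j ->
  (eS L j = eS K i /\ eN L j = eN K i) \/ (eS L j = eN K i /\ eN L j = eS K i).
Proof.
move=> /set2_inj; rewrite vert_neq ?ord3_n12// => /(_ isT) [[h1 h2]|[h1 h2]].
  by left; rewrite /eS /eN /W h1 h2.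
by right; rewrite /eS /eN /W h1 h2.
Qed.

(** The size of a move off the midpoint of an edge, where two coordinates are 1/2, towards a point
    with arbitrary coordinates [p] and [q]: both must stay nonnegative. *)
Lemma small_step (p q : R) : exists t : R, [/\ 0 < t, 0 < (1 - t) * 2^-1,
  0 <= (1 - t) * 2^-1 + t * p & 0 <= (1 - t) * 2^-1 + t * q].
Proof.
pose B := `|p| + `|q| + 1.
have B1 : 1 <= B by rewrite /B lerDr addr_ge0.
have b1 : `|p| <= B by rewrite /B -addrA lerDl addr_ge0.
have b2 : `|q| <= B by rewrite /B addrAC lerDr addr_ge0.
pose t := (4 * B)^-1; exists t.
have t0 : 0 < t by rewrite invr_gt0; lra.
have tB : t * B = 4^-1 by rewrite /t; field; lra.
have t1 : t <= 4^-1 by nra.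
move: b1 b2; rewrite !ler_norml => /andP[c1 c2] /andP[c3 c4].
by split; nra.
Qed.

Lemma bary_mid K i : let m := 2^-1 *: eS K i + 2^-1 *: eN K i in
  [/\ bary K i m = 0, bary K (i + 1) m = 2^-1 & bary K (i + 2%:R) m = 2^-1].
Proof.
move=> m; have h : 0 + 2^-1 + 2^-1 = 1 :> R by lra.
have -> : m = 0 *: W K i + 2^-1 *: eS K i + 2^-1 *: eN K i by rewrite scale0r add0r.
by rewrite bary_comb ?bary_comb1 ?bary_comb2.
Qed.

(* Otherwise a point slightly above the midpoint of the edge would lie both in
   the interior of [K] and in [L]. *)
Lemma shared_edge_side K i L j : K != L -> edge K i = edge L j ->
  bary L j (W K i) < 0.
Proof.
move=> KL E; rewrite ltNge; apply/negP => h.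
have [mK0 mK1 mK2] := bary_mid K i; have [mL0 mL1 mL2] := bary_mid L j.
set m := _ + _ in mK0 mK1 mK2; have mE : 2^-1 *: eS L j + 2^-1 *: eN L j = m.
  by rewrite /m; case: (edge_eqP E) => -[-> ->] //; rewrite addrC.
rewrite mE in mL0 mL1 mL2.
have [t [t0 t1 t2 t3]] := small_step (bary L (j + 1) (W K i)) (bary L (j + 2%:R) (W K i)).
apply: (@otri_ctri_disjoint K L (m + t *: (W K i - m)) KL).
  apply/otriP; apply: (all3 (i := i)); rewrite bary_affine ?mK0 ?mK1 ?mK2 bary_vertex.
  - by rewrite eqxx mulr0 add0r mulr1.
  - by rewrite eq_sym ord3_n01 mulr0 addr0.
  - by rewrite eq_sym ord3_n02 mulr0 addr0.
apply/ctriP; apply: (all3 (i := j)); rewrite bary_affine ?mL0 ?mL1 ?mL2//.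
by rewrite mulr0 add0r mulr_ge0// ltW.
Qed.

(** The negative coordinate in [shared_edge_side] is [sarea2 K / sarea2 L] up to a sign given by the
    directions of the edge. Hence equally oriented neighbours run through it in opposite
    directions. *)
Lemma shared_edge_area K i L j : K != L -> edge K i = edge L j ->
  (eS L j = eS K i /\ eN L j = eN K i /\ sarea2 K * sarea2 L < 0) \/
  (eS L j = eN K i /\ eN L j = eS K i /\ 0 < sarea2 K * sarea2 L).
Proof.
move=> KL E; have := shared_edge_side KL E; rewrite /bary => h.
have L0 := sarea2_neq0 L.
have L2 : 0 < sarea2 L ^+ 2 by rewrite lt_neqAle sqr_ge0 andbT eq_sym sqrf_eq0.
have EE (c : R) : c / sarea2 L * sarea2 L ^+ 2 = c * sarea2 L by field.
have := h; rewrite -(pmulr_llt0 _ L2) EE.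
case: (edge_eqP E) => -[-> ->].
  by rewrite sarea2E => ?; left.
have -> : cross (eN K i - W K i) (eS K i - W K i) = - sarea2 K.
  by rewrite -(sarea2E K i) /cross; ring.
by rewrite mulNr oppr_lt0 => ?; right.
Qed.

Definition rotcw x : R * R := (x.2, - x.1).

Lemma enormN x : enorm (- x) = enorm x.
Proof. by rewrite /enorm /dot !planeE; congr Num.sqrt; ring. Qed.

Lemma enorm_eq0 x : (enorm x == 0) = (x == 0).
Proof.
apply/eqP/eqP => [/eqP|->]; last by rewrite /enorm /dot /= mulr0 addr0 sqrtr0.
rewrite /enorm sqrtr_eq0 /dot => h.
have h1 := sqr_ge0 x.1; have h2 := sqr_ge0 x.2.
have : x.1 ^+ 2 = 0 by nra.
have : x.2 ^+ 2 = 0 by nra.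
by move=> /eqP; rewrite sqrf_eq0 => /eqP e2 /eqP; rewrite sqrf_eq0 => /eqP e1; exact: plane_eq.
Qed.

Lemma enorm_ge0 x : 0 <= enorm x. Proof. exact: sqrtr_ge0. Qed.

Lemma dot_ge0 x : 0 <= dot x x. Proof. by rewrite /dot; nra. Qed.

Lemma sqr_enorm x : enorm x ^+ 2 = dot x x.
Proof. by rewrite sqr_sqrtr// dot_ge0. Qed.

Lemma enormZ (k : R) x : enorm (k *: x) = `|k| * enorm x.
Proof.
rewrite /enorm (_ : dot (k *: x) _ = k ^+ 2 * dot x x); last by rewrite /dot !planeE; ring.
by rewrite sqrtrM ?sqr_ge0// sqrtr_sqr.
Qed.

Lemma enorm_rotcw x : enorm (rotcw x) = enorm x.
Proof. by rewrite /enorm /dot /=; congr Num.sqrt; ring. Qed.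

Lemma elen_gt0 K i : 0 < elen K i.
Proof.
rewrite lt_neqAle enorm_ge0 andbT eq_sym enorm_eq0 subr_eq0; apply/eqP => /(@W_inj K)/eqP.
by rewrite ord3_n12.
Qed.

Lemma outnormalE K i : outnormal K i =
  (- Num.sg (sarea2 K) / elen K i) *: rotcw (eS K i - eN K i).
Proof.
rewrite /outnormal -/(rotcw _) -/(elen K i); congr (- _ / _ *: _).
rewrite -(sarea2E K i) /dot /cross /= ?planeE; congr Num.sg; ring.
Qed.

Lemma sg_sarea2_sq K : Num.sg (sarea2 K) * Num.sg (sarea2 K) = 1.
Proof. by rewrite -expr2 sqr_sg sarea2_neq0. Qed.

Lemma enorm_outnormal K i : enorm (outnormal K i) = 1.
Proof.
rewrite outnormalE enormZ enorm_rotcw normrM normrN normr_sg sarea2_neq0 mul1r.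
have l0 := elen_gt0 K i.
by rewrite ger0_norm ?invr_ge0 ?ltW// -/(elen K i) mulVf ?gt_eqF.
Qed.

Lemma dot_outnormal K i : dot (outnormal K i) (outnormal K i) = 1.
Proof. by rewrite -sqr_enorm enorm_outnormal expr1n. Qed.

Lemma elen_eq K i L j : edge K i = edge L j -> elen L j = elen K i.
Proof.
by move=> /edge_eqP[[h1 h2]|[h1 h2]]; rewrite /elen h1 h2// -opprB enormN.
Qed.

(** In [outnormalE] exactly one of two factors changes sign from [K] to [L], by [shared_edge_area]:
    the sign of the area or the rotated edge vector. *)
Lemma outnormal_opp K i L j : K != L -> edge K i = edge L j ->
  outnormal L j = - outnormal K i.
Proof.
move=> KL E; rewrite !outnormalE (elen_eq E).
have := sg_sarea2_sq K; have := sg_sarea2_sq L.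
case: (shared_edge_area KL E) => -[-> [-> s]].
  have : Num.sg (sarea2 K) * Num.sg (sarea2 L) = -1 by rewrite -sgrM ltr0_sg.
  move=> h1 h2 h3; have -> : Num.sg (sarea2 L) = - Num.sg (sarea2 K) by nra.
  by rewrite !mulNr !scaleNr.
have : Num.sg (sarea2 K) * Num.sg (sarea2 L) = 1 by rewrite -sgrM gtr0_sg.
move=> h1 h2 h3; have -> : Num.sg (sarea2 L) = Num.sg (sarea2 K) by nra.
by rewrite -scalerN; congr (_ *: _); apply: plane_eq; rewrite /rotcw /=; ring.
Qed.

End Geometry.

(** * Triangles around an edge and the fixed normals *)

Section Orientation.
Variables (R : realType) (Omega : set (R * R)).
Hypothesis Omega_open : open Omega.
Hypothesis Omega_convex : convex_set Omega.
Variable M : mesh Omega.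
Implicit Types (K L : tri M) (i j : 'I_3) (a b : {set vtx M}) (x : R * R).

Lemma convex_comb x y (t : R) : 0 <= t <= 1 -> Omega x -> Omega y ->
  Omega (t *: x + (1 - t) *: y).
Proof.
move=> /andP[t0 t1] ox oy.
have := @Omega_convex x y (Itv01 t0 t1); rewrite !inE => /(_ ox oy).
by [].
Qed.

Lemma ctri_closure K x : ctri K x -> closure Omega x.
Proof. by move=> Kx; rewrite (mesh_cover M); exists K. Qed.

Lemma open_otri K : open (otri K).
Proof. by rewrite (otriE K 0); apply: open_otr; exact: edge_cross_neq0. Qed.

Lemma continuous_ray x y : continuous (fun t : R => x + t *: y).
Proof.
move=> t; apply: cvgD; first exact: cvg_cst.
by apply: cvgZ; [exact: cvg_id|exact: cvg_cst].
Qed.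

Lemma otri_ctri K : otri K `<=` ctri K.
Proof. by move=> x /otriP h; apply/ctriP => i; exact: ltW. Qed.

Lemma near_ray (U : set (R * R)) x y : open U -> U x ->
  \forall t \near (0 : R)^'+, U (x + t *: y).
Proof.
move=> oU Ux; apply: cvg_within.
have : nbhs (0 : R) ((fun t : R => x + t *: y) @^-1` U).
  by apply: continuous_ray; rewrite scale0r addr0; exact: open_nbhs_nbhs.
exact.
Qed.

(* An open convex set contains the interior of its closure. *)
Lemma otri_sub K : otri K `<=` Omega.
Proof.
move=> x Kx; have cx := ctri_closure (otri_ctri Kx).
have [y [oy _]] := cx setT filterT.
have [t [t0 Kz]] : exists t : R, 0 < t /\ otri K (x + t *: (x - y)).
  have := near_ray (x - y) (open_otri (K := K)) Kx.
  move=> H; have : \forall t \near (0 : R)^'+, 0 < t /\ otri K (x + t *: (x - y)).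
    by near=> t; split; near: t => //; exact: nbhs_right_gt.
  by move/filter_ex.
set z := x + _ in Kz; have cz := ctri_closure (otri_ctri Kz).
(* [h z'] is the point for which [x] divides the segment from [z'] to [h z'] as it divides the one
   from [z] to [y]. Since [h z] is [y], a point [z'] of [Omega] close to [z] has [h z'] in [Omega],
   and convexity gives [x]. *)
pose h (z' : R * R) := t^-1 *: ((1 + t) *: x - z').
have ch : continuous h.
  move=> u; apply: cvgZr; apply: cvgB; [exact: cvg_cst|exact: cvg_id].
have hz : h z = y.
  by rewrite /h /z; apply: plane_eq; rewrite !planeE; field; lra.
have : nbhs z (h @^-1` Omega).
  by apply: ch; rewrite hz; exact: open_nbhs_nbhs.
move=> /cz [z' [oz' ohz']].
have -> : x = (1 + t)^-1 *: z' + (1 - (1 + t)^-1) *: h z'.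
  by rewrite /h; apply: plane_eq; rewrite !planeE; field; rewrite !gt_eqF//; lra.
apply: convex_comb => //; apply/andP; split.
  by rewrite invr_ge0; lra.
by rewrite invf_le1; lra.
Unshelve. all: by end_near.
Qed.

Lemma edge_segP K i x : edge_seg (edge K i) x <-> segment (eS K i) (eN K i) x.
Proof.
split=> [[v [w [va wa [s /andP[s0 s1] ->]]]]|sx]; last first.
  by exists (vert K (i + 1)), (vert K (i + 2%:R)); rewrite /edge !inE !eqxx orbT.
have S : segment (eS K i) (eN K i) (s *: eS K i + (1 - s) *: eN K i).
  by exists s => //; apply/andP.
move: va wa; rewrite !inE => /orP[]/eqP -> /orP[]/eqP ->.
- rewrite -scalerDl (_ : s + (1 - s) = 1) ?scale1r; last by ring.
  by exists 1; rewrite ?ler01 ?lexx// subrr scale0r addr0 scale1r.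
- exact: S.
- exists (1 - s); first by apply/andP; split; lra.
  by rewrite addrC (_ : 1 - (1 - s) = s) //; ring.
- rewrite -scalerDl (_ : s + (1 - s) = 1) ?scale1r; last by ring.
  by exists 0; rewrite ?ler01 ?lexx// subr0 scale0r add0r scale1r.
Qed.

Lemma edge_ctri K i : segment (eS K i) (eN K i) `<=` ctri K.
Proof.
by move=> x /(segmentP K i x)[h1 h2 h0]; apply/ctriP; apply: (all3 (i := i)); rewrite ?h0.
Qed.

(** A point of the edge off the boundary may be an end point; a small move towards the midpoint
    makes it relatively interior while it stays in the open set [Omega]. *)
Lemma interior_edge_point K i : ~ edge_seg (edge K i) `<=` bdry Omega ->
  exists x, [/\ Omega x, bary K i x = 0, 0 < bary K (i + 1) x & 0 < bary K (i + 2%:R) x].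
Proof.
move=> /existsNP[x0 /not_implyP[/edge_segP sx0 nb]].
have c0 := ctri_closure (edge_ctri sx0).
have o0 : Omega x0.
  by apply: contrapT => no; apply: nb; split => // io; apply: no; exact: interior_subset io.
have [s1 s2 s0] := (segmentP K i x0).1 sx0.
have [m0 m1 m2] := bary_mid K i; set m := _ + _ in m0 m1 m2.
have : \forall t \near (0 : R)^'+, [/\ 0 < t, t < 1 & Omega (x0 + t *: (m - x0))].
  have H := near_ray (m - x0) Omega_open o0.
  near=> t; split; near: t => //; first exact: nbhs_right_gt.
  exact: nbhs_right_lt.
move=> /filter_ex [t [t0 t1 ot]].
exists (x0 + t *: (m - x0)); rewrite !bary_affine m0 m1 m2 s0 !mulr0 addr0.
have t1' : 0 <= 1 - t by lra.
have p (b : R) : 0 <= b -> 0 < (1 - t) * b + t * 2^-1.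
  by move=> b0; have := mulr_ge0 t1' b0; lra.
by split => //; exact: p.
Unshelve. all: by end_near.
Qed.

(* Points just across the edge lie in finitely many closed triangles other than
   [K], so one of these contains the point of the edge. *)
Lemma interior_edge_neighbor K i : ~ edge_seg (edge K i) `<=` bdry Omega ->
  exists L j, K != L /\ edge K i = edge L j.
Proof.
move=> /interior_edge_point[x [ox x0 x1 x2]].
have xK : ctri K x by apply/ctriP; apply: (all3 (i := i)); rewrite ?x0// ltW.
have [L [KL Lx]] : exists L, K != L /\ ctri L x.
  apply: contrapT => noL.
  have far L : \forall t \near (0 : R)^'+, ~ ctri L (x + t *: (x - W K i)).
    have [<-|KL] := eqVneq K L.
      near=> t; move/ctriP => /(_ i).
      have -> : x - W K i = - (W K i - x) by rewrite opprB.
      rewrite scalerN -scaleNr bary_affine x0 bary_self mulr0 add0r mulr1.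
      by apply/negP; rewrite -ltNge oppr_lt0; near: t; exact: nbhs_right_gt.
    have : exists j, bary L j x < 0.
      apply: contrapT => noj; apply: noL; exists L; split => //; apply/ctriP => j.
      by rewrite leNgt; apply/negP => h; apply: noj; exists j.
    move=> [j Lj].
    have oU : open [set y | bary L j y < 0].
      have -> : [set y | bary L j y < 0] = bary L j @^-1` [set r | r < 0] by [].
      have c : continuous (bary L j).
        have [G [cG _ _ _]] := has_grad_cr (W L j) (edge_cross_neq0 L j).
        rewrite (_ : bary L j = fun x => 1 -
          cs (W L j) (eS L j - W L j) (eN L j - W L j) x -
          ct (W L j) (eS L j - W L j) (eN L j - W L j) x)//.
        apply/funext => y; rewrite -bary_cs -bary_ct.
        by have <- := bary_sum L j y; ring.
      by move/continuousP : c; apply; exact: open_lt.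
    have := near_ray (x - W K i) oU Lj; apply: filterS => t h /ctriP/(_ j).
    by rewrite leNgt h.
  have /filter_forall farL := far.
  have H := near_ray (x - W K i) Omega_open ox.
  have : \forall t \near (0 : R)^'+, False.
    move: farL H; apply: filterS2 => t hL ho.
    have : closure Omega (x + t *: (x - W K i)) by exact: subset_closure.
    by rewrite (mesh_cover M) => -[L _ Lx]; exact: (hL L).
  by move/filter_ex => [].
exists L; have xKL : (ctri K `&` ctri L) x by split.
(* Two coordinates of [x] in [K] are positive, so [x] is no vertex, and the only edge of [K] that
   contains it is edge [i]. *)
case: (mesh_conformal KL); rewrite -/(ctri K) -/(ctri L).
- by move=> E; move: xKL; rewrite E.
- case=> i' [j [_ E]]; move: xKL; rewrite E => /= xE; exfalso.
  move: x0 x1 x2; rewrite xE -[pos _]/(W K i') !bary_vertex.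
  case: (ord3P i i'); first by move=> /eqP; rewrite eqxx oner_eq0.
    by rewrite [_ + 2%:R == _]eq_sym ord3_n12 ltxx.
  by rewrite ord3_n12 ltxx.
- case=> i' [j [E1 E]]; move: xKL; rewrite E => /(segmentP K i' x)[_ _ h].
  exists j; split => //; rewrite -[RHS]E1 -/(edge K i').
  case: (ord3P i i') h => // h; first by move: x1; rewrite h ltxx.
  by move: x2; rewrite h ltxx.
Unshelve. all: by end_near.
Qed.

Variable n : {set vtx M} -> R * R.
Hypothesis n_normal : edge_normals n.

Lemma edge_edges K i : edge K i \in edges M.
Proof. by apply/imsetP; exists (K, i). Qed.

Lemma edgesP a : a \in edges M -> exists K i, a = edge K i.
Proof. by move=> /imsetP[[K i] _ ->]; exists K, i. Qed.

(** Incidence number of the edge and the triangle: 1 if the fixed normal leaves [K], -1 if it enters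
    [K]. *)
Definition esgn K i : R := dot (n (edge K i)) (outnormal K i).

Lemma dot_outnormal_edge K i : dot (outnormal K i) (eS K i - eN K i) = 0.
Proof. by rewrite outnormalE dotZl /dot /rotcw /=; ring. Qed.

(** Orthogonality to a common nonzero vector makes [cross u v] vanish, and Lagrange's identity
    leaves [dot u v ^+ 2 = 1]. *)
Lemma unit_orth_dir (u v t : R * R) : dot u u = 1 -> dot v v = 1 -> dot u t = 0 ->
  dot v t = 0 -> t != 0 -> dot u v ^+ 2 = 1 /\ u = dot u v *: v.
Proof.
move=> uu vv ut vt t0.
have c0 : cross u v = 0.
  have h1 : cross u v * t.1 = 0.
    have -> : cross u v * t.1 = v.2 * dot u t - u.2 * dot v t by rewrite /cross /dot; ring.
    by rewrite ut vt !mulr0 subrr.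
  have h2 : cross u v * t.2 = 0.
    have -> : cross u v * t.2 = u.1 * dot v t - v.1 * dot u t by rewrite /cross /dot; ring.
    by rewrite ut vt !mulr0 subrr.
  apply/eqP; move: h1 h2 => /eqP; rewrite mulf_eq0 => /orP[//|/eqP t1] /eqP.
  rewrite mulf_eq0 => /orP[//|/eqP t2]; exfalso; move/eqP : t0; apply.
  exact: plane_eq.
have s1 : dot u v ^+ 2 = 1.
  have : cross u v ^+ 2 + dot u v ^+ 2 = dot u u * dot v v by rewrite /cross /dot; ring.
  by rewrite c0 uu vv expr0n/= add0r mulr1.
split=> //; apply/eqP; rewrite -subr_eq0 -enorm_eq0 /enorm.
have -> : dot (u - dot u v *: v) (u - dot u v *: v) = dot u u - dot u v ^+ 2 * (2 - dot v v).
  by rewrite {1 4 5}/dot !planeE /dot; ring.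
by rewrite uu vv s1 mul1r (_ : 1 - (2 - 1) = 0) ?sqrtr0//; ring.
Qed.

Lemma normal_dir K i : esgn K i ^+ 2 = 1 /\ n (edge K i) = esgn K i *: outnormal K i.
Proof.
have [h1 h2] := n_normal.1 _ _ _ (edge_edges K i) (set21 _ _) (set22 _ _).
apply: (unit_orth_dir (t := eS K i - eN K i)) => //.
- by rewrite -sqr_enorm h1 expr1n.
- exact: dot_outnormal.
- exact: dot_outnormal_edge.
- by have := elen_gt0 K i; rewrite /elen lt_neqAle eq_sym enorm_eq0 => /andP[].
Qed.

Lemma esgn_sq K i : esgn K i * esgn K i = 1.
Proof. by rewrite -expr2; case: (normal_dir K i). Qed.

Lemma esgn_opp K i L j : K != L -> edge K i = edge L j -> esgn L j = - esgn K i.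
Proof. by move=> KL E; rewrite /esgn -E (outnormal_opp KL E) dotNr. Qed.

(** Among three triangles at one edge any two would have opposite incidence numbers, which three
    signs cannot achieve. *)
Lemma edge_two K i L j N k : K != L -> edge K i = edge L j -> edge N k = edge K i ->
  N = K \/ N = L.
Proof.
move=> KL E1 E2; have [->|NK] := eqVneq N K; first by left.
have [->|NL] := eqVneq N L; first by right.
exfalso; rewrite eq_sym in NK; rewrite eq_sym in NL.
have h1 := esgn_opp KL E1; have h2 := esgn_opp NK (esym E2).
have h3 := esgn_opp NL (etrans (esym E1) (esym E2)).
have : esgn N k * esgn N k = - 1.
  by rewrite {1}h2 h3 h1 opprK mulNr esgn_sq.
rewrite esgn_sq => /eqP; rewrite -subr_eq0 opprK; apply/negP.
by rewrite -(natrD _ 1 1) pnatr_eq0.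
Qed.

Lemma dc1_esgn a K i : dc1 n a K i -> esgn K i = 1.
Proof. by case=> _ -> nE; rewrite /esgn nE dot_outnormal. Qed.

Lemma dc2_esgn a K i L j : dc2 n a K i L j -> esgn K i = 1 /\ esgn L j = -1.
Proof.
case=> _ KL E1 E2 nE; have E : edge K i = edge L j by rewrite -E1.
have h : esgn K i = 1 by rewrite /esgn -E1 nE dot_outnormal.
by split => //; rewrite (esgn_opp KL E) h.
Qed.

Lemma edge_cases a : a \in edges M ->
  (exists K i, dc1 n a K i) \/ (exists K i L j, dc2 n a K i L j).
Proof.
move=> ae; have [K [i aE]] := edgesP ae.
have [b|nb] := pselect (edge_seg a `<=` bdry Omega).
  left; exists K, i; split => //; rewrite aE; apply: n_normal.2.
  by rewrite -aE; split.
right; have := nb; rewrite {1}aE => /interior_edge_neighbor[L [j [KL E]]].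
have [s nE] := normal_dir K i.
(* The incidence number decides which of the two triangles comes first in the oriented
   coboundary. *)
have /orP[/eqP s1|/eqP s1] : (esgn K i == 1) || (esgn K i == -1) by rewrite -sqrf_eq1 s.
  exists K, i, L, j; split; [exact: (conj ae nb)|by []|by []|by rewrite aE|].
  by rewrite aE nE s1 scale1r.
exists L, j, K, i; split; [exact: (conj ae nb)|by rewrite eq_sym|by rewrite aE|by []|].
by rewrite aE nE s1 scaleN1r (outnormal_opp KL E).
Qed.

(* The oriented coboundary of [a] as a signed sum over all pairs representing
   [a]; it treats [dc1] and [dc2] uniformly. *)
Definition edge_sum (V : lmodType R) (a : {set vtx M}) (F : tri M -> 'I_3 -> V) : V :=
  \sum_(p : tri M * 'I_3 | edge p.1 p.2 == a) esgn p.1 p.2 *: F p.1 p.2.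

Lemma dc1_sum (V : lmodType R) a K i (F : tri M -> 'I_3 -> V) : dc1 n a K i ->
  edge_sum a F = F K i.
Proof.
move=> H; have [[ae ab] aE nE] := H.
rewrite /edge_sum (bigD1 (K, i)) /=; last by rewrite aE.
rewrite big1 ?addr0 ?(dc1_esgn H) ?scale1r// => -[L j] /= /andP[/eqP E ne].
exfalso; have [KL|KL] := eqVneq K L.
  move/eqP : ne; apply; rewrite KL; congr pair.
  by apply: (@edge_inj _ _ _ L); rewrite E aE KL.
(* On a boundary edge [n] is the outward normal of every adjacent triangle, whereas two neighbours
   have opposite outward normals; so there is only one. *)
have bL : n (edge L j) = outnormal L j by apply: n_normal.2; rewrite E.
have := dot_outnormal L j; rewrite -{1}bL E nE.
have -> : outnormal L j = - outnormal K i by apply: outnormal_opp KL _; rewrite E.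
rewrite dotNr dot_outnormal => /eqP; rewrite eq_sym -subr_eq0 opprK -(natrD _ 1 1).
by rewrite pnatr_eq0.
Qed.

Lemma dc2_sum (V : lmodType R) a K i L j (F : tri M -> 'I_3 -> V) : dc2 n a K i L j ->
  edge_sum a F = F K i - F L j.
Proof.
move=> H; have [ia KL aK aL nE] := H; have [sK sL] := dc2_esgn H.
have E : edge K i = edge L j by rewrite -aK.
rewrite /edge_sum (bigD1 (K, i)) /=; last by rewrite aK.
rewrite (bigD1 (L, j)) /=; last first.
  by rewrite -aL eqxx /=; apply/eqP => -[e _]; move: KL; rewrite e eqxx.
rewrite sK sL scale1r scaleN1r big1 ?addr0// => -[N k] /= /andP[/andP[/eqP e1 n1] n2].
exfalso; have e1' : edge N k = edge K i by rewrite e1.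
case: (edge_two KL E e1') => NE.
  move/eqP : n1; apply; rewrite NE; congr pair.
  by apply: (@edge_inj _ _ _ K); rewrite -e1' NE.
move/eqP : n2; apply; rewrite NE; congr pair.
by apply: (@edge_inj _ _ _ L); rewrite -E -e1' NE.
Qed.

Lemma assembledE (loc : tri M -> 'I_3 -> R * R -> R * R) phi a x :
  assembled n loc phi -> a \in edges M -> phi a x = edge_sum a (fun K i => loc K i x).
Proof.
move=> [h2 h1] /edge_cases[[K [i H]]|[K [i [L [j H]]]]].
  by rewrite (dc1_sum _ H) (h1 _ _ _ H).
by rewrite (dc2_sum _ H) (h2 _ _ _ _ _ H).
Qed.

End Orientation.

(** * Local integrals *)

Section Local.
Variables (R : realType) (Omega : set (R * R)) (M : mesh Omega).
Local Notation mR := (measurableTypeR R).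
Local Notation mP := (measurableTypeR R * measurableTypeR R)%type.
Local Notation leb := (@lebesgue_measure R).
Local Notation mu := (mu2 R).
Implicit Types (K L : tri M) (i j k : 'I_3) (x : R * R) (w : R * R -> R).

Lemma measurable_otri K : measurable (otri K : set mP).
Proof. by rewrite (otriE K 0); apply: measurable_otr; exact: edge_cross_neq0. Qed.

Lemma otri_box K : exists m, otri K `<=` box m.
Proof. by rewrite (otriE K 0); eexists; apply: otr_box; exact: edge_cross_neq0. Qed.

Lemma areaE K : area K = `|sarea2 K| / 2.
Proof.
by rewrite /area (otriE K 0) (area_otr _ (edge_cross_neq0 K 0)) sarea2E.
Qed.

Lemma area_gt0 K : 0 < area K.
Proof. by rewrite areaE divr_gt0// normr_gt0 sarea2_neq0. Qed.

Lemma edge_paramE K i (s : R) :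
  edge_param K i s = W K i + s *: (eS K i - W K i) + (1 - s) *: (eN K i - W K i).
Proof. by rewrite /edge_param; apply: plane_eq; rewrite !planeE; ring. Qed.

Lemma continuous_edge_param K i : continuous (edge_param K i).
Proof.
have -> : edge_param K i = fun s => (eN K i) + s *: (eS K i - eN K i).
  by apply/funext => s; rewrite /edge_param; apply: plane_eq; rewrite !planeE; ring.
exact: continuous_ray.
Qed.

Lemma continuous_dot_grad (G : R * R -> R * R) w : C1 w ->
  continuous (fun x => (G x).1) -> continuous (fun x => (G x).2) ->
  continuous (fun x => dot (G x) (grad w x)).
Proof.
move=> /C1_has_grad [_ g1 g2 _] c1 c2 x; apply: cvgD; apply: cvgM;
  [exact: c1|exact: g1|exact: c2|exact: g2].
Qed.

Lemma continuous_subr1 (P : R * R) : continuous (fun x : R * R => (x - P).1).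
Proof.
rewrite (_ : (fun x => _) = fun x => 1 * x.1 + 0 * x.2 + - P.1).
  exact: continuous_affine_form.
by apply/funext => x; rewrite !planeE; ring.
Qed.

Lemma continuous_subr2 (P : R * R) : continuous (fun x : R * R => (x - P).2).
Proof.
rewrite (_ : (fun x => _) = fun x => 0 * x.1 + 1 * x.2 + - P.2).
  exact: continuous_affine_form.
by apply/funext => x; rewrite !planeE; ring.
Qed.

Lemma rt_local_in K i x : otri K x -> rt_local K i x = (2 * area K)^-1 *: (x - W K i).
Proof. by move=> Kx; rewrite /rt_local indicE mem_set// scale1r. Qed.

Lemma rt_local_out K i x : ~ otri K x -> rt_local K i x = 0.
Proof. by move=> Kx; rewrite /rt_local indicE memNset// scale0r. Qed.

(** The same shape as [psi_green], with edge density 1 and divergence [1 / area K]; this common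
    shape is what the assembly relies on. *)
Lemma rt_local_trace K i w : C1 w ->
  \int[mu]_(x in otri K) (dot (rt_local K i x) (grad w x) + w x * (\1_(otri K) x / area K)) =
  \int[leb]_(s in `]0%R, 1%R[) (w (edge_param K i s) * 1).
Proof.
move=> C1w; have a0 := area_gt0 K; have mK := measurable_otri K; have [m Km] := otri_box K.
transitivity (\int[mu]_(x in otri K)
    ((2 * area K)^-1 * (dot (x - W K i) (grad w x) + 2 * w x))).
  apply: eq_Rintegral => x; rewrite inE => Kx; rewrite rt_local_in// dotZl.
  rewrite indicE mem_set//=; field; lra.
rewrite RintegralZl//; last first.
  apply: (@continuous_integrable R m) => // x; apply: cvgD.
    by apply: (@continuous_dot_grad (fun y => y - W K i) w C1w);
      [exact: continuous_subr1|exact: continuous_subr2].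
  by apply: cvgM; [exact: cvg_cst|exact: C1_continuous].
rewrite (otriE K i) (green_tri (W K i) (edge_cross_neq0 K i) C1w).
rewrite sarea2E areaE mulrA [2 * _]mulrC divfK ?mulVf ?mul1r ?normr_eq0 ?sarea2_neq0//.
by apply: eq_Rintegral => s _; rewrite mulr1 edge_paramE.
Qed.

Lemma L2v_rt_local K i : L2v (otri K) (rt_local K i).
Proof.
have mK := measurable_otri K; have [m Km] := otri_box K.
split.
  apply: (@L2_eq _ _ (fun x => (2 * area K)^-1 * (x - W K i).1)) => //.
    by move=> x Kx; rewrite rt_local_in.
  by apply: L2Z => //; apply: L2_continuous Km => //; exact: continuous_subr1.
apply: (@L2_eq _ _ (fun x => (2 * area K)^-1 * (x - W K i).2)) => //.
  by move=> x Kx; rewrite rt_local_in.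
by apply: L2Z => //; apply: L2_continuous Km => //; exact: continuous_subr2.
Qed.

Lemma L2_cst_otri K (k : R) : L2 (otri K) (fun x => \1_(otri K) x * k).
Proof.
have mK := measurable_otri K; have [m Km] := otri_box K.
apply: (@L2_eq _ _ (fun=> k)) => //; first by move=> x Kx; rewrite indicE mem_set// mul1r.
by apply: L2_continuous Km => //; exact: cst_continuous.
Qed.

Lemma mean_rt_div K : \int[mu]_(x in otri K) (\1_(otri K) x / area K) = 1.
Proof.
have mK := measurable_otri K.
transitivity (\int[mu]_(x in otri K) (area K)^-1).
  by apply: eq_Rintegral => x; rewrite inE => Kx; rewrite indicE mem_set// mul1r.
by rewrite Rintegral_cst// -/(area K) mulVf// gt_eqF// area_gt0.
Qed.

(** [normal_trace] refers to the representative [wdiv]; by [div_unique] any other divergence gives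
    the same integral. The next lemma is the converse passage. *)
Lemma trace_div K psi h d w : normal_trace K psi h -> is_div (otri K) psi d -> C1 w ->
  \int[mu]_(x in otri K) (dot (psi x) (grad w x) + w x * d x) =
  bdry_int K (fun x => w x * h x).
Proof.
move=> [Hd _ Ht] D1 C1w; have D2 := wdivP Hd.
have mK := measurable_otri K; have [m Km] := otri_box K.
have E := div_unique (P := W K 0) (edge_cross_neq0 K 0) mK Km _ D1 D2 C1w.
have [Lp Ld _] := D1; have [_ Ld' _] := D2.
have [i1 i2] := integrable_div mK Km Lp Ld C1w.
have [_ i3] := integrable_div mK Km Lp Ld' C1w.
rewrite -Ht// (RintegralD mK i1 i2) (RintegralD mK i1 i3); congr (_ + _).
by move: E; rewrite -otriE; apply.
Qed.

Lemma ntrace_of_div K psi h d : is_div (otri K) psi d ->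
  (forall i, leb.-integrable `]0%R, 1%R[ (fun s : R => (h (edge_param K i s))%:E)) ->
  (forall w, C1 w -> \int[mu]_(x in otri K) (dot (psi x) (grad w x) + w x * d x) =
     bdry_int K (fun x => w x * h x)) ->
  normal_trace K psi h.
Proof.
move=> D1 ih Ht; have Hd : Hdiv (otri K) psi by exists d.
split=> // w C1w; have D2 := wdivP Hd.
have mK := measurable_otri K; have [m Km] := otri_box K.
have E := div_unique (P := W K 0) (edge_cross_neq0 K 0) mK Km _ D1 D2 C1w.
have [Lp Ld _] := D1; have [_ Ld' _] := D2.
have [i1 i2] := integrable_div mK Km Lp Ld C1w.
have [_ i3] := integrable_div mK Km Lp Ld' C1w.
rewrite -Ht// (RintegralD mK i1 i2) (RintegralD mK i1 i3); congr (_ + _); apply: esym.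
by move: E; rewrite -otriE; apply.
Qed.

Lemma bary_edge_param K i k (s : R) : 0 < s < 1 -> k != i ->
  bary K i (edge_param K k s) != 0.
Proof.
move=> /andP[s0 s1]; case: (ord3P i k) => [|_|_]; first by rewrite eqxx.
  rewrite /edge_param eS_succ eN_succ.
  have -> : s *: eN K i + (1 - s) *: W K i =
    (1 - s) *: W K i + 0 *: eS K i + s *: eN K i by rewrite scale0r addr0 addrC.
  by rewrite bary_comb; lra.
rewrite /edge_param eS_pred eN_pred.
have -> : s *: W K i + (1 - s) *: eS K i =
    s *: W K i + (1 - s) *: eS K i + 0 *: eN K i by rewrite scale0r addr0.
by rewrite bary_comb; lra.
Qed.

(** * Edge densities and the moments of [g] *)

Section EdgeDensity.
Variables (g : R -> R) (gloc : tri M -> 'I_3 -> R * R -> R).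
Hypothesis g_integrable : leb.-integrable `]0%R, 1%R[ (fun s : R => (g s)%:E).
Hypothesis gloc_def : forall K i (s : R), 0 < s < 1 ->
  gloc K i (s *: eS K i + (1 - s) *: eN K i) = g s / elen K i.

(** The normal trace on the whole boundary of [K]: off its own edge [gloc K i] is arbitrary, and the
    indicator replaces it by zero. *)
Definition gtrace K i x : R := gloc K i x * \1_(edge_seg (edge K i)) x.

Lemma gtrace_edge K i k (s : R) : 0 < s < 1 ->
  gtrace K i (edge_param K k s) = (k == i)%:R * (g s / elen K i).
Proof.
move=> s01; rewrite /gtrace; have [->|ki] := eqVneq k i.
  rewrite gloc_def// indicE mem_set ?mulr1 ?mul1r//; apply/edge_segP.
  by exists s => //; case/andP: s01 => *; rewrite !ltW.
rewrite indicE memNset ?mulr0 ?mul0r// => /edge_segP/segmentP[_ _ h].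
by have := bary_edge_param K s01 ki; rewrite h eqxx.
Qed.

Lemma integrable_continuous_mul (h : R -> R) : continuous h ->
  leb.-integrable `]0%R, 1%R[ (fun s : R => (h s * g s)%:E).
Proof.
move=> ch.
have mI : measurable (`]0%R, 1%R[%classic : set mR) by exact: measurable_itv.
have mh : measurable_fun (`]0%R, 1%R[%classic : set mR) (h : mR -> mR).
  exact: measurable_funTS (continuous_measurable_fun ch).
have bh : [bounded h t | t in `]0%R, 1%R[%classic].
  have cnh : {within `[(0:R), 1], continuous (fun t => `|h t|)}.
    by apply: continuous_subspaceT => y; apply: continuous_comp; [exact: ch|exact: norm_continuous].
  have [c _ cP] := EVT_max ler01 cnh.
  exists `|h c|; split; first exact: num_real.
  move=> M' /ltW MM' x /= x01; apply: le_trans MM'; apply: cP.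
  exact: subset_itv_oo_cc x01.
have := integrableMr mI mh bh g_integrable.
by apply: eq_integrable => // x _; rewrite /= EFinM.
Qed.

Lemma edge_int_gtrace K i k w : continuous w ->
  edge_int K k (fun x => w x * gtrace K i x) =
  (k == i)%:R * \int[leb]_(s in `]0%R, 1%R[) (w (edge_param K i s) * g s).
Proof.
move=> cw; rewrite /edge_int; have l0 := elen_gt0 K i.
have mI : measurable (`]0%R, 1%R[%classic : set mR) by exact: measurable_itv.
have [->|ki] := eqVneq k i; last first.
  rewrite mul0r (@eq_Rintegral _ _ _ _ _ (fun=> 0)).
    by rewrite Rintegral_cst// mul0r mulr0.
  move=> s; rewrite inE/= in_itv/= => s01.
  by rewrite gtrace_edge// (negPf ki) mul0r mulr0.
rewrite mul1r -RintegralZl//; last first.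
  apply: (@eq_integrable _ _ _ _ _ mI (fun s => (w (edge_param K i s) / elen K i * g s)%:E)).
    move=> s; rewrite inE/= in_itv/= => s01; rewrite /= gtrace_edge// eqxx mul1r.
    by congr EFin; ring.
  apply: (integrable_continuous_mul (h := fun s => w (edge_param K i s) / elen K i)).
  move=> s; apply: cvgM; last exact: cvg_cst.
  by apply: continuous_comp; [exact: continuous_edge_param|exact: cw].
apply: eq_Rintegral => s; rewrite inE/= in_itv/= => s01.
by rewrite gtrace_edge// eqxx mul1r; field; rewrite gt_eqF.
Qed.

Lemma bdry_int_gtrace K i w : continuous w ->
  bdry_int K (fun x => w x * gtrace K i x) =
  \int[leb]_(s in `]0%R, 1%R[) (w (edge_param K i s) * g s).
Proof.
move=> cw; rewrite /bdry_int (bigD1 i)//= edge_int_gtrace// eqxx mul1r big1 ?addr0//.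
by move=> k ki; rewrite edge_int_gtrace// (negPf ki) mul0r.
Qed.

Lemma integrable_gtrace K i k :
  leb.-integrable `]0%R, 1%R[ (fun s : R => (gtrace K i (edge_param K k s))%:E).
Proof.
have mI : measurable (`]0%R, 1%R[%classic : set mR) by exact: measurable_itv.
apply: (@eq_integrable _ _ _ _ _ mI (fun s => ((k == i)%:R / elen K i * g s)%:E)).
  move=> s; rewrite inE/= in_itv/= => s01; rewrite /= gtrace_edge//.
  by congr EFin; ring.
apply: (integrable_continuous_mul (h := fun s => (k == i)%:R / elen K i)).
exact: cst_continuous.
Qed.

Hypothesis g_mean : \int[leb]_(s in `]0%R, 1%R[) g s = 1.
Hypothesis g_moment : \int[leb]_(s in `]0%R, 1%R[) (g s * s ^+ 2) = 0.
Hypothesis g_sym : forall s : R, 0 < s < 1 -> g s = g (1 - s).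

(** By symmetry the moment of [(1 - s) ^+ 2] vanishes along with that of [s ^+ 2]; since
    [2 * s * (1 - s)] is 1 minus these two squares, its moment is the mean of [g], that is 1. *)
Lemma g_quadratic (A B C : R) :
  \int[leb]_(s in `]0%R, 1%R[) ((A * s ^+ 2 + B * (2 * s * (1 - s)) + C * (1 - s) ^+ 2) * g s)
  = B.
Proof.
have mI : measurable (`]0%R, 1%R[%classic : set mR) by exact: measurable_itv.
have c2 : continuous (fun s : R => s ^+ 2).
  by move=> s; apply: cvgM; exact: cvg_id.
have c1 : continuous (fun s : R => 1 - s).
  by move=> s; apply: cvgB; [exact: cvg_cst|exact: cvg_id].
have c3 : continuous (fun s : R => (1 - s) ^+ 2).
  by move=> s; apply: cvgM; exact: c1.
have i0 : leb.-integrable `]0%R, 1%R[ (EFin \o g) by [].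
have i2 := integrable_continuous_mul c2; have i3 := integrable_continuous_mul c3.
have e2 : \int[leb]_(s in `]0%R, 1%R[) (s ^+ 2 * g s) = 0.
  by rewrite -[RHS]g_moment; apply: eq_Rintegral => s _; rewrite mulrC.
have e3 : \int[leb]_(s in `]0%R, 1%R[) ((1 - s) ^+ 2 * g s) = 0.
  rewrite -[RHS]e2 -[RHS]Rintegral_reflect; last by apply/measurable_EFinP; exact: measurable_int i2.
  by apply: eq_Rintegral => s; rewrite inE/= in_itv/= => s01; rewrite (g_sym s01).
transitivity (\int[leb]_(s in `]0%R, 1%R[) (((A - B) * (s ^+ 2 * g s) + B * g s)
    + (C - B) * ((1 - s) ^+ 2 * g s))).
  by apply: eq_Rintegral => s _; ring.
have z (k : R) h : leb.-integrable (`]0%R, 1%R[%classic : set mR) (EFin \o h) ->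
    leb.-integrable (`]0%R, 1%R[%classic : set mR) (EFin \o (fun s => k * h s)).
  by move=> ih; apply: (@integrableZl _ _ _ _ _ mI k (EFin \o h)).
rewrite RintegralD//; last 2 first.
- by apply: (@integrableD _ _ _ _ _ mI (EFin \o _) (EFin \o _)); exact: z.
- exact: z.
rewrite RintegralD//; last 2 first.
- exact: z.
- exact: z.
by rewrite !RintegralZl// e2 e3 g_mean; ring.
Qed.

Variable delta : tri M -> R * R -> R.
Hypothesis delta_moment : forall K i,
  \int[mu]_(x in otri K) (delta K x * enorm (x - W K i) ^+ 2) = 0.
Variable psi : tri M -> 'I_3 -> R * R -> R * R.
Hypothesis psi_div : forall K i, is_div (otri K) (psi K i) (delta K).
Hypothesis psi_trace : forall K i, normal_trace K (psi K i) (gtrace K i).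

Lemma psi_green K i w : C1 w ->
  \int[mu]_(x in otri K) (dot (psi K i x) (grad w x) + w x * delta K x) =
  \int[leb]_(s in `]0%R, 1%R[) (w (edge_param K i s) * g s).
Proof.
move=> C1w; rewrite (trace_div (psi_trace K i) (psi_div K i) C1w).
by rewrite bdry_int_gtrace//; exact: C1_continuous.
Qed.

Lemma has_grad_sqdist (P : R * R) (k : R) :
  has_grad (fun x => k * dot (x - P) (x - P)) (fun x => (2 * k) *: (x - P)).
Proof.
have h1 := has_grad_affine (1 : R) 0 (- P.1); have h2 := has_grad_affine (0 : R) 1 (- P.2).
have [c1 d1 e1 f1] := has_gradM (has_grad_cst k) (has_gradM h1 h1).
have [c2 d2 e2 f2] := has_gradM (has_grad_cst k) (has_gradM h2 h2).
have E : (fun x => k * dot (x - P) (x - P)) =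
    (fun x => k * ((1 * x.1 + 0 * x.2 + - P.1) * (1 * x.1 + 0 * x.2 + - P.1)) +
              k * ((0 * x.1 + 1 * x.2 + - P.2) * (0 * x.1 + 1 * x.2 + - P.2))).
  by apply/funext => x; rewrite /dot !planeE; ring.
split.
- by rewrite E => x; apply: cvgD; [exact: c1|exact: c2].
- by move=> x; apply: cvgM; [exact: cvg_cst|exact: continuous_subr1].
- by move=> x; apply: cvgM; [exact: cvg_cst|exact: continuous_subr2].
- move=> x v; rewrite E; apply: is_derive_eq (is_deriveD (f1 x v) (f2 x v)) _.
  by rewrite /dot !planeE /=; ring.
Qed.

(* The gradient of [w] below is [rt_local K j] on [K]. *)
Lemma psi_rt K i j :
  \int[mu]_(x in otri K) dot (psi K i x) (rt_local K j x) =
  (i == j)%:R * (dot (eS K i - W K i) (eN K i - W K i) / (4 * area K)).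
Proof.
have mK := measurable_otri K; have [m Km] := otri_box K.
have a0 := area_gt0 K.
pose k := (4 * area K)^-1.
pose w x := k * dot (x - W K j) (x - W K j).
have Hw := has_grad_sqdist (W K j) k; have C1w : C1 w := has_grad_C1 Hw.
have [Lp Ld _] := psi_div K i.
have [i1 i2] := integrable_div mK Km Lp Ld C1w.
have := psi_green K i C1w; rewrite RintegralD//.
have -> : \int[mu]_(x in otri K) (w x * delta K x) = 0.
  transitivity (\int[mu]_(x in otri K) (k * (delta K x * enorm (x - W K j) ^+ 2))).
    by apply: eq_Rintegral => x _; rewrite sqr_enorm /w; ring.
  rewrite RintegralZl// ?delta_moment ?mulr0//.
  have ck : k != 0 by rewrite invr_eq0 gt_eqF// mulr_gt0.
  apply: (@eq_integrable _ _ _ _ _ mK (fun x => (k^-1)%:E * (w x * delta K x)%:E)%E).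
    by move=> x _; rewrite /= -EFinM sqr_enorm /w; congr EFin; field.
  exact: integrableZl.
have -> : \int[mu]_(x in otri K) dot (psi K i x) (grad w x) =
          \int[mu]_(x in otri K) dot (psi K i x) (rt_local K j x).
  apply: eq_Rintegral => x; rewrite inE => Kx; rewrite (has_grad_gradE Hw) rt_local_in//.
  by congr (dot _ (_ *: _)); rewrite /k; field; rewrite gt_eqF.
rewrite addr0 => ->.
(* Along edge [i] the quadratic [w] has the Bernstein coefficients [A], [B], [C]. The density [g]
   selects [B], which vanishes when [W K j] is an end point of the edge. *)
pose A := k * dot (eS K i - W K j) (eS K i - W K j).
pose B := k * dot (eS K i - W K j) (eN K i - W K j).
pose C := k * dot (eN K i - W K j) (eN K i - W K j).
transitivity (\int[leb]_(s in `]0%R, 1%R[)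
   ((A * s ^+ 2 + B * (2 * s * (1 - s)) + C * (1 - s) ^+ 2) * g s)).
  apply: eq_Rintegral => s _; congr (_ * _); rewrite /w /A /B /C /edge_param /dot !planeE.
  ring.
rewrite g_quadratic /B; case: (ord3P i j).
- by rewrite eqxx mul1r mulrC.
- by rewrite ord3_n01 mul0r -/(eS K i) subrr /dot /= !mul0r addr0 mulr0.
- by rewrite ord3_n02 mul0r -/(eN K i) subrr /dot /= !mulr0 addr0 mulr0.
Qed.

End EdgeDensity.

Lemma dot_cross_sq (u v : R * R) : dot u v ^+ 2 + cross u v ^+ 2 = dot u u * dot v v.
Proof. by rewrite /dot /cross; ring. Qed.

(** The sine of an [acos] is a nonnegative square root, here [|cross u v|] over the product of the
    lengths, and [|cross u v|] is twice the area. *)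
Lemma cot_angle K i :
  cot (angle K i) = dot (eS K i - W K i) (eN K i - W K i) / (2 * area K).
Proof.
rewrite areaE [2 * _]mulrC divfK ?pnatr_eq0// -(sarea2E K i) /cot /angle.
have := edge_cross_neq0 K i.
set u := eS K i - W K i; set v := eN K i - W K i => c0.
have uv := dot_cross_sq u v.
have cp : 0 < cross u v ^+ 2 by rewrite lt_neqAle sqr_ge0 eq_sym sqrf_eq0 c0.
have pos : 0 < dot u u * dot v v by rewrite -uv; have := sqr_ge0 (dot u v); lra.
have u0 : 0 < dot u u.
  by have := dot_ge0 u; rewrite le_eqVlt => /orP[/eqP e|//]; rewrite -e mul0r ltxx in pos.
have v0 : 0 < dot v v.
  by have := dot_ge0 v; rewrite le_eqVlt => /orP[/eqP e|//]; rewrite -e mulr0 ltxx in pos.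
set l := enorm u * enorm v.
have l0 : 0 < l by rewrite mulr_gt0// sqrtr_gt0.
have l2 : l ^+ 2 = dot u u * dot v v by rewrite exprMn !sqr_enorm.
set c := dot u v / l.
have c2 : 1 - c ^+ 2 = (`|cross u v| / l) ^+ 2.
  rewrite /c !expr_div_n l2 real_normK ?num_real//.
  have -> : 1 = (dot u v ^+ 2 + cross u v ^+ 2) / (dot u u * dot v v).
    by rewrite uv divff// gt_eqF.
  by rewrite -mulrBl addrC addKr.
have c11 : -1 <= c <= 1.
  rewrite -ler_norml -(@ler_pXn2r _ 2) ?nnegrE// expr1n real_normK ?num_real//.
  by have := sqr_ge0 (`|cross u v| / l); rewrite -c2; lra.
rewrite sin_acos// acosK ?in_itv//= c2 sqrtr_sqr ger0_norm; last first.
  by apply: divr_ge0; [exact: normr_ge0|exact: ltW].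
have n0 : `|cross u v| != 0 by rewrite normr_eq0.
have l1 : l != 0 by rewrite gt_eqF.
by rewrite /c; field; rewrite n0 l1.
Qed.

End Local.

(** * Global fields *)

Section Sums.
Variable R : realType.
Local Notation mR := (measurableTypeR R).
Local Notation mP := (measurableTypeR R * measurableTypeR R)%type.
Local Notation mu := (mu2 R).
Variables (m : R) (D : set mP).
Hypothesis mD : measurable D.
Hypothesis Dm : D `<=` box m.
Variables (I : Type) (s : seq I) (P : pred I) (c : I -> R).
Implicit Types (f : I -> R * R -> R * R) (d : I -> R * R -> R).

Lemma is_div_sum f d : (forall a, P a -> is_div D (f a) (d a)) ->
  is_div D (fun x => \sum_(a <- s | P a) c a *: f a x)
           (fun x => \sum_(a <- s | P a) c a * d a x).
Proof.
move=> H; elim: s => [|a s' IH].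
  rewrite (_ : (fun x => _) = fun=> 0); last by apply/funext => x; rewrite big_nil.
  rewrite (_ : (fun x => _) = fun=> 0); last by apply/funext => x; rewrite big_nil.
  exact: is_div0.
have [Pa|nPa] := boolP (P a); last first.
  under eq_fun do rewrite big_cons (negPf nPa).
  by under [X in is_div D _ X]eq_fun do rewrite big_cons (negPf nPa).
under eq_fun do rewrite big_cons Pa.
under [X in is_div D _ X]eq_fun do rewrite big_cons Pa.
apply: (is_divD mD Dm) => //; apply: (is_divZ _ mD Dm); exact: H.
Qed.

Lemma L2v_sum f : (forall a, P a -> L2v D (f a)) ->
  L2v D (fun x => \sum_(a <- s | P a) c a *: f a x).
Proof.
move=> H; elim: s => [|a s' IH].
  rewrite (_ : (fun x => _) = fun=> 0); last by apply/funext => x; rewrite big_nil.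
  by split; exact: L2_0.
have [Pa|nPa] := boolP (P a); last first.
  by under eq_fun do rewrite big_cons (negPf nPa).
under eq_fun do rewrite big_cons Pa.
have [h1 h2] := H a Pa; have [h3 h4] := IH.
by split; apply: L2D => //; exact: L2Z.
Qed.

Lemma ipv_suml f G : (forall a, P a -> L2v D (f a)) -> L2v D G ->
  ipv D (fun x => \sum_(a <- s | P a) c a *: f a x) G =
  \sum_(a <- s | P a) c a * ipv D (f a) G.
Proof.
move=> H LG.
(* Integrability of the partial sums joins the induction, because additivity of the integral asks
   for it. *)
suff [-> _] : ipv D (fun x => \sum_(a <- s | P a) c a *: f a x) G =
  \sum_(a <- s | P a) c a * ipv D (f a) G /\
  mu.-integrable D (fun x => (dot (\sum_(a <- s | P a) c a *: f a x) (G x))%:E) by [].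
elim: s => [|a s' [IH1 IH2]].
  have z : (fun x => dot (\sum_(a <- [::] | P a) c a *: f a x) (G x)) = fun=> 0.
    by apply/funext => x; rewrite big_nil /dot /= !mul0r addr0.
  rewrite big_nil; split.
    by rewrite /ipv z Rintegral_cst// mul0r.
  by rewrite -[fun x => _]/(EFin \o (fun x => dot (\sum_(a <- [::] | P a) c a *: f a x) (G x))) z;
    exact: integrable0.
have [Pa|nPa] := boolP (P a); last first.
  rewrite big_cons (negPf nPa) -IH1; split.
    by apply: eq_Rintegral => x _; rewrite big_cons (negPf nPa).
  by under eq_fun do rewrite big_cons (negPf nPa).
have ia := L2v_dot_integrable mD (H _ Pa) LG.
have ica : mu.-integrable D (fun x => (c a * dot (f a x) (G x))%:E).
  exact: (@integrableZl _ _ _ _ _ mD (c a) (fun x => (dot (f a x) (G x))%:E)).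
have E : (fun x => dot (\sum_(a0 <- a :: s' | P a0) c a0 *: f a0 x) (G x)) =
    (fun x => c a * dot (f a x) (G x) + dot (\sum_(a <- s' | P a) c a *: f a x) (G x)).
  by apply/funext => x; rewrite big_cons Pa dotDl dotZl.
split.
  rewrite /ipv E big_cons Pa (RintegralD mD ica IH2) -IH1; congr (_ + _).
  by rewrite (RintegralZl _ mD ia).
rewrite -[fun x => _]/(EFin \o (fun x => dot (\sum_(a0 <- a :: s' | P a0) c a0 *: f a0 x) (G x))).
by rewrite E; apply: (integrableD mD ica IH2).
Qed.

Lemma Rintegral_suml d : (forall a, P a -> mu.-integrable D (fun x => (d a x)%:E)) ->
  \int[mu]_(x in D) (\sum_(a <- s | P a) c a * d a x) =
  \sum_(a <- s | P a) c a * \int[mu]_(x in D) d a x.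
Proof.
move=> H.
suff [-> _] : \int[mu]_(x in D) (\sum_(a <- s | P a) c a * d a x) =
  \sum_(a <- s | P a) c a * \int[mu]_(x in D) d a x /\
  mu.-integrable D (fun x => (\sum_(a <- s | P a) c a * d a x)%:E) by [].
elim: s => [|a s' [IH1 IH2]].
  have z : (fun x => \sum_(a <- [::] | P a) c a * d a x) = fun=> 0.
    by apply/funext => x; rewrite big_nil.
  rewrite big_nil z; split; first by rewrite Rintegral_cst// mul0r.
  by rewrite -[fun x => _]/(EFin \o (fun x => \sum_(a <- [::] | P a) c a * d a x)) z;
    exact: integrable0.
have [Pa|nPa] := boolP (P a); last first.
  rewrite big_cons (negPf nPa) -IH1; split.
    by apply: eq_Rintegral => x _; rewrite big_cons (negPf nPa).
  by under eq_fun do rewrite big_cons (negPf nPa).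
have ia := H _ Pa.
have ica : mu.-integrable D (fun x => (c a * d a x)%:E).
  exact: (@integrableZl _ _ _ _ _ mD (c a) (fun x => (d a x)%:E)).
have E : (fun x => \sum_(a0 <- a :: s' | P a0) c a0 * d a0 x) =
    (fun x => c a * d a x + \sum_(a <- s' | P a) c a * d a x).
  by apply/funext => x; rewrite big_cons Pa.
split.
  rewrite E big_cons Pa (RintegralD mD ica IH2) -IH1; congr (_ + _).
  by rewrite (RintegralZl _ mD ia).
rewrite -[fun x => _]/(EFin \o (fun x => \sum_(a0 <- a :: s' | P a0) c a0 * d a0 x)).
by rewrite E; apply: (integrableD mD ica IH2).
Qed.

End Sums.

Lemma ipvC (R : realType) (D : set (R * R)) (f g : R * R -> R * R) : ipv D f g = ipv D g f.
Proof. by apply: eq_Rintegral => x _; rewrite dotC. Qed.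

(** [bounded_set] refers to the sup norm of [R * R], whose balls are squares. *)
Lemma bounded_box (R : realType) (A : set (R * R)) : bounded_set A ->
  exists m, A `<=` box m.
Proof.
move=> [m0 [_ H]]; exists (m0 + 1) => x Ax.
have := H (m0 + 1) ltac:(by rewrite ltrDl) x Ax.
rewrite /Num.norm/= ge_max => /andP[h1 h2].
by split; rewrite /= in_itv/= -ler_norml.
Qed.

(** * From local fields to fields on [Omega] *)

Section Assembly.
Variables (R : realType) (Omega : set (R * R)).
Hypothesis Omega_open : open Omega.
Hypothesis Omega_bounded : bounded_set Omega.
Hypothesis Omega_convex : convex_set Omega.
Variable M : mesh Omega.
Variable n : {set vtx M} -> R * R.
Hypothesis n_normal : edge_normals n.
Local Notation mR := (measurableTypeR R).
Local Notation mP := (measurableTypeR R * measurableTypeR R)%type.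
Local Notation leb := (@lebesgue_measure R).
Local Notation mu := (mu2 R).
Implicit Types (K L : tri M) (i j k : 'I_3) (x : R * R) (w : R * R -> R)
  (a b : {set vtx M}).

Let mO : measurable (Omega : set mP). Proof. exact: open_measurable_plane. Qed.
Let mT K : measurable (otri K : set mP). Proof. exact: measurable_otri. Qed.
Let TO K : otri K `<=` Omega. Proof. exact: otri_sub. Qed.

Lemma edge_sum_restrict (V : lmodType R) K a (F : tri M -> 'I_3 -> V) :
  (forall L i, L != K -> F L i = 0) ->
  edge_sum n a F = \sum_(i | edge K i == a) esgn n K i *: F K i.
Proof.
move=> F0; rewrite /edge_sum -(pair_big_dep xpredT (fun L i => edge L i == a)
  (fun L i => esgn n L i *: F L i)) /= (bigD1 K)//= [X in _ + X]big1 ?addr0// => L LK.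
by apply: big1 => i _; rewrite F0// scaler0.
Qed.

Lemma edge_eq_pred K i : (fun k => edge K k == edge K i) =1 pred1 i.
Proof. by move=> k /=; apply/eqP/eqP => [/edge_inj|->]. Qed.

(** * Assembly common to the Raviart-Thomas fields ([g = 1]) and the dual fields *)

Section Family.
Variables (g : R -> R) (loc : tri M -> 'I_3 -> R * R -> R * R) (dl : tri M -> R * R -> R).
Hypothesis g_integrable : leb.-integrable `]0%R, 1%R[ (fun s : R => (g s)%:E).
Hypothesis g_sym : forall s : R, 0 < s < 1 -> g s = g (1 - s).
Hypothesis loc_out : forall K i x, ~ otri K x -> loc K i x = 0.
Hypothesis loc_L2 : forall K i, L2v (otri K) (loc K i).
Hypothesis dl_out : forall K x, ~ otri K x -> dl K x = 0.
Hypothesis dl_L2 : forall K, L2 (otri K) (dl K).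
Hypothesis dl_mean : forall K, \int[mu]_(x in otri K) dl K x = 1.
Hypothesis loc_green : forall K i w, C1 w ->
  \int[mu]_(x in otri K) (dot (loc K i x) (grad w x) + w x * dl K x) =
  \int[leb]_(s in `]0%R, 1%R[) (w (edge_param K i s) * g s).
Variable phi : {set vtx M} -> R * R -> R * R.
Hypothesis phi_loc : assembled n loc phi.

Lemma loc_L2_Omega K i : L2v Omega (loc K i).
Proof.
have [h1 h2] := loc_L2 K i.
by split; apply: (L2_extend mO (mT K)) => // x Kx; rewrite loc_out.
Qed.

Lemma dl_L2_Omega K : L2 Omega (dl K).
Proof. by apply: (L2_extend mO (mT K)) => // x; exact: dl_out. Qed.

Lemma loc_green_Omega K i w : C1 w ->
  \int[mu]_(x in Omega) (dot (loc K i x) (grad w x) + w x * dl K x) =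
  \int[leb]_(s in `]0%R, 1%R[) (w (edge_param K i s) * g s).
Proof.
move=> C1w; rewrite -loc_green//; apply: Rintegral_zero_outside (TO (K:=K)) _ => x _ Kx.
by rewrite loc_out// dl_out// /dot /= !mul0r mulr0 !addr0.
Qed.

(** The two triangles may parametrize their edge in opposite directions; the symmetry of [g] makes
    the edge integrals match. *)
Lemma shared_edge_green K i L j w : continuous w -> edge K i = edge L j ->
  \int[leb]_(s in `]0%R, 1%R[) (w (edge_param K i s) * g s) =
  \int[leb]_(s in `]0%R, 1%R[) (w (edge_param L j s) * g s).
Proof.
move=> cw /edge_eqP[[h1 h2]|[h1 h2]].
  by apply: eq_Rintegral => s _; rewrite /edge_param h1 h2.
rewrite -Rintegral_reflect; last first.
  apply/measurable_EFinP.
  have := @integrable_continuous_mul R g g_integrable (fun s => w (edge_param K i s)).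
  move=> H; apply: measurable_int (H _).
  by move=> s; apply: continuous_comp; [exact: continuous_edge_param|exact: cw].
apply: eq_Rintegral => s; rewrite inE/= in_itv/= => s01; rewrite -(g_sym s01).
congr (w _ * _); rewrite /edge_param h1 h2 addrC; congr (_ *: _ + _).
by ring.
Qed.

Definition assembled_div a x : R := edge_sum n a (fun K i => dl K x : R^o).

(** On an interior edge the two edge integrals cancel. On a boundary edge the integral vanishes,
    since the test function is supported inside the open set [Omega], which the edge does not
    meet. *)
Lemma is_div_assembled a : a \in edges M -> is_div Omega (phi a) (assembled_div a).
Proof.
have [m Om] := bounded_box Omega_bounded => ae.
have -> : phi a = fun x => edge_sum n a (fun K i => loc K i x).
  by apply/funext => x; exact: assembledE.
case: (edge_cases Omega_open n_normal ae) => [[K [i H]]|[K [i [L [j H]]]]].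
  rewrite (_ : (fun x => _) = loc K i); last by apply/funext => x; rewrite (dc1_sum n_normal _ H).
  rewrite (_ : assembled_div a = dl K); last first.
    by apply/funext => x; rewrite /assembled_div (dc1_sum n_normal _ H).
  split; [exact: loc_L2_Omega|exact: dl_L2_Omega|move=> w [C1w [C [_ CO C0]]]].
  rewrite loc_green_Omega// (@eq_Rintegral _ _ _ _ _ (fun=> 0)).
    by rewrite Rintegral_cst ?mul0r//; exact: measurable_itv.
  move=> s; rewrite inE/= in_itv/= => /andP[s0 s1]; rewrite C0 ?mul0r// => /CO Os.
  have [[_ ab] aE _] := H; have /ab[_ no] : edge_seg a (edge_param K i s).
    by rewrite aE; apply/edge_segP; exists s; rewrite ?(ltW s0) ?(ltW s1).
  by apply: no; rewrite (interior_id _).1.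
have [_ KL aK aL _] := H.
have sE x : edge_sum n a (fun K i => loc K i x) = loc K i x - loc L j x.
  by rewrite (dc2_sum n_normal _ H).
have dE x : assembled_div a x = dl K x - dl L x.
  by rewrite /assembled_div (dc2_sum n_normal _ H).
rewrite (funext sE) (funext dE).
have [k1 k2] := loc_L2_Omega K i; have [l1 l2] := loc_L2_Omega L j.
have LN (f h : R * R -> R) : L2 Omega f -> L2 Omega h -> L2 Omega (fun x => f x - h x).
  move=> Lf Lh; have := L2D mO Lf (L2Z (-1) mO Lh).
  by apply: L2_eq => // x _; rewrite mulN1r.
split; [by split; exact: LN|by apply: LN; exact: dl_L2_Omega|move=> w [C1w _]].
have [i1 i2] := integrable_div mO Om (conj k1 k2) (dl_L2_Omega K) C1w.
have [i3 i4] := integrable_div mO Om (conj l1 l2) (dl_L2_Omega L) C1w.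
have c12 := integrableD mO i1 i2; have c34 := integrableD mO i3 i4.
transitivity (\int[mu]_(x in Omega) ((dot (loc K i x) (grad w x) + w x * dl K x) -
                                 (dot (loc L j x) (grad w x) + w x * dl L x))).
  by apply: eq_Rintegral => x _; rewrite dotDl dotNl; ring.
rewrite (RintegralB mO c12 c34) !loc_green_Omega//.
rewrite (@shared_edge_green K i L j) ?subrr// -?aK//; exact: C1_continuous.
Qed.

Lemma is_div_lincomb (c : {set vtx M} -> R) : is_div Omega (lincomb phi c)
  (fun x => \sum_(a in edges M) c a * assembled_div a x).
Proof.
have [m Om] := bounded_box Omega_bounded.
by apply: (is_div_sum mO Om) => a ae; exact: is_div_assembled.
Qed.

Lemma lincomb_div_in K (c : {set vtx M} -> R) x : otri K x ->
  \sum_(a in edges M) c a * assembled_div a x =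
  (\sum_i c (edge K i) * esgn n K i) * dl K x.
Proof.
move=> Kx; rewrite mulr_suml.
rewrite [RHS](partition_big (edge K) (mem (edges M)))/=; last by move=> i _; exact: edge_edges.
apply: eq_bigr => a _; rewrite /assembled_div (edge_sum_restrict (K := K)); last first.
  move=> L i LK; apply: dl_out; apply: otri_disjoint Kx.
  by rewrite eq_sym.
rewrite mulr_sumr; apply: eq_bigr => i /eqP <-.
by rewrite [_ *: _]/(_ * _) mulrA.
Qed.

(** Since [dl K] has integral one, neither [g] nor [dl] appears in the result: tested against
    piecewise constants, the divergences of both families act in the same way on coefficients. *)
Lemma wdiv_lincomb K (c : {set vtx M} -> R) :
  \int[mu]_(x in otri K) wdiv Omega (lincomb phi c) x =
  \sum_i c (edge K i) * esgn n K i.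
Proof.
have [m Om] := bounded_box Omega_bounded.
have D1 := is_div_lincomb c; have D2 := wdivP (ex_intro _ _ D1).
have KO : otr (W K 0) (eS K 0 - W K 0) (eN K 0 - W K 0) `<=` Omega.
  by rewrite -otriE; exact: TO.
have := div_unique (edge_cross_neq0 K 0) mO Om KO D2 D1 (@C1_cst R 1).
rewrite -otriE => E.
transitivity (\int[mu]_(x in otri K) (1 * wdiv Omega (lincomb phi c) x)).
  by apply: eq_Rintegral => x _; rewrite mul1r.
rewrite E.
transitivity (\int[mu]_(x in otri K) ((\sum_i c (edge K i) * esgn n K i) * dl K x)).
  by apply: eq_Rintegral => x; rewrite inE => Kx; rewrite mul1r (lincomb_div_in _ Kx).
have [m' Km] := otri_box K.
by rewrite (RintegralZl _ (mT K) (L2_integrable (mT K) Km (dl_L2 K))) dl_mean mulr1.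
Qed.

Lemma wdiv_L2 (c : {set vtx M} -> R) : L2 Omega (wdiv Omega (lincomb phi c)).
Proof. by have [] := wdivP (ex_intro _ _ (is_div_lincomb c)). Qed.

Lemma phi_L2 a : a \in edges M -> L2v Omega (phi a).
Proof. by case/is_div_assembled. Qed.

End Family.

Lemma ip_P0 (c : tri M -> R) (h : R * R -> R) : L2 Omega h ->
  ip Omega (P0_of c) h = \sum_K c K * \int[mu]_(x in otri K) h x.
Proof.
have [m Om] := bounded_box Omega_bounded => Lh.
transitivity (\int[mu]_(x in Omega) (\sum_K c K * (\1_(otri K) x * h x))).
  apply: eq_Rintegral => x _; rewrite /P0_of mulr_suml; apply: eq_bigr => K _.
  by rewrite mulrA.
rewrite (Rintegral_suml mO); last first.
  move=> K _; apply: L2M_integrable => //; split.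
    exact: measurable_indic.
  have := L2_continuous (m := m) (w := fun=> 1) (@cst_continuous _ _ _) (mT K)
     (subset_trans (TO (K:=K)) Om).
  have e : forall x, ~ otri K x -> \1_(otri K) x = 0 :> R.
    by move=> x Kx; rewrite indicE memNset.
  move=> L1; have L1' : L2 (otri K) (\1_(otri K) : R * R -> R).
    by apply: L2_eq L1 => // x Kx; rewrite indicE mem_set.
  by have [_] := L2_extend mO (mT K) (TO (K:=K)) e L1'.
apply: eq_bigr => K _; congr (_ * _).
rewrite (Rintegral_zero_outside (TO (K:=K))); last first.
  by move=> x _ Kx; rewrite indicE memNset// mul0r.
by apply: eq_Rintegral => x; rewrite inE => Kx; rewrite indicE mem_set// mul1r.
Qed.

Lemma rt_local_in_family phi : assembled n (@rt_local R Omega M) phi ->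
  (forall a, a \in edges M -> L2v Omega (phi a)) /\
  (forall K c, \int[mu]_(x in otri K) wdiv Omega (lincomb phi c) x =
     \sum_i c (edge K i) * esgn n K i) /\
  (forall c, L2 Omega (wdiv Omega (lincomb phi c))).
Proof.
move=> H; pose dl (K : tri M) x : R := \1_(otri K) x / area K.
have gi : leb.-integrable `]0%R, 1%R[ (fun s : R => (1 : R)%:E).
  by apply: (@continuous_integrable01 R (fun=> 1)); exact: cst_continuous.
have d0 K x : ~ otri K x -> dl K x = 0 by move=> Kx; rewrite /dl indicE memNset// mul0r.
have dL K : L2 (otri K) (dl K) by exact: L2_cst_otri.
have gs (s : R) : 0 < s < 1 -> (1:R) = 1 by [].
have tr K i w : C1 w -> _ := @rt_local_trace R Omega M K i w.
split; [|split].
- by move=> a; exact: (@phi_L2 (fun=> 1) _ dl gi gs (@rt_local_out _ _ M)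
    (@L2v_rt_local _ _ M) d0 dL tr phi H).
- by move=> K c; exact: (@wdiv_lincomb (fun=> 1) _ dl gi gs (@rt_local_out _ _ M)
    (@L2v_rt_local _ _ M) d0 dL (@mean_rt_div _ _ M) tr phi H).
- by move=> c; exact: (@wdiv_L2 (fun=> 1) _ dl gi gs (@rt_local_out _ _ M)
    (@L2v_rt_local _ _ M) d0 dL tr phi H).
Qed.

End Assembly.

(** * The VF4 scheme *)

Lemma linear_inj_surj (F : fieldType) N (f : {linear 'rV[F]_N -> 'rV[F]_N}) :
  (forall v, f v = 0 -> v = 0) -> forall b, exists v, f v = b.
Proof.
move=> finj b.
have U : lin1_mx f \in unitmx.
  by rewrite -row_free_unit; apply: inj_row_free => v; rewrite mul_rV_lin1; exact: finj.
by exists (b *m invmx (lin1_mx f)); rewrite -mul_rV_lin1 mulmxKV.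
Qed.

Section Fluxes.
Variables (R : realType) (Omega : set (R * R)).
Hypothesis Omega_open : open Omega.
Variable M : mesh Omega.
Variable n : {set vtx M} -> R * R.
Hypothesis n_normal : edge_normals n.
Implicit Types (K L : tri M) (i j k : 'I_3) (a b : {set vtx M}) (c : tri M -> R).

(** On a boundary edge the signed sum has the single term [c K], as if [c] were extended by zero:
    this encodes the Dirichlet condition. *)
Definition jump c a : R := edge_sum n a (fun K _ => c K : R^o).

Lemma jump_dc1 c a K i : dc1 n a K i -> jump c a = c K.
Proof. by move=> H; rewrite /jump (dc1_sum n_normal _ H). Qed.

Lemma jump_dc2 c a K i L j : dc2 n a K i L j -> jump c a = c K - c L.
Proof. by move=> H; rewrite /jump (dc2_sum n_normal _ H). Qed.

Lemma jumpE c a : jump c a =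
  \sum_(p : tri M * 'I_3 | edge p.1 p.2 == a) esgn n p.1 p.2 * c p.1.
Proof. by []. Qed.

(** Signs square to one, so an unsigned sum over the triangles at an edge becomes a signed one,
    which [dc1_sum] and [dc2_sum] evaluate. *)
Lemma edge_sumE (G : tri M -> 'I_3 -> R) a :
  \sum_(p : tri M * 'I_3 | edge p.1 p.2 == a) G p.1 p.2 =
  edge_sum n a (fun K i => esgn n K i * G K i : R^o).
Proof.
apply: eq_bigr => p _; rewrite /GRing.scale/= mulrA.
by rewrite (esgn_sq n_normal) mul1r.
Qed.

Lemma edge_partition (G : tri M -> 'I_3 -> R) :
  \sum_K \sum_i G K i =
  \sum_(a in edges M) \sum_(p : tri M * 'I_3 | edge p.1 p.2 == a) G p.1 p.2.
Proof.
rewrite pair_big /= (partition_big (fun p : tri M * 'I_3 => edge p.1 p.2) (mem (edges M)))//=.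
by move=> p _; exact: edge_edges.
Qed.

(** Discrete integration by parts: pairs of a triangle and one of its edges are regrouped by edge,
    so the divergence is adjoint to the jump. *)
Lemma sum_by_parts c (e : {set vtx M} -> R) :
  \sum_K c K * (\sum_i e (edge K i) * esgn n K i) = \sum_(a in edges M) e a * jump c a.
Proof.
under eq_bigr do rewrite mulr_sumr.
rewrite edge_partition; apply: eq_bigr => a _; rewrite jumpE mulr_sumr.
by apply: eq_bigr => p /eqP <-; ring.
Qed.

(* Outward flux of the field [x] through edge [i]. *)
Definition edge_moment K i : R := elen K i * dot (outnormal K i) (eS K i).

(** [eS L j] may be the other end point, but the normal component of the position is constant along
    the edge. *)
Lemma edge_moment_opp K i L j : K != L -> edge K i = edge L j ->
  edge_moment L j = - edge_moment K i.
Proof.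
move=> KL E; rewrite /edge_moment (elen_eq E) (outnormal_opp KL E) dotNl mulrN.
congr (- (_ * _)); case: (edge_eqP E) => -[-> _] //.
by have /eqP := dot_outnormal_edge K i; rewrite dotDr dotNr subr_eq0 => /eqP ->.
Qed.

(** The shoelace formula; the orientation sign in the outward normals turns the signed area into its
    absolute value. *)
Lemma edge_moment_sum K : \sum_i edge_moment K i = `|sarea2 K|.
Proof.
have E i : edge_moment K i = Num.sg (sarea2 K) * cross (eS K i) (eN K i).
  rewrite /edge_moment outnormalE dotZl; have l0 := elen_gt0 K i.
  rewrite mulrA [elen K i * _]mulrC divfK ?gt_eqF//.
  by rewrite /dot /rotcw /cross /=; ring.
rewrite (eq_bigr _ (fun i _ => E i)) -mulr_sumr -(sarea2E K 0).
have -> : \sum_i cross (eS K i) (eN K i) = cross (eS K 0 - W K 0) (eN K 0 - W K 0).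
  by rewrite (sum3 0) eS_succ eN_succ eS_pred eN_pred /cross !planeE; ring.
by rewrite -normrEsg.
Qed.

(* Divergence theorem for the field [x]: without jumps, the fluxes weighted by
   [c ^+ 2] cancel edge by edge, and they sum to twice the weighted area. *)
Lemma jump_inj c : (forall a, a \in edges M -> jump c a = 0) -> forall K, c K = 0.
Proof.
move=> H.
have S0 : \sum_K \sum_i c K ^+ 2 * edge_moment K i = 0.
  rewrite (edge_partition (fun K i => c K ^+ 2 * edge_moment K i)).
  apply: big1 => a ae; rewrite (edge_sumE (fun K i => c K ^+ 2 * edge_moment K i)).
  have := H a ae.
  case: (edge_cases Omega_open n_normal ae) => [[K [i D]]|[K [i [L [j D]]]]].
    rewrite (jump_dc1 _ D) (dc1_sum n_normal _ D) => ->.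
    by rewrite expr0n /= mul0r mulr0.
  rewrite (jump_dc2 _ D) (dc2_sum n_normal _ D) => /eqP; rewrite subr_eq0 => /eqP ->.
  have [sK sL] := dc2_esgn D; have [_ KL aK aL _] := D.
  have E : edge K i = edge L j by rewrite -aK.
  by rewrite sK sL (edge_moment_opp KL E); ring.
(* The square makes every term nonnegative, so that a vanishing sum forces each term to vanish. *)
have S1 : \sum_K c K ^+ 2 * `|sarea2 K| = 0.
  by rewrite -[RHS]S0; apply: eq_bigr => K _; rewrite -mulr_sumr edge_moment_sum.
move=> K; have /eqP := S1; rewrite psumr_eq0; last by move=> L _; rewrite mulr_ge0// sqr_ge0.
move=> /allP/(_ K (mem_index_enum _))/eqP/eqP.
by rewrite mulf_eq0 normr_eq0 (negPf (sarea2_neq0 K)) orbF sqrf_eq0 => /eqP.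
Qed.

Variable m : {set vtx M} -> R.
Hypothesis m_gt0 : forall a, a \in edges M -> 0 < m a.

(** The VF4 operator for arbitrary edge weights [m]; with [m] the function [half_cot] it is the
    balance with the VF4 fluxes inserted. *)
Definition stiff c K : R := \sum_i jump c (edge K i) / m (edge K i) * esgn n K i.

Lemma stiff_inj c : (forall K, stiff c K = 0) -> forall K, c K = 0.
Proof.
move=> H; apply: jump_inj.
have S0 : \sum_(a in edges M) jump c a / m a * jump c a = 0.
  rewrite -(sum_by_parts c (fun a => jump c a / m a)).
  by apply: big1 => K _; rewrite -/(stiff c K) H mulr0.
have pos a : a \in edges M -> 0 <= jump c a / m a * jump c a.
  by move=> /m_gt0 ma; rewrite mulrAC -expr2 divr_ge0 ?sqr_ge0 ?ltW.
move=> a ae; have /eqP := S0; rewrite psumr_eq0//.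
move=> /allP/(_ a (mem_index_enum _))/implyP/(_ ae).
have ma := m_gt0 ae.
by rewrite !mulf_eq0 invr_eq0 (gt_eqF ma) orbF orbb => /eqP.
Qed.

Lemma jump_linear (t : R) c c' a :
  jump (fun K => t * c K + c' K) a = t * jump c a + jump c' a.
Proof.
rewrite !jumpE mulr_sumr -big_split /=; apply: eq_bigr => p _; ring.
Qed.

Lemma stiff_linear (t : R) c c' K :
  stiff (fun K => t * c K + c' K) K = t * stiff c K + stiff c' K.
Proof.
rewrite /stiff mulr_sumr -big_split /=; apply: eq_bigr => i _.
by rewrite jump_linear; ring.
Qed.

Lemma stiff_surj (F : tri M -> R) : exists c, forall K, stiff c K = F K.
Proof.
pose N := #|{: tri M}|.
pose fc (v : 'rV[R]_N) : tri M -> R := fun K => v 0 (enum_rank K).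
pose f (v : 'rV[R]_N) : 'rV[R]_N := \row_p stiff (fc v) (enum_val p).
have lf : linear f.
  move=> t u v; apply/rowP => p; rewrite !mxE -stiff_linear; congr stiff.
  by apply/funext => K; rewrite /fc !mxE.
pose f' : {linear 'rV[R]_N -> 'rV[R]_N} := HB.pack f (GRing.isLinear.Build R _ _ _ f lf).
have finj v : f' v = 0 -> v = 0.
  move=> fv; have Z : forall K, fc v K = 0.
    apply: stiff_inj => K; have /rowP/(_ (enum_rank K)) := fv.
    by rewrite !mxE enum_rankK.
  apply/rowP => p; rewrite mxE; have := Z (enum_val p).
  by rewrite /fc enum_valK.
have [v fv] := linear_inj_surj finj (\row_p F (enum_val p)).
exists (fc v) => K; have /rowP/(_ (enum_rank K)) := fv.
by rewrite !mxE enum_rankK.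
Qed.

Lemma stiff_unique c c' : (forall K, stiff c K = stiff c' K) -> forall K, c K = c' K.
Proof.
move=> H; have Z : forall K, (fun K => -1 * c K + c' K) K = 0.
  by apply: stiff_inj => K; rewrite stiff_linear H mulN1r addNr.
by move=> K; have := Z K; rewrite mulN1r => /eqP; rewrite addrC subr_eq0 => /eqP.
Qed.

End Fluxes.

(** * Circumcenters and cotangents *)

Section Circumcenter.
Variables (R : realType) (Omega : set (R * R)) (M : mesh Omega).
Hypothesis Omega_open : open Omega.
Implicit Types (K L : tri M) (i j k : 'I_3) (a b : {set vtx M}) (c : tri M -> R).
Hypothesis angle_acute : forall (K : tri M) (i : 'I_3), 0 < angle K i < pi / 2.
Variable n : {set vtx M} -> R * R.
Hypothesis n_normal : edge_normals n.
Variables (xc : tri M -> R * R) (d : {set vtx M} -> R).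
Hypothesis xc_circumcenter : circumcenters xc.
Hypothesis d_def : vf4_dist n xc d.

Lemma cot_gt0 K i : 0 < cot (angle K i).
Proof.
have /andP[h1 h2] := angle_acute K i; have p0 := pi_gt0 R.
by rewrite divr_gt0// ?cos_gt0_pihalf ?sin_gt0_pi//; apply/andP; split; lra.
Qed.

Lemma equidistant (x u v : R * R) : enorm (x - u) = enorm (x - v) ->
  2 * dot (x - u) (v - u) = dot (v - u) (v - u).
Proof.
move=> /(congr1 (fun t => t ^+ 2)); rewrite !sqr_enorm.
by rewrite /dot !planeE => h; move: h; lra.
Qed.

(** The circumcenter lies on the perpendicular bisector of the edge, at signed distance
    [elen K i * cot / 2] from the midpoint towards the inside. Equidistance from the vertices gives
    two linear equations, [h1] and [h2], that determine it. *)
Lemma circumcenterE K i : xc K = 2^-1 *: (eS K i + eN K i) -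
  (elen K i * (cot (angle K i) / 2)) *: outnormal K i.
Proof.
have h1 := equidistant (xc_circumcenter K i (i + 1)).
have h2 := equidistant (xc_circumcenter K i (i + 2%:R)).
rewrite -/(eS K i) in h1; rewrite -/(eN K i) in h2.
rewrite outnormalE cot_angle areaE [2 * (_ / 2)]mulrC divfK ?pnatr_eq0// scalerA.
have l0 := elen_gt0 K i.
set q := dot (eS K i - W K i) (eN K i - W K i).
have -> : elen K i * (q / `|sarea2 K| / 2) * (- Num.sg (sarea2 K) / elen K i) =
   - (q / (2 * sarea2 K)).
  have A0 := sarea2_neq0 K.
  have sA : Num.sg (sarea2 K) = `|sarea2 K| / sarea2 K.
    by rewrite normrEsg mulfK.
  have l1 : elen K i != 0 by rewrite gt_eqF.
  by rewrite sA; field; rewrite A0 normr_eq0 A0 l1.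
rewrite scaleNr opprK -(sarea2E K i).
have A0 := edge_cross_neq0 K i.
move: h1 h2 A0; rewrite /q /dot /cross /rotcw !planeE /=.
set x := xc K; set w := W K i; set s := eS K i; set t := eN K i => h1 h2 A0.
apply: plane_eq; rewrite !planeE /=.
  (* Each coordinate is compared after multiplication by twice the determinant; [e] expresses it by
     Cramer's rule through the left-hand sides of [h1] and [h2]. *)
  apply: (@mulIf _ (2 * ((s.1 - w.1) * (t.2 - w.2) - (s.2 - w.2) * (t.1 - w.1)))).
    by rewrite mulf_neq0 ?pnatr_eq0.
  rewrite [RHS](_ : _ = 
    ((s.1 + t.1) * ((s.1 - w.1) * (t.2 - w.2) - (s.2 - w.2) * (t.1 - w.1)) +
    ((s.1 - w.1) * (t.1 - w.1) + (s.2 - w.2) * (t.2 - w.2)) * (s.2 - t.2))); last by field.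
  have e : x.1 * (2 * ((s.1 - w.1) * (t.2 - w.2) - (s.2 - w.2) * (t.1 - w.1))) =
    2 * w.1 * ((s.1 - w.1) * (t.2 - w.2) - (s.2 - w.2) * (t.1 - w.1)) +
    (2 * ((x.1 - w.1) * (s.1 - w.1) + (x.2 - w.2) * (s.2 - w.2))) * (t.2 - w.2) -
    (2 * ((x.1 - w.1) * (t.1 - w.1) + (x.2 - w.2) * (t.2 - w.2))) * (s.2 - w.2) by ring.
  by rewrite e h1 h2; ring.
apply: (@mulIf _ (2 * ((s.1 - w.1) * (t.2 - w.2) - (s.2 - w.2) * (t.1 - w.1)))).
  by rewrite mulf_neq0 ?pnatr_eq0.
rewrite [RHS](_ : _ =
    ((s.2 + t.2) * ((s.1 - w.1) * (t.2 - w.2) - (s.2 - w.2) * (t.1 - w.1)) +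
    ((s.1 - w.1) * (t.1 - w.1) + (s.2 - w.2) * (t.2 - w.2)) * (t.1 - s.1))); last by field.
have e : x.2 * (2 * ((s.1 - w.1) * (t.2 - w.2) - (s.2 - w.2) * (t.1 - w.1))) =
    2 * w.2 * ((s.1 - w.1) * (t.2 - w.2) - (s.2 - w.2) * (t.1 - w.1)) +
    (2 * ((x.1 - w.1) * (t.1 - w.1) + (x.2 - w.2) * (t.2 - w.2))) * (s.1 - w.1) -
    (2 * ((x.1 - w.1) * (s.1 - w.1) + (x.2 - w.2) * (s.2 - w.2))) * (t.1 - w.1) by ring.
by rewrite e h1 h2; ring.
Qed.

(** The sum runs over the one or two triangles at [a]; by [ipv_phiS_phi] this is the diagonal scalar
    product of the two bases. *)
Definition half_cot a : R :=
  \sum_(p : tri M * 'I_3 | edge p.1 p.2 == a) cot (angle p.1 p.2) / 2.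

Lemma half_cot_dc2 a K i L j : dc2 n a K i L j ->
  half_cot a = 2^-1 * (cot (angle K i) + cot (angle L j)).
Proof.
move=> D; rewrite /half_cot (edge_sumE n_normal (fun K i => cot (angle K i) / 2)).
rewrite (dc2_sum n_normal _ D); have [-> ->] := dc2_esgn D; ring.
Qed.

Lemma half_cot_dc1 a K i : dc1 n a K i -> half_cot a = 2^-1 * cot (angle K i).
Proof.
move=> D; rewrite /half_cot (edge_sumE n_normal (fun K i => cot (angle K i) / 2)).
rewrite (dc1_sum n_normal _ D) (dc1_esgn D); ring.
Qed.

Lemma half_cot_gt0 a : a \in edges M -> 0 < half_cot a.
Proof.
move=> /edgesP[K [i ->]]; rewrite /half_cot (bigD1 (K, i))//=.
apply: ltr_wpDr; last by apply: divr_gt0; [exact: cot_gt0|exact: ltr0n].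
by apply: sumr_ge0 => p _; apply: divr_ge0; [exact/ltW/cot_gt0|exact: ler0n].
Qed.

(** Both circumcenters lie on the perpendicular bisector of the edge, and acute angles put them on
    opposite sides of it, so their distances to the midpoint add up. *)
Lemma vf4_dist_dc2 a K i L j : dc2 n a K i L j -> d a = elen K i * half_cot a.
Proof.
move=> D; rewrite (d_def.1 _ _ _ _ _ D) (half_cot_dc2 D).
have [_ KL aK aL _] := D; have E : edge K i = edge L j by rewrite -aK.
have hK := circumcenterE K i; have hL := circumcenterE L j.
have -> : xc K - xc L =
   (- (elen K i * (2^-1 * (cot (angle K i) + cot (angle L j))))) *: outnormal K i.
  rewrite hK hL (elen_eq E) (outnormal_opp KL E).
  have -> : eS L j + eN L j = eS K i + eN K i.
    by case: (edge_eqP E) => -[-> ->]; [|exact: addrC].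
  by apply: plane_eq; rewrite !planeE; ring.
rewrite enormZ enorm_outnormal mulr1 normrN ger0_norm// mulr_ge0 ?(ltW (elen_gt0 _ _))//.
by rewrite mulr_ge0 ?invr_ge0// addr_ge0// ltW// cot_gt0.
Qed.

Lemma dot_enorm_le (u v : R * R) : dot v v = 1 -> `|dot u v| <= enorm u.
Proof.
move=> v1; rewrite -(@ler_pXn2r _ 2) ?nnegrE ?enorm_ge0// real_normK ?num_real//.
by rewrite sqr_enorm -[leRHS]mulr1 -v1 -dot_cross_sq lerDl sqr_ge0.
Qed.

Lemma midpoint_sub (u v w : R * R) (h s : R) :
  2^-1 *: (u + v) - h *: w - (s *: u + (1 - s) *: v) = (2^-1 - s) *: (u - v) - h *: w.
Proof. by apply: plane_eq; rewrite !planeE; field. Qed.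

(** The infimum is attained at the midpoint: the vector from any point of the edge to the
    circumcenter has component [- h] along the unit normal, so its length is at least [h]. *)
Lemma vf4_dist_dc1 a K i : dc1 n a K i -> d a = elen K i * half_cot a.
Proof.
move=> D; rewrite (d_def.2 _ _ _ D) (half_cot_dc1 D).
have [_ aK _] := D.
set h := elen K i * _.
have h0 : 0 <= h.
  by rewrite mulr_ge0 ?(ltW (elen_gt0 _ _))// mulr_ge0 ?invr_ge0// ltW// cot_gt0.
have xE : xc K = 2^-1 *: (eS K i + eN K i) - h *: outnormal K i.
  by rewrite (circumcenterE K i) /h [cot _ / 2]mulrC.
have lb : lbound [set r | exists2 y, edge_seg a y & r = enorm (xc K - y)] h.
  move=> r [y]; rewrite aK => /edge_segP[s _ ->] ->.
  apply: le_trans (dot_enorm_le _ (dot_outnormal K i)).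
  have -> : xc K - (s *: eS K i + (1 - s) *: eN K i) =
     (2^-1 - s) *: (eS K i - eN K i) - h *: outnormal K i.
    by rewrite xE midpoint_sub.
  have e : dot (eS K i - eN K i) (outnormal K i) = 0 by rewrite dotC dot_outnormal_edge.
  rewrite dotDl dotZl e mulr0 add0r dotNl dotZl dot_outnormal.
  by rewrite mulr1 normrN ger0_norm.
have at_mid : [set r | exists2 y, edge_seg a y & r = enorm (xc K - y)] h.
  exists (2^-1 *: eS K i + (1 - 2^-1) *: eN K i).
    rewrite aK; apply/edge_segP; exists 2^-1 => //.
    by apply/andP; split; lra.
  have -> : xc K - (2^-1 *: eS K i + (1 - 2^-1) *: eN K i) = (- h) *: outnormal K i.
    by rewrite xE midpoint_sub subrr scale0r sub0r scaleNr.
  by rewrite enormZ enorm_outnormal mulr1 normrN ger0_norm.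
apply/eqP; rewrite eq_le /edist_set; apply/andP; split.
  by apply: ge_inf at_mid; exists h.
by apply: lb_le_inf => //; exists h.
Qed.

(** The edge length in the flux cancels against the one in [d a], which is
    [elen K i * half_cot a]. *)
Lemma vf4_fluxesP c p : vf4_fluxes n d c p <->
  forall a, a \in edges M -> p a = - (jump n c a / half_cot a).
Proof.
have l0 K i : elen K i != 0 by rewrite gt_eqF// elen_gt0.
split=> [[F2 F1] a ae|H].
  have m0 : half_cot a != 0 by rewrite gt_eqF// half_cot_gt0.
  case: (edge_cases Omega_open n_normal ae) => [[K [i D]]|[K [i [L [j D]]]]].
    rewrite (F1 _ _ _ D) (vf4_dist_dc1 D) (jump_dc1 n_normal _ D).
    by field; rewrite l0 m0.
  rewrite (F2 _ _ _ _ _ D) (vf4_dist_dc2 D) (jump_dc2 n_normal _ D).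
  by field; rewrite l0 m0.
split=> [a K i L j D|a K i D].
  have ae : a \in edges M by case: D => -[].
  have m0 : half_cot a != 0 by rewrite gt_eqF// half_cot_gt0.
  rewrite H// (vf4_dist_dc2 D) (jump_dc2 n_normal _ D).
  by field; rewrite l0 m0.
have ae : a \in edges M by case: D => -[].
have m0 : half_cot a != 0 by rewrite gt_eqF// half_cot_gt0.
rewrite H// (vf4_dist_dc1 D) (jump_dc1 n_normal _ D).
by field; rewrite l0 m0.
Qed.

End Circumcenter.

(** * The dual basis and the discrete problem *)

Section DualBasis.
Variables (R : realType) (Omega : set (R * R)).
Hypothesis Omega_open : open Omega.
Hypothesis Omega_bounded : bounded_set Omega.
Hypothesis Omega_convex : convex_set Omega.
Variable M : mesh Omega.
Hypothesis angle_acute : forall (K : tri M) (i : 'I_3), 0 < angle K i < pi / 2.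
Variable n : {set vtx M} -> R * R.
Hypothesis n_normal : edge_normals n.
Variables (g : R -> R) (gloc : tri M -> 'I_3 -> R * R -> R).
Hypothesis g_integrable :
  lebesgue_measure.-integrable `]0%R, 1%R[ (fun s : R => (g s)%:E).
Hypothesis g_mean : \int[lebesgue_measure]_(s in `]0%R, 1%R[) g s = 1.
Hypothesis g_moment : \int[lebesgue_measure]_(s in `]0%R, 1%R[) (g s * s ^+ 2) = 0.
Hypothesis g_sym : forall s : R, 0 < s < 1 -> g s = g (1 - s).
Hypothesis gloc_def : forall (K : tri M) (i : 'I_3) (s : R), 0 < s < 1 ->
  gloc K i (s *: eS K i + (1 - s) *: eN K i) = g s / elen K i.
Variable delta : tri M -> R * R -> R.
Hypothesis delta_L2 : forall K : tri M, L2 (otri K) (delta K).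
Hypothesis delta_mean : forall K : tri M, \int[mu2 R]_(x in otri K) delta K x = 1.
Hypothesis delta_moment : forall (K : tri M) (i : 'I_3),
  \int[mu2 R]_(x in otri K) (delta K x * enorm (x - W K i) ^+ 2) = 0.
Variable psi : tri M -> 'I_3 -> R * R -> R * R.
Hypothesis psi_out : forall (K : tri M) (i : 'I_3) (x : R * R), ~ otri K x -> psi K i x = 0.
Hypothesis psi_div : forall (K : tri M) (i : 'I_3), is_div (otri K) (psi K i) (delta K).
Hypothesis psi_trace : forall (K : tri M) (i : 'I_3),
  normal_trace K (psi K i) (gtrace gloc K i).
Variables phi phiS : {set vtx M} -> R * R -> R * R.
Hypothesis phi_RT : assembled n (@rt_local R Omega M) phi.
Hypothesis phiS_def : assembled n psi phiS.
Local Notation mR := (measurableTypeR R).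
Local Notation mP := (measurableTypeR R * measurableTypeR R)%type.
Local Notation leb := (@lebesgue_measure R).
Local Notation mu := (mu2 R).
Implicit Types (K L : tri M) (i j k : 'I_3) (x : R * R) (w : R * R -> R)
  (a b : {set vtx M}).

Let mO : measurable (Omega : set mP). Proof. exact: open_measurable_plane. Qed.
Let mT K : measurable (otri K : set mP). Proof. exact: measurable_otri. Qed.
Let TO K : otri K `<=` Omega. Proof. exact: otri_sub. Qed.

(** [delta K] is constrained only on its own triangle; cutting it off makes it a function on [Omega]
    as the assembly requires. *)
Let dl K x : R := \1_(otri K) x * delta K x.

Let dl_in K x : otri K x -> dl K x = delta K x.
Proof. by move=> Kx; rewrite /dl indicE mem_set// mul1r. Qed.

Let dl_out K x : ~ otri K x -> dl K x = 0.
Proof. by move=> Kx; rewrite /dl indicE memNset// mul0r. Qed.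

Let dl_L2 K : L2 (otri K) (dl K).
Proof. by apply: L2_eq (delta_L2 K) => // x /dl_in ->. Qed.

Let dl_mean K : \int[mu]_(x in otri K) dl K x = 1.
Proof. by rewrite -(delta_mean K); apply: eq_Rintegral => x; rewrite inE => /dl_in. Qed.

Let psi_L2 K i : L2v (otri K) (psi K i).
Proof. by case: (psi_div K i). Qed.

Let psi_dl_green K i w : C1 w ->
  \int[mu]_(x in otri K) (dot (psi K i x) (grad w x) + w x * dl K x) =
  \int[leb]_(s in `]0%R, 1%R[) (w (edge_param K i s) * g s).
Proof.
move=> C1w; rewrite -(psi_green g_integrable gloc_def psi_div psi_trace K i C1w).
by apply: eq_Rintegral => x; rewrite inE => /dl_in ->.
Qed.

Lemma phiS_is_div a : a \in edges M -> is_div Omega (phiS a) (assembled_div n dl a).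
Proof.
exact: (is_div_assembled Omega_open Omega_bounded Omega_convex n_normal g_integrable
  g_sym psi_out psi_L2 dl_out dl_L2 psi_dl_green phiS_def).
Qed.

Lemma phiS_L2 a : a \in edges M -> L2v Omega (phiS a).
Proof. by case/phiS_is_div. Qed.

Lemma wdiv_lincomb_phiS K c :
  \int[mu]_(x in otri K) wdiv Omega (lincomb phiS c) x = \sum_i c (edge K i) * esgn n K i.
Proof.
exact: (wdiv_lincomb Omega_open Omega_bounded Omega_convex n_normal g_integrable
  g_sym psi_out psi_L2 dl_out dl_L2 dl_mean psi_dl_green phiS_def).
Qed.

Lemma wdiv_L2_phiS c : L2 Omega (wdiv Omega (lincomb phiS c)).
Proof.
exact: (wdiv_L2 Omega_open Omega_bounded Omega_convex n_normal g_integrable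
  g_sym psi_out psi_L2 dl_out dl_L2 psi_dl_green phiS_def).
Qed.

Let RT := rt_local_in_family Omega_open Omega_bounded Omega_convex n_normal phi_RT.

Lemma psi_L2_Omega K i : L2v Omega (psi K i).
Proof. exact: (loc_L2_Omega Omega_open Omega_convex psi_out psi_L2). Qed.

Lemma rt_L2_Omega K i : L2v Omega (rt_local K i).
Proof.
exact: (loc_L2_Omega Omega_open Omega_convex (@rt_local_out _ _ M) (@L2v_rt_local _ _ M)).
Qed.

Lemma ipv_psi_rt (p q : tri M * 'I_3) :
  ipv Omega (psi p.1 p.2) (rt_local q.1 q.2) =
  (p == q)%:R * (cot (angle p.1 p.2) / 2).
Proof.
case: p q => [K i] [L j] /=; rewrite /ipv.
rewrite (Rintegral_zero_outside (TO (K:=K))); last first.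
  by move=> x _ Kx; rewrite psi_out// /dot /= !mul0r addr0.
have [<-|KL] := eqVneq K L; last first.
  rewrite (@eq_Rintegral _ _ _ _ _ (fun=> 0)).
    by rewrite Rintegral_cst// xpair_eqE (negPf KL) !mul0r.
  move=> x; rewrite inE => Kx; rewrite rt_local_out; first by rewrite /dot /= !mulr0 addr0.
  exact: otri_disjoint Kx.
rewrite (psi_rt g_integrable gloc_def g_mean g_moment g_sym delta_moment psi_div psi_trace).
rewrite xpair_eqE eqxx /= cot_angle; congr (_ * _).
by have a0 := area_gt0 K; field; rewrite gt_eqF.
Qed.

Lemma phiE a : a \in edges M -> phi a = fun x =>
  \sum_(p : tri M * 'I_3 | edge p.1 p.2 == a) esgn n p.1 p.2 *: rt_local p.1 p.2 x.
Proof. by move=> ae; apply/funext => x; exact: (assembledE Omega_open n_normal _ phi_RT ae). Qed.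

Lemma phiSE a : a \in edges M -> phiS a = fun x =>
  \sum_(p : tri M * 'I_3 | edge p.1 p.2 == a) esgn n p.1 p.2 *: psi p.1 p.2 x.
Proof. by move=> ae; apply/funext => x; exact: (assembledE Omega_open n_normal _ phiS_def ae). Qed.

(** The local fields are biorthogonal by [ipv_psi_rt], so only equal pairs survive in the double
    sum; their signs square to one and leave the unsigned sum [half_cot]. *)
Lemma ipv_phiS_phi a b : a \in edges M -> b \in edges M ->
  ipv Omega (phiS a) (phi b) = (a == b)%:R * half_cot a.
Proof.
move=> ae be; have Lphi := RT.1 b be.
rewrite (phiSE ae) (ipv_suml mO) => [|p _|//]; last exact: psi_L2_Omega.
have E p : ipv Omega (psi p.1 p.2) (phi b) =
    (edge p.1 p.2 == b)%:R * (esgn n p.1 p.2 * (cot (angle p.1 p.2) / 2)).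
  rewrite (phiE be) ipvC (ipv_suml mO) => [|q _|]; [|exact: rt_L2_Omega|exact: psi_L2_Omega].
  have Eq q : esgn n q.1 q.2 * ipv Omega (rt_local q.1 q.2) (psi p.1 p.2) =
      if q == p then esgn n p.1 p.2 * (cot (angle p.1 p.2) / 2) else 0.
    rewrite ipvC ipv_psi_rt eq_sym; case: eqP => [->|_]; first by rewrite mul1r.
    by rewrite mul0r mulr0.
  rewrite (eq_bigr _ (fun q _ => Eq q)) -big_mkcondr /=.
  have [pb|pb] := boolP (edge p.1 p.2 == b).
    rewrite mul1r (big_pred1 p)// => q /=.
    by have [->|_] := eqVneq q p; rewrite ?pb ?andbF.
  rewrite mul0r big_pred0// => q; apply/negP => /andP[qb /eqP qp].
  by move: pb; rewrite -qp qb.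
rewrite /half_cot mulr_sumr; apply: eq_bigr => p /eqP <-; rewrite E.
by rewrite [LHS](_ : _ = (edge p.1 p.2 == b)%:R * (esgn n p.1 p.2 * esgn n p.1 p.2 *
  (cot (angle p.1 p.2) / 2))); [rewrite (esgn_sq n_normal) mul1r|ring].
Qed.

Lemma phiS_in K a x : a \in edges M -> otri K x -> phiS a x =
  \sum_(i | edge K i == a) esgn n K i *: psi K i x.
Proof.
move=> ae Kx; rewrite (phiSE ae) -[LHS]/(edge_sum n a (fun L i => psi L i x)).
rewrite (@edge_sum_restrict _ _ _ n _ K)// => L i LK; apply: psi_out; apply: otri_disjoint Kx.
by rewrite eq_sym.
Qed.

Lemma edge_int_gtrace1 K i k : edge_int K k (gtrace gloc K i) = (k == i)%:R.
Proof.
have := edge_int_gtrace g_integrable gloc_def K i k (@cst_continuous _ _ (1 : R)).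
have -> : (fun x => 1 * gtrace gloc K i x) = gtrace gloc K i.
  by apply/funext => x; rewrite mul1r.
move=> ->; rewrite -[RHS]mulr1 -[X in _ = _ * X]g_mean; congr (_ * _).
by apply: eq_Rintegral => s _; rewrite mul1r.
Qed.

Lemma phiS_trace a : a \in edges M -> exists h : tri M -> R * R -> R,
  (forall K, normal_trace K (phiS a) (h K)) /\
  (forall b K i, b = edge K i ->
     dot (n b) (outnormal K i) * edge_int K i (h K) = (a == b)%:R).
Proof.
move=> ae.
(* At most one edge of [K] equals [a], so [h K] is a signed [gtrace] on the triangles at [a] and
   zero on all others. *)
pose h K x : R := \sum_(i | edge K i == a) esgn n K i * gtrace gloc K i x.
have h_edge K i : edge K i = a -> h K = fun x => esgn n K i * gtrace gloc K i x.
  move=> E; apply/funext => x; rewrite /h (big_pred1 i)// => k.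
  by rewrite -E edge_eq_pred.
have h_none K : (forall i, edge K i != a) -> h K = fun=> 0.
  by move=> H; apply/funext => x; rewrite /h big_pred0// => i; exact/negbTE.
have cases K : (exists i, edge K i = a) \/ (forall i, edge K i != a).
  have [[i E]|H] := pselect (exists i, edge K i = a); first by left; exists i.
  by right => i; apply/eqP => E; apply: H; exists i.
have zint i K : edge_int K i (fun=> 0) = 0.
  by rewrite /edge_int Rintegral_cst ?mul0r ?mulr0//; exact: measurable_itv.
have pull i k K (c : R) w : continuous w ->
    edge_int K k (fun x => w x * (c * gtrace gloc K i x)) =
    c * edge_int K k (fun x => w x * gtrace gloc K i x).
  move=> cw; have H := @edge_int_gtrace _ _ _ g gloc g_integrable gloc_def K i k.
  have -> : (fun x => w x * (c * gtrace gloc K i x)) = (fun x => (c * w x) * gtrace gloc K i x).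
    by apply/funext => x; ring.
  have cw' : continuous (fun x => c * w x).
    by move=> x; apply: cvgM; [exact: cvg_cst|exact: cw].
  rewrite (H _ cw') (H _ cw) mulrCA; congr (_ * _).
  have I := integrable_continuous_mul g_integrable
    (h := fun s => w (edge_param K i s)).
  rewrite -RintegralZl//; first by apply: eq_Rintegral => s _; rewrite mulrA.
  apply: I => s; apply: continuous_comp; [exact: continuous_edge_param|exact: cw].
exists h; split=> [K|b K i ->].
  have [m Km] := otri_box K.
  case: (cases K) => [[i E]|H].
    rewrite (h_edge _ _ E).
    have pE x : otri K x -> esgn n K i *: psi K i x = phiS a x.
      by move=> Kx; rewrite (phiS_in ae Kx) (big_pred1 i)// => k; rewrite -E edge_eq_pred.
    apply: (@ntrace_of_div _ _ _ _ _ _ (fun x => esgn n K i * delta K x)).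
    + apply: (is_div_eq (mT K) pE (fun _ _ => erefl)).
      exact: (is_divZ _ (mT K) Km).
    + move=> k; have mI : measurable (`]0%R, 1%R[%classic : set mR) by exact: measurable_itv.
      apply: (@integrableZl _ _ _ _ _ mI (esgn n K i)
        (fun s => (gtrace gloc K i (edge_param K k s))%:E)).
      exact: (integrable_gtrace g_integrable gloc_def).
    + move=> w C1w; rewrite /bdry_int.
      rewrite (eq_bigr _ (fun k _ => pull i k K (esgn n K i) w (C1_continuous C1w))).
      rewrite -mulr_sumr -/(bdry_int K (fun x => w x * gtrace gloc K i x)).
      rewrite -(trace_div (psi_trace K i) (psi_div K i) C1w).
      have [Lp Ld _] := psi_div K i.
      have [i1 i2] := integrable_div (mT K) Km Lp Ld C1w.
      rewrite -(RintegralZl _ (mT K) (integrableD (mT K) i1 i2)).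
      by apply: eq_Rintegral => x; rewrite inE => Kx; rewrite -pE// dotZl; ring.
  rewrite (h_none _ H).
  have pE x : otri K x -> 0 = phiS a x.
    by move=> Kx; rewrite (phiS_in ae Kx) big_pred0// => i; exact/negbTE.
  apply: (@ntrace_of_div _ _ _ _ _ _ (fun=> 0)).
  + exact: is_div_eq (mT K) pE (fun _ _ => erefl) (is_div0 (mT K)).
  + by move=> k; exact: (@continuous_integrable01 R (fun=> 0) (@cst_continuous _ _ _)).
  + move=> w C1w; rewrite /bdry_int big1.
      rewrite (@eq_Rintegral _ _ _ _ _ (fun=> 0)) ?Rintegral_cst ?mul0r//.
      by move=> x; rewrite inE => Kx; rewrite -pE// /dot /= !mul0r mulr0 !addr0.
    move=> k _; have -> : (fun x => w x * 0) = fun=> 0 by apply/funext => x; rewrite mulr0.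
    exact: zint.
(* The trace carries the factor [esgn] and the flux multiplies it by [esgn] again, so the flux is 1
   as seen from either side of the edge. *)
have [aE|aE] := eqVneq a (edge K i).
  rewrite (h_edge K i)//.
  have := pull i i K (esgn n K i) _ (@cst_continuous _ _ (1 : R)).
  have e1 (f : R * R -> R) : (fun x => 1 * f x) = f by apply/funext => x; rewrite mul1r.
  rewrite !e1 => ->; rewrite edge_int_gtrace1 eqxx mulr1.
  exact: (esgn_sq n_normal).
case: (cases K) => [[k E]|H]; last by rewrite (h_none _ H) zint mulr0.
rewrite (h_edge _ _ E).
have := pull k i K (esgn n K k) _ (@cst_continuous _ _ (1 : R)).
have e1 (f : R * R -> R) : (fun x => 1 * f x) = f by apply/funext => x; rewrite mul1r.
rewrite !e1 => ->; rewrite edge_int_gtrace1.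
have -> : (i == k) = false by apply/eqP => ik; move: aE; rewrite -E ik eqxx.
by rewrite !mulr0.
Qed.

(** The inclusion holds pointwise before null sets are discarded: on an open triangle at [a] the
    field [phi a] is a nonzero multiple of the vector from a vertex, which vanishes only at that
    vertex. *)
Lemma phiS_support a : a \in edges M -> esupp (phiS a) `<=` esupp (phi a).
Proof.
move=> ae x Sx U Ux ng; apply: (Sx U Ux); apply: negligibleS ng.
move=> y [Uy]; rewrite /= => phiS0; split => // phi0; apply: phiS0.
have [[K Ky]|noK] := pselect (exists K, otri K y); last first.
  rewrite (phiSE ae) big1// => p _; rewrite psi_out ?scaler0// => Ky.
  by apply: noK; exists p.1.
have H := phi0; rewrite (phiE ae) -[LHS]/(edge_sum n a (fun L i => rt_local L i y)) in H.
rewrite (@edge_sum_restrict _ _ _ n _ K) in H; last first.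
  move=> L i LK; apply: rt_local_out; apply: otri_disjoint Ky; by rewrite eq_sym.
rewrite (phiS_in ae Ky); apply: big1 => i /eqP E; exfalso.
rewrite (big_pred1 i) in H; last by move=> k; rewrite -E edge_eq_pred.
move: H; rewrite rt_local_in// => /eqP; rewrite !scaler_eq0.
have a0 := area_gt0 K.
have s0 : esgn n K i != 0.
  by apply/eqP => z; have /eqP := esgn_sq n_normal K i; rewrite z mul0r eq_sym oner_eq0.
rewrite (negPf s0) /= invr_eq0 mulf_eq0 pnatr_eq0 (gt_eqF a0) /= subr_eq0 => /eqP yW.
have /otriP/(_ (i + 1)) := Ky; rewrite yW bary_vertex eq_sym ord3_n01.
by rewrite ltxx.
Qed.

Lemma dual_basis : rt_dual_basis n phi phiS.
Proof.
split.
- by move=> a ae; exists (assembled_div n dl a); exact: phiS_is_div.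
- by move=> a ae; rewrite ipv_phiS_phi// eqxx mul1r gt_eqF// half_cot_gt0.
- by move=> a b ae be ab; rewrite ipv_phiS_phi// (negPf ab) mul0r.
- exact: phiS_support.
- exact: phiS_trace.
Qed.

Lemma ipv_lincomb (p e : {set vtx M} -> R) :
  ipv Omega (lincomb phi p) (lincomb phiS e) =
  \sum_(a in edges M) e a * (half_cot a * p a).
Proof.
have Le : L2v Omega (lincomb phiS e).
  by apply: (L2v_sum mO) => b be; exact: phiS_L2.
rewrite /lincomb (ipv_suml mO) => [|a ae|//]; last exact: RT.1.
apply: eq_bigr => a ae; rewrite ipvC (ipv_suml mO) => [|b be|]; last exact: RT.1.
  rewrite (bigD1 a)//= big1 ?addr0.
    by rewrite ipv_phiS_phi// eqxx mul1r; ring.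
  by move=> b /andP[be ba]; rewrite ipv_phiS_phi// (negPf ba) mul0r mulr0.
exact: phiS_L2.
Qed.

Lemma ipC (f h : R * R -> R) : ip Omega f h = ip Omega h f.
Proof. by apply: eq_Rintegral => x _; rewrite mulrC. Qed.

(** The Gram matrix of the two bases is diagonal, so a single dual field as test function isolates
    one flux, and the indicator of a single triangle isolates one balance. *)
Lemma petrov_galerkinP f c p : L2 Omega f ->
  petrov_galerkin phi phiS f (P0_of c) (lincomb phi p) <->
  (forall a, a \in edges M -> p a = - (jump n c a / half_cot a)) /\
  vf4_scheme n f p.
Proof.
move=> Lf.
have E1 e : ipv Omega (lincomb phi p) (lincomb phiS e) +
    ip Omega (P0_of c) (wdiv Omega (lincomb phiS e)) =
    \sum_(a in edges M) e a * (half_cot a * p a + jump n c a).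
  rewrite ipv_lincomb ip_P0//; last exact: wdiv_L2_phiS.
  rewrite (eq_bigr _ (fun K _ => congr1 _ (wdiv_lincomb_phiS K e))).
  rewrite sum_by_parts -big_split /=; apply: eq_bigr => a _; ring.
have E2 c' : ip Omega (wdiv Omega (lincomb phi p)) (P0_of c') =
    \sum_K c' K * (\sum_i p (edge K i) * esgn n K i).
  rewrite ipC ip_P0//; last exact: RT.2.2.
  by apply: eq_bigr => K _; rewrite RT.2.1.
have E3 (c' : tri M -> R) : ip Omega f (P0_of c') = \sum_K c' K * \int[mu]_(x in otri K) f x.
  by rewrite ipC (ip_P0 Omega_open Omega_bounded Omega_convex c' Lf).
have sE K : \sum_i dot (n (edge K i)) (outnormal K i) * p (edge K i) =
    \sum_i p (edge K i) * esgn n K i.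
  by apply: eq_bigr => i _; rewrite mulrC.
split=> [[_ _ H]|[H1 H2]].
  split=> [a ae|K].
    have [] := H (P0_of (fun _ : tri M => 0)) (lincomb phiS (fun b => (b == a)%:R)).
    - by exists (fun=> 0).
    - by eexists.
    rewrite E1 (bigD1 a)//= eqxx mul1r big1 ?addr0.
      move=> /eqP; rewrite addr_eq0 => /eqP h _.
      have m0 : half_cot a != 0 by rewrite gt_eqF// half_cot_gt0.
      by rewrite -mulNr -h mulrC mulKf.
    by move=> b /andP[_ /negPf ->]; rewrite mul0r.
  have [] := H (P0_of (fun L => (L == K)%:R)) (lincomb phiS (fun=> 0)).
  - by eexists.
  - by eexists.
  have pick (G : tri M -> R) : \sum_L (L == K)%:R * G L = G K.
    rewrite (bigD1 K)//= eqxx mul1r big1 ?addr0//.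
    by move=> L /negPf ->; rewrite mul0r.
  by move=> _; rewrite E2 E3 sE !pick.
split; [by exists c|by exists p|move=> v q [c' ->] [e ->]]; split.
  rewrite E1 big1// => a ae; rewrite H1//.
  have m0 : half_cot a != 0 by rewrite gt_eqF// half_cot_gt0.
  by rewrite mulrN [half_cot a * _]mulrC divfK// addNr mulr0.
rewrite E2 E3 -sumrN; apply: eq_bigr => K _.
by rewrite -mulrN -sE H2.
Qed.

End DualBasis.

Theorem theorem1 (R : realType) (Omega : set (R * R))
    (Omega_open : open Omega) (Omega_bounded : bounded_set Omega)
    (Omega_convex : convex_set Omega) (Omega_polygonal : polygonal_bdry Omega)
    (M : mesh Omega)
    (angle_acute : forall (K : tri M) (i : 'I_3), 0 < angle K i < pi / 2)
    (n : {set vtx M} -> R * R) (n_normal : edge_normals n)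
    (g : R -> R)
    (g_integrable :
       lebesgue_measure.-integrable `]0%R, 1%R[ (fun s : R => (g s)%:E))
    (g_mean : \int[lebesgue_measure]_(s in `]0%R, 1%R[) g s = 1)
    (g_moment : \int[lebesgue_measure]_(s in `]0%R, 1%R[) (g s * s ^+ 2) = 0)
    (g_sym : forall s : R, 0 < s < 1 -> g s = g (1 - s))
    (gloc : tri M -> 'I_3 -> R * R -> R)
    (gloc_def : forall (K : tri M) (i : 'I_3) (s : R), 0 < s < 1 ->
       gloc K i (s *: eS K i + (1 - s) *: eN K i) = g s / elen K i)
    (delta : tri M -> R * R -> R)
    (delta_L2 : forall K : tri M, L2 (otri K) (delta K))
    (delta_mean : forall K : tri M,
       \int[mu2 R]_(x in otri K) delta K x = 1)
    (delta_moment : forall (K : tri M) (i : 'I_3),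
       \int[mu2 R]_(x in otri K) (delta K x * enorm (x - W K i) ^+ 2) = 0)
    (phiS_loc : tri M -> 'I_3 -> R * R -> R * R)
    (phiS_loc_out : forall (K : tri M) (i : 'I_3) (x : R * R),
       ~ otri K x -> phiS_loc K i x = 0)
    (phiS_loc_div : forall (K : tri M) (i : 'I_3),
       is_div (otri K) (phiS_loc K i) (delta K))
    (phiS_loc_trace : forall (K : tri M) (i : 'I_3),
       normal_trace K (phiS_loc K i)
         (fun x : R * R => gloc K i x * \1_(edge_seg (edge K i)) x))
    (phi : {set vtx M} -> R * R -> R * R)
    (phi_RT : assembled n (@rt_local R Omega M) phi)
    (phiS : {set vtx M} -> R * R -> R * R)
    (phiS_def : assembled n phiS_loc phiS)
    (xc : tri M -> R * R) (xc_circumcenter : circumcenters xc)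
    (d : {set vtx M} -> R) (d_def : vf4_dist n xc d) :
  [/\ rt_dual_basis n phi phiS,
      (forall (a : {set vtx M}) (K : tri M) (i : 'I_3) (L : tri M) (j : 'I_3),
         dc2 n a K i L j ->
         ipv Omega (phiS a) (phi a) =
         2^-1 * (cot (angle K i) + cot (angle L j))) /\
      (forall (a : {set vtx M}) (K : tri M) (i : 'I_3),
         dc1 n a K i ->
         ipv Omega (phiS a) (phi a) = 2^-1 * cot (angle K i)) &
      forall f : R * R -> R, L2 Omega f ->
        (exists! up : (R * R -> R) * (R * R -> R * R),
           petrov_galerkin phi phiS f up.1 up.2) /\
        (forall (u : R * R -> R) (p : R * R -> R * R),
           petrov_galerkin phi phiS f u p <->
           exists (c : tri M -> R) (pf : {set vtx M} -> R),
             [/\ u = P0_of c, vf4_fluxes n d c pf, vf4_scheme n f pf &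
                 p = lincomb phi pf])].
Proof.
have ipE := ipv_phiS_phi Omega_open Omega_bounded Omega_convex n_normal g_integrable
  g_mean g_moment g_sym gloc_def delta_moment phiS_loc_out phiS_loc_div phiS_loc_trace
  phi_RT phiS_def.
have PG := petrov_galerkinP Omega_open Omega_bounded Omega_convex angle_acute n_normal
  g_integrable g_mean g_moment g_sym gloc_def delta_L2 delta_mean delta_moment
  phiS_loc_out phiS_loc_div phiS_loc_trace phi_RT phiS_def.
have FL := vf4_fluxesP Omega_open angle_acute n_normal xc_circumcenter d_def.
have m0 := half_cot_gt0 angle_acute.
split.
- exact: (dual_basis Omega_open Omega_bounded Omega_convex angle_acute n_normal
    g_integrable g_mean g_moment g_sym gloc_def delta_L2 delta_moment
    phiS_loc_out phiS_loc_div phiS_loc_trace phi_RT phiS_def).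
- split=> [a K i L j D|a K i D].
    have ae : a \in edges M by case: D => -[].
    by rewrite ipE// eqxx mul1r (half_cot_dc2 n_normal D).
  have ae : a \in edges M by case: D => -[].
  by rewrite ipE// eqxx mul1r (half_cot_dc1 n_normal D).
move=> f Lf.
have equiv u p : petrov_galerkin phi phiS f u p <->
    exists (c : tri M -> R) (pf : {set vtx M} -> R),
      [/\ u = P0_of c, vf4_fluxes n d c pf, vf4_scheme n f pf & p = lincomb phi pf].
  split=> [H|[c [pf [-> /FL H1 H2 ->]]]]; last by apply/PG.
  have [[c uE] [pf pE] _] := H; exists c, pf.
  by move: H; rewrite uE pE => /(PG _ _ _ Lf)[/FL H1 H2].
split=> //.
have scheme_stiff c pf : vf4_fluxes n d c pf ->
    (vf4_scheme n f pf <->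
     forall K, stiff n (@half_cot R Omega M) c K = \int[mu2 R]_(x in otri K) f x).
  move=> /FL H.
  have E K : - (\sum_i dot (n (edge K i)) (outnormal K i) * pf (edge K i)) =
      stiff n (@half_cot R Omega M) c K.
    rewrite -sumrN; apply: eq_bigr => i _.
    by rewrite H ?edge_edges// mulrN opprK mulrC.
  by split=> h K; rewrite -?E ?h//; rewrite E h.
have [c cE] := stiff_surj Omega_open n_normal m0 (fun K => \int[mu2 R]_(x in otri K) f x).
pose pf a := - (jump n c a / half_cot a).
have Fpf : vf4_fluxes n d c pf by apply/FL.
exists (P0_of c, lincomb phi pf); split=> [/=|[u p] /= /equiv[c' [pf' [-> F' S' ->]]]].
  by apply/equiv; exists c, pf; split => //; apply/(scheme_stiff _ _ Fpf).
have S := (scheme_stiff _ _ F').1 S'.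
have cc : c = c'.
  apply/funext; apply: (stiff_unique Omega_open n_normal m0) => K.
  by rewrite cE S.
congr pair; first by rewrite cc.
(* Coefficients outside [edges M] are unconstrained, so the fluxes are compared only under the
   sum. *)
apply/funext => x; apply: eq_bigr => a ae; congr (_ *: _).
by move/FL : F' => ->//; rewrite /pf cc.
Qed.
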